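(* Let $K\subset\mathbb C$ be compact and let $\eta\in M_0^+(\mathbb C)$ be such that $\mathcal C\eta$ is continuous on $\mathbb C$. Suppose that $f\in L^\infty(\eta)$ with $\|f\|_{L^\infty(\eta)}\le1$ and that $\mathcal C(f\eta)$ is continuous on $\mathbb C$. Then $\mathcal C(f\eta)\in L(\mathcal C\eta,K)$.
   Context: $C(K)$ is the space of continuous complex functions on $K$ with the sup norm. $M_0^+(\mathbb C)$: finite positive Borel measures with compact support in $\mathbb C$. The Cauchy transform of a finite complex compactly supported Borel measure $\nu$ is $\mathcal C\nu(z)=\lim_{\epsilon\to0}\int_{|w-z|>\epsilon}\frac{d\nu(w)}{w-z}$ where the limit exists; ''$\mathcal C\nu$ is continuous on $\mathbb C$'' means it agrees $\mathcal L^2$-a.e. (planar Lebesgue measure) with a continuous function on $\mathbb C$, with which it is identified. $L(\mathcal C\eta,K)$ is the closure in $C(K)$ of $\{T_\varphi(\mathcal C\eta):\varphi$ smooth with compact support$\}$, where $(T_\varphi g)(\lambda)=\frac1\pi\int\frac{g(z)-g(\lambda)}{z-\lambda}\bar\partial\varphi(z)\,d\mathcal L^2(z)$; one has $T_\varphi(\mathcal C\eta)=\mathcal C(\varphi\eta)$ $\mathcal L^2$-a.e. *)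

(* Defs.v *)
From HB Require Import structures.
From mathcomp Require Import all_boot all_order all_algebra.
From mathcomp Require Import all_classical all_reals all_analysis.
From mathcomp Require Import complex.
Import Order.TTheory GRing.Theory Num.Theory.
Import numFieldNormedType.Exports.
Import ComplexField.Normc.
Set Implicit Arguments.
Unset Strict Implicit.
Unset Printing Implicit Defensive.
Local Open Scope classical_set_scope.
Local Open Scope ring_scope.

(* Points of the complex plane are pairs [p : R * R], so that topology, Borel
   sigma-algebra (which is the product one), Lebesgue measure and real partial
   derivatives are the library's; [toC p] is the corresponding complex number.
   Complex values are in [R[i]]; the alias [R[i]^o] carries the topology and
   uniformity of the modulus. *)
Definition toC (R : realType) (p : R * R) : R[i] := Complex p.1 p.2.

(* The same type with the measurable structure on which Lebesgue measure is
   defined. *)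
Notation mplane R := (measurableTypeR R * measurableTypeR R)%type.

Definition planar_lebesgue (R : realType) : {measure set (mplane R) -> \bar R} :=
  (@lebesgue_measure R \x @lebesgue_measure R)%E.

Definition measure_support (R : realType)
    (mu : {measure set (mplane R) -> \bar R}) : set (R * R) :=
  [set z | forall U : set (R * R), open U -> U z -> (0 < mu U)%E].

Definition cintegral (R : realType) (mu : {measure set (mplane R) -> \bar R})
    (D : set (R * R)) (h : R * R -> R[i]) : R[i] :=
  Complex (\int[mu]_(z in D) complex.Re (h z)) (\int[mu]_(z in D) complex.Im (h z)).

(* The complex measure [f mu] is given by its density [f] with respect to the
   positive measure [mu]: integrating [h] against [f mu] means integrating
   [h * f] against [mu].  The measure [mu] itself is the case [f = cst 1]. *)
Definition cauchy_trunc (R : realType) (mu : {measure set (mplane R) -> \bar R})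
    (f : R * R -> R[i]) (z : R * R) (e : R) : R[i] :=
  cintegral mu [set w | e < normc (toC w - toC z)]
    (fun w => (toC w - toC z)^-1 * f w).

(* The Cauchy transform of [f mu] is continuous, and is identified with [g]. *)
Definition continuous_cauchy_transform (R : realType)
    (mu : {measure set (mplane R) -> \bar R}) (f : R * R -> R[i])
    (g : R * R -> R[i]^o) : Prop :=
  continuous g /\
  {ae @planar_lebesgue R, forall z, cauchy_trunc mu f z e @[e --> 0^'+] --> g z}.

Definition complex_measurable (R : realType) (f : R * R -> R[i]) : Prop :=
  measurable_fun [set: mplane R] (fun z => complex.Re (f z)) /\
  measurable_fun [set: mplane R] (fun z => complex.Im (f z)).

Definition Linfty_norm (R : realType) (mu : {measure set (mplane R) -> \bar R})
    (f : R * R -> R[i]) : \bar R :=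
  ('N[mu]_(+oo)[(fun z => (normc (f z))%:E)])%E.

Definition dx (R : realType) (u : R * R -> R) (z : R * R) : R := 'D_((1, 0) : R * R) u z.
Definition dy (R : realType) (u : R * R -> R) (z : R * R) : R := 'D_((0, 1) : R * R) u z.

Fixpoint Cn (R : realType) (n : nat) (u : R * R -> R) : Prop :=
  if n is m.+1 then
    [/\ continuous u,
        forall z, derivable u z (1, 0) /\ derivable u z (0, 1),
        Cn m (dx u) & Cn m (dy u)]
  else continuous u.

Definition smooth_compact_support (R : realType) (phi : R * R -> R[i]) : Prop :=
  [/\ forall n, Cn n (fun z => complex.Re (phi z)),
      forall n, Cn n (fun z => complex.Im (phi z)) &
      compact (closure [set z | phi z != 0])].

Definition dbar (R : realType) (phi : R * R -> R[i]) (z : R * R) : R[i] :=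
  let u := fun w => complex.Re (phi w) in
  let v := fun w => complex.Im (phi w) in
  2^-1 * (Complex (dx u z) (dx v z) + 'i%C * Complex (dy u z) (dy v z)).

(* The singularity [z = lam] of the integrand is a null set. *)
Definition vitushkin (R : realType) (phi g : R * R -> R[i]) (lam : R * R) : R[i] :=
  (pi^-1)%:C%C *
  cintegral (@planar_lebesgue R) setT
    (fun z => (g z - g lam) / (toC z - toC lam) * dbar phi z).

(* An element of C(K) is represented by any function on the plane whose
   restriction to [K] it is; the topology of [{uniform` K -> _}] only sees that
   restriction, and is the one of the sup norm over [K]. *)
Definition vitushkin_closure (R : realType) (g : R * R -> R[i]) (K : set (R * R)) :
    set {uniform` K -> R[i]^o} :=
  [set h | {within K, continuous (h : R * R -> R[i]^o)} /\
     closure ([set vitushkin phi g | phi in @smooth_compact_support R] :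
                set {uniform` K -> R[i]^o}) h].
Arguments vitushkin_closure {R} g K.

(* Main.v *)
Require Import Defs.
From HB Require Import structures.
From mathcomp Require Import all_boot all_order all_algebra.
From mathcomp Require Import all_classical all_reals all_analysis.
From mathcomp Require Import measurable_realfun ess_sup_inf.
From mathcomp Require Import complex.
From mathcomp Require Import ring lra.
Import Order.TTheory GRing.Theory Num.Theory.
Import numFieldNormedType.Exports.
Import ComplexField.Normc.
Set Implicit Arguments.
Unset Strict Implicit.
Unset Printing Implicit Defensive.
Local Open Scope classical_set_scope.
Local Open Scope ring_scope.

(** Write [g] and [h] for the continuous versions of the Cauchy transforms of
    [eta] and of [f eta].  For a smooth compactly supported [phi], localizing
    [g] by [phi] gives the Cauchy transform of [phi eta]
    ([localization], [vitushkin_grid]), so the task is to find smooth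
    [phi] for which the Cauchy transform of [(f - phi) eta] is uniformly
    small.  Cut the plane into a grid of mesh [d], with a smooth partition of
    unity [phi_p] made of products of one-variable windows, and put
    [phi = sum_p gam_p phi_p] with [gam_p] the mean of [f] against
    [phi_p eta].  Then [h - C(phi eta)] is the sum over the cells of the
    Cauchy transforms of [(f - gam_p) phi_p eta], measures of total mass zero.

    Near a point [l] there are boundedly many cells, and each contributes a
    multiple of the modulus of continuity of [h] and [g] at scale [d]: this is
    Vitushkin's estimate of the localization of a continuous function
    ([near_estimate], [cell_near]).  Away from [l] the vanishing of the mass
    gains one factor of distance, so the far cells together contribute at most
    a multiple of the integral of [d / |w - l|^2] against [eta]
    ([cell_far]).  In Vitushkin's general scheme such a sum diverges
    logarithmically; here it is small because [eta] is positive.  Testing [g]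
    against a bump equal to 1 on a square gives
    [eta (square of side s) <= G * om * s], where [om] is the oscillation of
    [g] on a concentric larger square ([mass_estimate], [growth]), and summing
    this over dyadic squares bounds the integral ([far_estimate]).

    The analytic input is the Cauchy-Pompeiu formula, needed only for products
    [a(x) b(y)] ([pompeiu]).  It is reduced to one-variable integrations by
    parts: [x / (x^2 + y^2)] is the [y]-derivative of [atan (y / x)] and the
    [x]-derivative of a logarithm, and symmetrically in [y], so the real part
    comes down to [atan (y / x) + atan (x / y) = pi / 2 * sign (x y)] and the
    two halves of the imaginary part cancel by Fubini's theorem.

    Identities between Cauchy transforms hold almost everywhere, at the points
    where [1 / |w - l|] is [eta]-integrable ([potential_ae], [cauchy_rep]).
    The final estimate reaches every point of [K] because both [h] and the
    localized function are continuous ([vitushkin_continuous]). *)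


(** * Complex-valued Lebesgue integrals *)

Lemma invr_measurable (R : realType) : measurable_fun [set: R] (fun x : R => x^-1).
Proof.
have -> : [set: R] = ~` [set 0] `|` [set 0] by rewrite setUC setUv.
apply/measurable_funU => //; first exact: measurableC.
split.
  apply: subspace_continuous_measurable_fun; first exact: measurableC.
  apply: continuous_in_subspaceT => x; rewrite inE /= => /eqP x0.
  exact: inv_continuous.
exact: measurable_fun_set1.
Qed.

Section almost_everywhere.
Context d (T : measurableType d) (R : realType) (mu : {measure set T -> \bar R}).
Implicit Types P Q : T -> Prop.

Lemma aeS P Q : (forall x, P x -> Q x) ->
  {ae mu, forall x, P x} -> {ae mu, forall x, Q x}.
Proof. by move=> PQ; apply: filterS. Qed.

Lemma aeI P Q : {ae mu, forall x, P x} -> {ae mu, forall x, Q x} ->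
  {ae mu, forall x, P x /\ Q x}.
Proof. by apply: filterS2 => x. Qed.

End almost_everywhere.

Section complex_integral.
Context d (T : measurableType d) (R : realType).
Implicit Types (h k : T -> R[i]).

Definition cmeas h := measurable_fun setT (fun z => complex.Re (h z)) /\
  measurable_fun setT (fun z => complex.Im (h z)).

Lemma ReD (x y : R[i]) : complex.Re (x + y) = complex.Re x + complex.Re y.
Proof. by case: x y => [? ?] [? ?]. Qed.
Lemma ImD (x y : R[i]) : complex.Im (x + y) = complex.Im x + complex.Im y.
Proof. by case: x y => [? ?] [? ?]. Qed.
Lemma ReN (x : R[i]) : complex.Re (- x) = - complex.Re x.
Proof. by case: x => [? ?]. Qed.
Lemma ImN (x : R[i]) : complex.Im (- x) = - complex.Im x.
Proof. by case: x => [? ?]. Qed.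
Lemma ReM (x y : R[i]) :
  complex.Re (x * y) = complex.Re x * complex.Re y - complex.Im x * complex.Im y.
Proof. by case: x y => [? ?] [? ?]. Qed.
Lemma ImM (x y : R[i]) :
  complex.Im (x * y) = complex.Re x * complex.Im y + complex.Im x * complex.Re y.
Proof. by case: x y => [? ?] [? ?]. Qed.
Lemma ReV (x : R[i]) :
  complex.Re x^-1 = complex.Re x / (complex.Re x ^+ 2 + complex.Im x ^+ 2).
Proof. by case: x => [? ?]. Qed.
Lemma ImV (x : R[i]) :
  complex.Im x^-1 = - (complex.Im x / (complex.Re x ^+ 2 + complex.Im x ^+ 2)).
Proof. by case: x => [? ?]. Qed.

Lemma normcE (x : R[i]) : normc x = Num.sqrt (complex.Re x ^+ 2 + complex.Im x ^+ 2).
Proof. by case: x. Qed.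

Lemma normc_ge0 (x : R[i]) : 0 <= normc x.
Proof. by rewrite normcE sqrtr_ge0. Qed.

Lemma normc_gt0 (x : R[i]) : (0 < normc x) = (x != 0).
Proof.
rewrite lt_neqAle normc_ge0 andbT eq_sym; congr (~~ _).
by apply/eqP/eqP => [/eq0_normc//|->]; rewrite normc0.
Qed.

Lemma ler_normcD (x y : R[i]) : normc (x + y) <= normc x + normc y.
Proof. exact: le_normcD. Qed.

Lemma normc_opp (x : R[i]) : normc (- x) = normc x.
Proof. exact: normcN. Qed.

Lemma normcB (x y : R[i]) : normc (x - y) = normc (y - x).
Proof. by rewrite -normc_opp opprB. Qed.

Lemma Re_le_normc (x : R[i]) : `|complex.Re x| <= normc x.
Proof. by rewrite normcE -sqrtr_sqr ler_wsqrtr// lerDl sqr_ge0. Qed.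

Lemma Im_le_normc (x : R[i]) : `|complex.Im x| <= normc x.
Proof. by rewrite normcE -sqrtr_sqr ler_wsqrtr// lerDr sqr_ge0. Qed.

Lemma normc_le_ReIm (x : R[i]) : normc x <= `|complex.Re x| + `|complex.Im x|.
Proof.
rewrite normcE -(ger0_norm (addr_ge0 (normr_ge0 _) (normr_ge0 _))) -sqrtr_sqr.
rewrite ler_wsqrtr// sqrrD !real_normK ?num_real// lerD2r lerDl.
by rewrite mulrn_wge0// mulr_ge0.
Qed.

Lemma cmeas_cst c : cmeas (cst c).
Proof. by split; exact: measurable_cst. Qed.

Lemma cmeasD h k : cmeas h -> cmeas k -> cmeas (fun z => h z + k z).
Proof.
move=> [h1 h2] [k1 k2]; split.
  by under eq_fun do rewrite ReD; exact: measurable_funD.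
by under eq_fun do rewrite ImD; exact: measurable_funD.
Qed.

Lemma cmeasN h : cmeas h -> cmeas (fun z => - h z).
Proof.
move=> [h1 h2]; split.
  by under eq_fun do rewrite ReN; exact: measurable_funN.
by under eq_fun do rewrite ImN; exact: measurable_funN.
Qed.

Lemma cmeasB h k : cmeas h -> cmeas k -> cmeas (fun z => h z - k z).
Proof. by move=> mh mk; apply: cmeasD => //; exact: cmeasN. Qed.

Lemma cmeasM h k : cmeas h -> cmeas k -> cmeas (fun z => h z * k z).
Proof.
move=> [h1 h2] [k1 k2]; split.
  under eq_fun do rewrite ReM.
  by apply: measurable_funB; exact: measurable_funM.
under eq_fun do rewrite ImM.
by apply: measurable_funD; exact: measurable_funM.
Qed.

Lemma cmeasV h : cmeas h -> cmeas (fun z => (h z)^-1).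
Proof.
move=> [h1 h2].
have mV : measurable_fun setT (fun z =>
    (complex.Re (h z) ^+ 2 + complex.Im (h z) ^+ 2)^-1).
  apply: (measurableT_comp (@invr_measurable R)).
  by apply: measurable_funD; exact: measurable_funX.
split.
  by under eq_fun do rewrite ReV; exact: measurable_funM.
under eq_fun do rewrite ImV.
by apply: measurable_funN; exact: measurable_funM.
Qed.

Lemma measurable_sqrt : measurable_fun [set: R] (@Num.sqrt R).
Proof. by apply: continuous_measurable_fun; exact: sqrt_continuous. Qed.

Lemma measurable_normc h : cmeas h -> measurable_fun setT (fun z => normc (h z)).
Proof.
move=> [h1 h2]; under eq_fun do rewrite normcE.
apply: (measurableT_comp measurable_sqrt).
by apply: measurable_funD; exact: measurable_funX.
Qed.

Lemma cmeas_real (u : T -> R) : measurable_fun setT u -> cmeas (fun z => (u z)%:C%C).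
Proof. by move=> mu; split => //=; exact: measurable_cst. Qed.

Variable mu : {measure set T -> \bar R}.

Definition L1 (u : T -> R) := mu.-integrable setT (EFin \o u).

Lemma L1_le (u v : T -> R) : measurable_fun setT u ->
  (forall z, `|u z| <= v z) -> L1 v -> L1 u.
Proof.
move=> m_u uv; apply: le_integrable => //; first exact/measurable_EFinP.
by move=> x _ /=; rewrite lee_fin (le_trans (uv x))// ler_norm.
Qed.

Lemma L1_meas (u : T -> R) : L1 u -> measurable_fun setT u.
Proof. by move=> /measurable_int/measurable_EFinP. Qed.

Lemma L1D (u v : T -> R) : L1 u -> L1 v -> L1 (fun z => u z + v z).
Proof. by move=> iu iv; have := integrableD measurableT iu iv. Qed.

Lemma L1B (u v : T -> R) : L1 u -> L1 v -> L1 (fun z => u z - v z).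
Proof. by move=> iu iv; have := integrableB measurableT iu iv. Qed.

Lemma L1Z (c : R) (u : T -> R) : L1 u -> L1 (fun z => c * u z).
Proof. by move=> iu; have := integrableZl measurableT c iu. Qed.

Lemma L1_norm (u : T -> R) : L1 u -> L1 (fun z => `|u z|).
Proof. by move=> /integrable_norm. Qed.

(** The same as [cintegral] over the whole plane, but on an arbitrary
    measurable space, so that it also applies to product measures. *)
Definition cint h : R[i] :=
  Complex (\int[mu]_z complex.Re (h z)) (\int[mu]_z complex.Im (h z)).

Definition cL1 h := L1 (fun z => complex.Re (h z)) /\ L1 (fun z => complex.Im (h z)).

Lemma cL1_meas h : cL1 h -> cmeas h.
Proof. by move=> [/L1_meas ? /L1_meas ?]. Qed.

Lemma cL1_le h (k : T -> R) : cmeas h -> (forall z, normc (h z) <= k z) -> L1 k -> cL1 h.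
Proof.
move=> [h1 h2] hk ik; split; apply: L1_le ik => // z.
  exact: le_trans (Re_le_normc _) (hk z).
exact: le_trans (Im_le_normc _) (hk z).
Qed.

Lemma cL1_normc h : cL1 h -> L1 (fun z => normc (h z)).
Proof.
move=> ih; have := L1D (L1_norm ih.1) (L1_norm ih.2).
apply: L1_le; first exact: measurable_normc (cL1_meas ih).
by move=> z; rewrite ger0_norm ?normc_ge0// normc_le_ReIm.
Qed.

Lemma cL1D h k : cL1 h -> cL1 k -> cL1 (fun z => h z + k z).
Proof.
move=> [h1 h2] [k1 k2]; split.
  by under eq_fun do rewrite ReD; exact: L1D.
by under eq_fun do rewrite ImD; exact: L1D.
Qed.

Lemma cL1B h k : cL1 h -> cL1 k -> cL1 (fun z => h z - k z).
Proof.
move=> [h1 h2] [k1 k2]; split.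
  by under eq_fun do rewrite ReD ReN; exact: L1B.
by under eq_fun do rewrite ImD ImN; exact: L1B.
Qed.

Lemma cL1Z c h : cL1 h -> cL1 (fun z => c * h z).
Proof.
move=> [h1 h2]; split.
  by under eq_fun do rewrite ReM; apply: L1B; exact: L1Z.
by under eq_fun do rewrite ImM; apply: L1D; exact: L1Z.
Qed.

Lemma eq_cint h k : (forall z, h z = k z) -> cint h = cint k.
Proof. by move=> /funext ->. Qed.

Lemma cint_cst0 : cint (fun=> 0) = 0.
Proof.
by rewrite /cint /Rintegral /=; congr Complex; rewrite integral_cst// mul0e.
Qed.

Lemma cintD h k : cL1 h -> cL1 k -> cint (fun z => h z + k z) = cint h + cint k.
Proof.
move=> [h1 h2] [k1 k2]; rewrite /cint /=.
under eq_Rintegral do rewrite ReD.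
under [X in Complex _ X]eq_Rintegral do rewrite ImD.
by rewrite !RintegralD.
Qed.

Lemma cintB h k : cL1 h -> cL1 k -> cint (fun z => h z - k z) = cint h - cint k.
Proof.
move=> [h1 h2] [k1 k2]; rewrite /cint /=.
under eq_Rintegral do rewrite ReD ReN.
under [X in Complex _ X]eq_Rintegral do rewrite ImD ImN.
by rewrite !RintegralB.
Qed.

Lemma cintZ c h : cL1 h -> cint (fun z => c * h z) = c * cint h.
Proof.
move=> [h1 h2]; rewrite /cint /=.
under eq_Rintegral do rewrite ReM.
under [X in Complex _ X]eq_Rintegral do rewrite ImM.
rewrite RintegralB ?RintegralD//; try exact: L1Z.
rewrite !RintegralZl//.
by case: c.
Qed.

Lemma cintZr c h : cL1 h -> cint (fun z => h z * c) = cint h * c.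
Proof. by move=> ih; rewrite mulrC -cintZ//; apply: eq_cint => z; rewrite mulrC. Qed.

Lemma cL1_sum (I : Type) (s : seq I) (F : I -> T -> R[i]) :
  (forall i, cL1 (F i)) -> cL1 (fun z => \sum_(i <- s) F i z).
Proof.
move=> iF; elim: s => [|i s ih].
  under eq_fun do rewrite big_nil.
  by split; rewrite /L1 /=; exact: integrable0.
by under eq_fun do rewrite big_cons; exact: cL1D.
Qed.

Lemma cint_sum (I : Type) (s : seq I) (F : I -> T -> R[i]) :
  (forall i, cL1 (F i)) ->
  cint (fun z => \sum_(i <- s) F i z) = \sum_(i <- s) cint (F i).
Proof.
move=> iF; elim: s => [|i s ih].
  by under eq_fun do rewrite big_nil; rewrite big_nil cint_cst0.
under eq_fun do rewrite big_cons; rewrite big_cons cintD ?ih//.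
exact: cL1_sum.
Qed.

Lemma ae_eq_Rintegral (u v : T -> R) : measurable_fun setT u -> measurable_fun setT v ->
  {ae mu, forall z, u z = v z} -> \int[mu]_z u z = \int[mu]_z v z.
Proof.
move=> m_u mv uv; rewrite /Rintegral; congr fine.
apply: ae_eq_integral => //; try exact/measurable_EFinP.
by apply: filterS uv => z /= ->.
Qed.

Lemma cint_ae h k : cmeas h -> cmeas k -> {ae mu, forall z, h z = k z} -> cint h = cint k.
Proof.
move=> [h1 h2] [k1 k2] hk; rewrite /cint; congr Complex;
  by apply: ae_eq_Rintegral => //; apply: filterS hk => z ->.
Qed.

(** The factor 2 comes from bounding the real and imaginary parts separately;
    only smallness of the integrals matters in what follows. *)
Lemma le_cint h (k : T -> R) : cmeas h -> (forall z, normc (h z) <= k z) -> L1 k ->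
  normc (cint h) <= 2 * \int[mu]_z k z.
Proof.
move=> mh hk ik; have [h1 h2] := cL1_le mh hk ik.
apply: (le_trans (normc_le_ReIm _)); rewrite /cint /= mulr_natl mulr2n.
have H u : L1 u -> (forall z, `|u z| <= k z) ->
    `|\int[mu]_z u z| <= \int[mu]_z k z.
  move=> iu uk; apply: (le_trans (le_normr_Rintegral measurableT iu)).
  by apply: le_Rintegral => //; exact: L1_norm.
apply: lerD; apply: H => // z.
  exact: le_trans (Re_le_normc _) (hk z).
exact: le_trans (Im_le_normc _) (hk z).
Qed.

End complex_integral.
Arguments cint {d T R} mu h.

Section complex_fubini.
Context d1 d2 (T1 : measurableType d1) (T2 : measurableType d2) (R : realType).
Variables (m1 : {sigma_finite_measure set T1 -> \bar R})
  (m2 : {sigma_finite_measure set T2 -> \bar R}).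

Lemma Rfubini_meas1 (u : T1 * T2 -> R) : L1 (m1 \x m2)%E u ->
  measurable_fun setT (fun x => \int[m2]_y u (x, y)).
Proof.
move=> iu; have m := measurable_fubini_F iu.
exact: (measurableT_comp (fine_measurable measurableT) m).
Qed.

Lemma Rfubini_meas2 (u : T1 * T2 -> R) : L1 (m1 \x m2)%E u ->
  measurable_fun setT (fun y => \int[m1]_x u (x, y)).
Proof.
move=> iu; have m := measurable_fubini_G iu.
exact: (measurableT_comp (fine_measurable measurableT) m).
Qed.

(** The inner extended-real integral may be infinite on a null set, where [fine]
    turns it into 0; hence the detour through almost everywhere equality. *)
Lemma Rfubini1 (u : T1 * T2 -> R) : L1 (m1 \x m2)%E u ->
  \int[m1]_x \int[m2]_y u (x, y) = \int[(m1 \x m2)%E]_z u z.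
Proof.
move=> iu; rewrite /Rintegral -(integral12_prod_meas1 iu); congr fine.
apply: ae_eq_integral => //.
- by apply/measurable_EFinP; exact: Rfubini_meas1.
- exact: (measurable_fubini_F iu).
- have := integrable_fubini_F iu => /integrable_ae -/(_ measurableT).
  by apply: filterS => x /(_ I) xfin _ /=; rewrite fineK.
Qed.

Lemma Rfubini2 (u : T1 * T2 -> R) : L1 (m1 \x m2)%E u ->
  \int[m2]_y \int[m1]_x u (x, y) = \int[(m1 \x m2)%E]_z u z.
Proof.
move=> iu; rewrite /Rintegral -(integral21_prod_meas1 iu); congr fine.
apply: ae_eq_integral => //.
- by apply/measurable_EFinP; exact: Rfubini_meas2.
- exact: (measurable_fubini_G iu).
- have ia := ae_integrable2 iu.
  apply: filterS ia => y ia _ /=.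
  by rewrite fineK//; exact: (integrable_fin_num _ ia).
Qed.

Lemma cfubini_ae2 (h : T1 * T2 -> R[i]) : cL1 (m1 \x m2)%E h ->
  {ae m2, forall y, cL1 m1 (fun x => h (x, y))}.
Proof. by move=> [/ae_integrable2 h1 /ae_integrable2 h2]; apply: filterS2 h1 h2 => x ? ?. Qed.

Lemma cfubini (h : T1 * T2 -> R[i]) : cL1 (m1 \x m2)%E h ->
  cint m1 (fun x => cint m2 (fun y => h (x, y))) =
  cint m2 (fun y => cint m1 (fun x => h (x, y))).
Proof.
move=> [h1 h2]; rewrite /cint /=.
by rewrite (Rfubini1 h1) (Rfubini1 h2) (Rfubini2 h1) (Rfubini2 h2).
Qed.

Lemma L1_prod (u : T1 * T2 -> R) : measurable_fun setT u ->
  (\int[m1]_x \int[m2]_y (`|u (x, y)|)%:E < +oo)%E -> L1 (m1 \x m2)%E u.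
Proof. by move=> m_u ?; apply/integrable12ltyP => //; exact/measurable_EFinP. Qed.

End complex_fubini.

(** * Squares in the plane and the size of the Cauchy kernel *)

Lemma L1_ge0_bound d (T : measurableType d) (R : realType)
    (mu : {measure set T -> \bar R}) (u : T -> R) (c : R) :
  measurable_fun setT u -> (forall z, 0 <= u z) ->
  (\int[mu]_z (u z)%:E <= c%:E)%E -> L1 mu u /\ \int[mu]_z u z <= c.
Proof.
move=> m_u u0 uc.
have iu : L1 mu u.
  apply/integrableP; split; first exact/measurable_EFinP.
  apply: le_lt_trans (ltry c); apply: le_trans uc.
  by under eq_integral do rewrite /= ger0_norm//.
split=> //; rewrite -lee_fin /Rintegral fineK//.
exact: (integrable_fin_num measurableT iu).
Qed.

Lemma L1_finite d (T : measurableType d) (R : realType)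
    (mu : {measure set T -> \bar R}) (u : T -> R) :
  L1 mu u -> (\int[mu]_z (u z)%:E)%E = (\int[mu]_z u z)%:E.
Proof. by move=> iu; rewrite /Rintegral fineK//; exact: (integrable_fin_num _ iu). Qed.

Section plane.
Variable R : realType.
Implicit Types (z w l : R * R) (r s : R).

(** The distance of the sup norm, whose balls [box] are squares, that is, products
    of intervals; it is equivalent to the modulus of the difference. *)
Definition dist z w : R := Num.max `|z.1 - w.1| `|z.2 - w.2|.

Definition box l r : set (mplane R) := [set z | dist z l <= r].

Lemma dist_ge0 z w : 0 <= dist z w.
Proof. by rewrite le_max normr_ge0. Qed.

Lemma distC z w : dist z w = dist w z.
Proof. by rewrite /dist distrC (distrC z.2). Qed.

Lemma distxx z : dist z z = 0.
Proof. by rewrite /dist !subrr normr0 maxxx. Qed.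

Lemma dist_tri u z w : dist z w <= dist z u + dist u w.
Proof.
rewrite /dist ge_max; apply/andP; split.
  have -> : z.1 - w.1 = (z.1 - u.1) + (u.1 - w.1) by ring.
  by apply: (le_trans (ler_normD _ _)); apply: lerD; rewrite le_max lexx.
have -> : z.2 - w.2 = (z.2 - u.2) + (u.2 - w.2) by ring.
by apply: (le_trans (ler_normD _ _)); apply: lerD; rewrite le_max lexx orbT.
Qed.

Lemma dist_le_normc z w : dist z w <= normc (toC z - toC w).
Proof.
rewrite /dist ge_max; apply/andP; split.
  exact: (Re_le_normc (toC z - toC w)).
exact: (Im_le_normc (toC z - toC w)).
Qed.

Lemma normc_le_dist z w : normc (toC z - toC w) <= 2 * dist z w.
Proof.
apply: (le_trans (normc_le_ReIm _)); rewrite mulr_natl mulr2n.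
by apply: lerD; rewrite /dist le_max lexx ?orbT.
Qed.

Lemma box_prod l r : box l r =
  (`[l.1 - r, l.1 + r] : set (measurableTypeR R)) `*` `[l.2 - r, l.2 + r].
Proof.
apply/seteqP; split => z /=; rewrite /box /= !in_itv /= /dist ge_max !ler_distl.
  by move=> /andP[-> ->].
by move=> [-> ->].
Qed.

Lemma measurable_box l r : measurable (box l r).
Proof. by rewrite box_prod; apply: measurableX; exact: measurable_itv. Qed.

Lemma planar_lebesgue_box l r : 0 <= r -> @planar_lebesgue R (box l r) = ((2 * r) ^+ 2)%:E.
Proof.
move=> r0; rewrite box_prod.
transitivity ((@lebesgue_measure R `[(l.1 - r)%R, (l.1 + r)%R]%classic) *
  (@lebesgue_measure R `[(l.2 - r)%R, (l.2 + r)%R]%classic))%E.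
  by apply: product_measure1E; exact: measurable_itv.
rewrite !lebesgue_measure_itv /= !lte_fin.
have H (x : R) : (if x - r < x + r then ((x + r)%:E - (x - r)%:E)%E else 0%E) =
    (2 * r)%:E.
  rewrite ltrBlDr -addrA ltrDl -EFinB.
  case: ifPn => [_|]; first by congr EFin; ring.
  rewrite -leNgt => rr; have -> : r = 0 by lra.
  by rewrite mulr0.
by rewrite !H -EFinM expr2.
Qed.

Lemma planar_lebesgue_sigma_finite : sigma_finite setT (@planar_lebesgue R).
Proof.
exists (fun n => box (0, 0) n%:R).
  rewrite predeqE => z; split=> // _.
  exists (Num.truncn (dist z (0, 0))).+1 => //.
  by rewrite /box /= ltW// truncnS_gt.
by move=> n; split; [exact: measurable_box|rewrite planar_lebesgue_box// ltry].
Qed.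

End plane.

(** Planar Lebesgue measure again, under a name that carries the sigma-finite
    structure which the Fubini theorems ask for. *)
Definition area (R : realType) : set (mplane R) -> \bar R := @planar_lebesgue R.
Arguments area {R}.

HB.instance Definition _ R := Measure.on (@area R).
HB.instance Definition _ R :=
  @Measure_isSigmaFinite.Build _ _ _ (@area R) (@planar_lebesgue_sigma_finite R).

Section kernel.
Variable R : realType.
Implicit Types (z w l : R * R) (r s : R).

Lemma area_box l r : 0 <= r -> area (box l r) = ((2 * r) ^+ 2)%:E.
Proof. exact: planar_lebesgue_box. Qed.

Lemma toCB z l : toC z - toC l = Complex (z.1 - l.1) (z.2 - l.2).
Proof. by []. Qed.

Lemma toC_eq0 z l : (toC z - toC l == 0) = (z == l).
Proof.
rewrite toCB eq_complex /= !subr_eq0.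
by case: z l => [? ?] [? ?].
Qed.

(** The Cauchy kernel, with value 0 on the diagonal. *)
Definition ker z l : R[i] := (toC z - toC l)^-1.

Lemma normc_ker z l : normc (ker z l) = (normc (toC z - toC l))^-1.
Proof. exact: normcV. Qed.

Lemma ker_le z l r : 0 < r -> r <= dist z l -> normc (ker z l) <= r^-1.
Proof.
move=> r0 rz; rewrite normc_ker lef_pV2 ?posrE//.
  exact: le_trans rz (dist_le_normc _ _).
exact: lt_le_trans r0 (le_trans rz (dist_le_normc _ _)).
Qed.

Lemma kerN z l : ker z l = - ker l z.
Proof. by rewrite /ker -invrN opprB. Qed.

Lemma normc_kerC z l : normc (ker z l) = normc (ker l z).
Proof. by rewrite kerN normc_opp. Qed.

Lemma kerxx z : ker z z = 0.
Proof. by rewrite /ker subrr invr0. Qed.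

Lemma cmeas_toC : cmeas (@toC R : mplane R -> R[i]).
Proof. by split; [exact: measurable_fst|exact: measurable_snd]. Qed.

Lemma cmeas_comp d d' (T : measurableType d) (U : measurableType d')
    (f : T -> U) (h : U -> R[i]) : measurable_fun setT f -> cmeas h ->
  cmeas (fun x => h (f x)).
Proof. by move=> mf [h1 h2]; split; [exact: (measurableT_comp h1 mf)|exact: (measurableT_comp h2 mf)]. Qed.

Lemma cmeas_ker2 : cmeas (fun p : mplane R * mplane R => ker p.1 p.2).
Proof.
apply: cmeasV; apply: cmeasB.
  exact: (cmeas_comp measurable_fst cmeas_toC).
exact: (cmeas_comp measurable_snd cmeas_toC).
Qed.

Lemma cmeas_kerl l : cmeas (fun z : mplane R => ker z l).
Proof. by apply: cmeasV; apply: cmeasB; [exact: cmeas_toC|exact: cmeas_cst]. Qed.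

Lemma cmeas_kerr l : cmeas (fun z : mplane R => ker l z).
Proof. by apply: cmeasV; apply: cmeasB; [exact: cmeas_cst|exact: cmeas_toC]. Qed.

Lemma pow2_gt n (x : R) : exists m : nat, x < 2 ^+ (m + n).
Proof.
exists (Num.truncn `|x|).+1; apply: (le_lt_trans (ler_norm x)).
apply: (lt_trans (truncnS_gt _)).
rewrite -natrX ltr_nat; apply: (leq_trans (ltn_expl _ (ltnSn 1))).
by rewrite leq_exp2l// leq_addr.
Qed.

(** Locates [x] in the dyadic scale below [s]; used to bound singular integrands
    by geometric series of indicators of squares. *)
Lemma dyadic (s x : R) : 0 < x -> x <= s ->
  exists k : nat, x <= s / 2 ^+ k /\ s / 2 ^+ k.+1 < x.
Proof.
move=> x0 xs.
have ex : exists k : nat, s / 2 ^+ k < x.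
  have [m] := pow2_gt 0 (s / x); rewrite addn0 => hm; exists m.
  by rewrite ltr_pdivrMr ?exprn_gt0// -ltr_pdivrMl// mulrC.
case: (ex_minnP ex) => -[|k] hk kmin.
  by move: hk; rewrite expr0 divr1 ltNge xs.
exists k; split => //; rewrite leNgt; apply/negP => /kmin.
by rewrite ltnn.
Qed.

Lemma measurable_indic_box l r :
  measurable_fun setT (\1_(box l r) : mplane R -> R).
Proof. by apply: measurable_indic; exact: measurable_box. Qed.

Lemma int_indic_box l r (c : R) : 0 <= r -> 0 <= c ->
  (\int[area]_z (c * \1_(box l r) z )%:E)%E = (c * (2 * r) ^+ 2)%:E.
Proof.
move=> r0 c0; under eq_integral do rewrite EFinM.
rewrite ge0_integralZl//=.
- rewrite integral_indic ?setIT; last exact: measurable_box; last by [].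
  by rewrite EFinM; congr (_ * _)%E; exact: area_box.
- by apply/measurable_EFinP; exact: measurable_indic_box.
Qed.

(** On the dyadic shell of radius [s / 2^k] the kernel is at most
    [2^(k+1) / s], while the square has area [(2 s / 2^k)^2]: the products form
    a geometric series. *)
Lemma box_kernel_center l s : 0 < s ->
  (\int[area]_z (\1_(box l s) z * normc (ker z l))%:E <= (16 * s)%:E)%E.
Proof.
move=> s0.
pose F (k : nat) (z : mplane R) : \bar R :=
  ((2 ^+ k.+1 / s) * \1_(box l (s / 2 ^+ k)) z)%:E.
have F0 k z : (0 <= F k z)%E.
  by rewrite lee_fin mulr_ge0// divr_ge0// ltW.
have mF k : measurable_fun setT (F k).
  apply/measurable_EFinP; 
  apply: measurable_funM; first exact: measurable_cst.
  exact: measurable_indic_box.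
have mL : measurable_fun setT (fun z => (\1_(box l s) z * normc (ker z l))%:E).
  apply/measurable_EFinP; apply: measurable_funM.
    exact: measurable_indic_box.
  exact: measurable_normc (cmeas_kerl l).
apply: (@le_trans _ _ (\int[area]_z (\sum_(k <oo) F k z))%E).
  apply: ge0_le_integral => //.
  - by move=> z _; rewrite lee_fin mulr_ge0// normc_ge0.
  - exact: ge0_emeasurable_sum.
  move=> z _; rewrite indicE.
  have [/set_mem zb|_] := boolP (z \in box l s); last first.
    by rewrite mul0r; exact: nneseries_ge0.
  rewrite mul1r.
  have [->|zl] := eqVneq z l.
    by rewrite kerxx normc0; exact: nneseries_ge0.
  have d0 : 0 < dist z l.
    rewrite lt_neqAle dist_ge0 andbT eq_sym; apply/eqP => d0.
    have := normc_le_dist z l; rewrite d0 mulr0 leNgt normc_gt0 toC_eq0.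
    by rewrite zl.
  have [k [zk1 zk2]] := dyadic d0 zb.
  apply: (@le_trans _ _ (\sum_(0 <= i < k.+1) F i z)%E); last exact: nneseries_lim_ge.
  rewrite big_nat_recr//=; apply: (@le_trans _ _ (F k z)); last first.
    by rewrite leeDr//; exact: sume_ge0.
  rewrite lee_fin indicE mem_set// mulr1.
  rewrite -[leRHS]invf_div; apply: ker_le; last exact: ltW.
  by rewrite divr_gt0// exprn_gt0.
rewrite integral_nneseries//.
rewrite (_ : (fun _ => _) = (fun k => \sum_(0 <= i < k) ((16 * s / (2 ^ (i + 1))%:R)%:E)))%E.
  have := @cvg_geometric_eseries_half R (16 * s) 0; rewrite expr0 divr1.
  by move/cvg_lim => ->.
apply/funext => n; apply: eq_bigr => k _.
have sk : 0 < s / 2 ^+ k by rewrite divr_gt0// exprn_gt0.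
rewrite int_indic_box; [|exact: ltW|by rewrite divr_ge0// ltW].
congr EFin; rewrite addn1 natrX exprS.
have k0 : (2 ^+ k : R) != 0 by rewrite expf_neq0.
by field; rewrite k0 gt_eqF.
Qed.

(** The kernel has a singularity of order one in dimension two, so its integral
    over a square is at most linear in the side, uniformly in the pole.  This
    scaling makes every localization estimate independent of the mesh. *)
Lemma box_kernel l z0 r : 0 < r ->
  L1 area (fun z => \1_(box z0 r) z * normc (ker z l)) /\
  \int[area]_z (\1_(box z0 r) z * normc (ker z l)) <= 20 * r.
Proof.
move=> r0.
have mk s l' : measurable_fun setT (fun z => \1_(box l' s) z * normc (ker z l)).
  by apply: measurable_funM; [exact: measurable_indic_box|exact: measurable_normc (cmeas_kerl l)].
have mr : measurable_fun setT (fun z => r^-1 * \1_(box z0 r) z).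
  by apply: measurable_funM; [exact: measurable_cst|exact: measurable_indic_box].
apply: L1_ge0_bound; first exact: mk.
  by move=> z; rewrite mulr_ge0 ?normc_ge0.
apply: (@le_trans _ _ (\int[area]_z ((\1_(box l r) z * normc (ker z l))%:E +
   (r^-1 * \1_(box z0 r) z)%:E))%E).
  apply: ge0_le_integral => //.
  - by move=> z _; rewrite lee_fin mulr_ge0 ?normc_ge0.
  - by apply/measurable_EFinP; exact: mk.
  - apply: emeasurable_funD; apply/measurable_EFinP; [exact: mk|exact: mr].
  move=> z _; rewrite -EFinD lee_fin !indicE.
  have [/set_mem zb|_] := boolP (z \in box z0 r); last first.
    by rewrite mul0r mulr0 addr0 mulr_ge0// normc_ge0.
  rewrite mul1r mulr1.
  have [/set_mem zl|/negP zl] := boolP (z \in box l r).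
    by rewrite mul1r lerDl invr_ge0 ltW.
  rewrite mul0r add0r; apply: ker_le => //.
  by rewrite leNgt; apply/negP => h; apply: zl; rewrite inE; exact: ltW.
rewrite ge0_integralD//.
- rewrite int_indic_box; [|exact: ltW|by rewrite invr_ge0 ltW].
  apply: (@le_trans _ _ ((16 * r)%:E + (r^-1 * (2 * r) ^+ 2)%:E)%E).
    by rewrite leeD2r// box_kernel_center.
  rewrite -EFinD lee_fin.
  have -> : 16 * r + r^-1 * (2 * r) ^+ 2 = 20 * r by field; rewrite gt_eqF.
  exact: lexx.
- by move=> z _; rewrite lee_fin mulr_ge0 ?normc_ge0.
- by apply/measurable_EFinP; exact: mk.
- by move=> z _; rewrite lee_fin mulr_ge0// invr_ge0 ltW.
- by apply/measurable_EFinP; exact: mr.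
Qed.

End kernel.

(** * Integration by parts against arctangents and logarithms *)

Section calculus.
Variable R : realType.
Notation mu := (@lebesgue_measure R).
Implicit Types (a b F k : R -> R) (p q x u M : R).

(** A continuously differentiable bump, with its derivative as a parameter, which
    avoids handling derivability proofs; [M] records the size of the
    derivative, of order the inverse of the length of the support. *)
Record cutoff p q M a a' : Prop := Cutoff {
  cutoff_lt : p < q;
  cutoff_der : forall x, is_derive x 1 a (a' x);
  cutoff_cont : continuous a';
  cutoff_supp : forall x, ~~ (p < x < q) -> a x = 0;
  cutoff_le : forall x, `|a x| <= 1;
  cutoff_dle : forall x, `|a' x| <= M }.

Lemma is_derive_continuous (a a' : R -> R) :
  (forall x, is_derive x 1 a (a' x)) -> continuous a.
Proof.
move=> da x; apply: differentiable_continuous.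
by apply/derivable1_diffP; case: (da x).
Qed.

Lemma is_derive_dLR (a a' : R -> R) x y :
  (forall x, is_derive x 1 a (a' x)) -> derivable_oo_LRcontinuous a x y.
Proof.
move=> da; have ca := is_derive_continuous da; split.
- by move=> z _; case: (da z).
- exact: cvg_at_right_filter (ca x).
- exact: cvg_at_left_filter (ca y).
Qed.

Lemma is_derive_derive1 (a a' : R -> R) x : is_derive x 1 a (a' x) -> derive1 a x = a' x.
Proof. by rewrite derive1E => da; rewrite derive_val. Qed.

Lemma cutoff_dsupp p q M a a' x : cutoff p q M a a' -> ~~ (p <= x <= q) -> a' x = 0.
Proof.
move=> B xpq; rewrite -(is_derive_derive1 (cutoff_der B x)) derive1E.
rewrite (@near_eq_derive _ _ _ a (cst 0)) ?derive_cst//.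
move: xpq; rewrite negb_and -!ltNge => /orP[xp|qx].
  near=> y; rewrite (cutoff_supp B)//= negb_and -!leNgt; apply/orP; left.
  by apply: ltW; near: y; exact: lt_nbhsl.
near=> y; rewrite (cutoff_supp B)//= negb_and -!leNgt; apply/orP; right.
by apply: ltW; near: y; exact: lt_nbhsr.
Unshelve. all: by end_near. Qed.

Lemma Rintegral_itv_support p q (h : R -> R) : (forall x, ~~ (p <= x <= q) -> h x = 0) ->
  \int[mu]_x h x = \int[mu]_(x in `[p, q]) h x.
Proof.
move=> h0; rewrite [RHS]Rintegral_mkcond; congr (Rintegral _ _ _).
apply/funext => x; rewrite patchE; case: ifPn => //.
by rewrite mem_setE in_itv /= => /h0.
Qed.

Lemma cutoff_ibp p q M a a' F k : cutoff p q M a a' ->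
  (forall x, is_derive x 1 F (k x)) -> continuous k ->
  \int[mu]_x (a x * k x) = - \int[mu]_x (a' x * F x).
Proof.
move=> B dF ck.
rewrite (@Rintegral_itv_support p q); last first.
  move=> x xpq; rewrite (cutoff_supp B) ?mul0r//.
  by apply: contra xpq => /andP[/ltW -> /ltW ->].
rewrite [in RHS](@Rintegral_itv_support p q); last first.
  by move=> x xpq; rewrite (cutoff_dsupp B) ?mul0r.
rewrite (@Rintegration_by_parts _ a F a' k p q (cutoff_lt B)).
- rewrite (cutoff_supp B); last by rewrite ltxx andbF.
  by rewrite (cutoff_supp B) ?ltxx// !mul0r subrr sub0r.
- exact/continuous_subspaceT/(cutoff_cont B).
- exact: is_derive_dLR (cutoff_der B).
- by move=> x _; exact: is_derive_derive1 (cutoff_der B x).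
- exact: continuous_subspaceT.
- exact: is_derive_dLR dF.
- by move=> x _; exact: is_derive_derive1 (dF x).
Qed.

Lemma Rintegral_FTC (a a' : R -> R) x y : x < y -> (forall x, is_derive x 1 a (a' x)) ->
  continuous a' -> \int[mu]_(t in `[x, y]) a' t = a y - a x.
Proof.
move=> xy da ca; rewrite /Rintegral (@continuous_FTC2 _ a' a) //.
- exact: continuous_subspaceT.
- exact: is_derive_dLR da.
- by move=> z _; exact: is_derive_derive1 (da z).
Qed.

Lemma continuous_itv_L1 (a : R -> R) x y : continuous a ->
  L1 mu (fun t => a t * \1_`[x, y] t).
Proof.
move=> ca; have : mu.-integrable `[x, y] (EFin \o a).
  apply: continuous_compact_integrable; first exact: segment_compact.
  exact: continuous_subspaceT.
have mI : measurable (`[x, y]%classic : set (measurableTypeR R)).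
  exact: measurable_itv.
move=> /(integrable_mkcond _ mI).
apply: eq_integrable => // t _ /=; rewrite patchE indicE.
by case: ifPn => ht /=; rewrite ?mulr1 ?mulr0.
Qed.

(** Integrating the derivative over each side of [u] gives [- a u] twice. *)
Lemma cutoff_sg p q M a a' u : cutoff p q M a a' ->
  \int[mu]_x (a' x * Num.sg (x - u)) = - 2 * a u.
Proof.
(* an interval containing both the support and [u] in its interior *)
move=> B; pose p' := Num.min p u - 1; pose q' := Num.max q u + 1.
have p'u : p' < u.
  by rewrite /p' ltrBlDr (le_lt_trans (_ : _ <= u))// ?ge_min ?lexx ?orbT// ltrDl.
have uq' : u < q'.
  by rewrite /q' (@le_lt_trans _ _ (Num.max q u))// ?le_max ?lexx ?orbT// ltrDl.
have p'p : p' < p.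
  by rewrite /p' ltrBlDr (le_lt_trans (_ : _ <= p))// ?ge_min ?lexx ?orbT// ltrDl.
have qq' : q < q'.
  by rewrite /q' (@le_lt_trans _ _ (Num.max q u))// ?le_max ?lexx ?orbT// ltrDl.
have ca := cutoff_cont B.
transitivity (\int[mu]_x (a' x * \1_`[u, q'] x - a' x * \1_`[p', u] x)).
  apply: eq_Rintegral => x _.
  have [xpq|/(cutoff_dsupp B) ->] := boolP (p <= x <= q); last by rewrite !mul0r subr0.
  rewrite -mulrBr; congr (_ * _).
  move/andP: xpq => [px xq].
  rewrite !indicE !mem_setE !in_itv /= (le_trans xq (ltW qq')) (le_trans (ltW p'p) px).
  rewrite andbT /=; case: (ltgtP x u) => [xu|xu|->].
  - by rewrite ltr0_sg ?subr_lt0// sub0r.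
  - by rewrite gtr0_sg ?subr_gt0// subr0.
  - by rewrite subrr sgr0 subrr.
rewrite RintegralB//; try exact: continuous_itv_L1.
have E x y : \int[mu]_t (a' t * \1_`[x, y] t) = \int[mu]_(t in `[x, y]) a' t.
  rewrite [RHS]Rintegral_mkcond; apply: eq_Rintegral => t _.
  by rewrite patchE indicE; case: ifPn; rewrite ?mulr1 ?mulr0.
rewrite !E (Rintegral_FTC uq' (cutoff_der B) ca) (Rintegral_FTC p'u (cutoff_der B) ca).
rewrite (cutoff_supp B (x := q')); last first.
  by rewrite negb_and -!leNgt (ltW qq') orbT.
rewrite (cutoff_supp B (x := p')); last first.
  by rewrite negb_and -!leNgt (ltW p'p).
ring.
Qed.

Lemma atanV_gt0 x : 0 < x -> atan x + atan x^-1 = pi / 2.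
Proof.
move=> x0; apply/eqP; rewrite eq_sym addrC -subr_eq; apply/eqP.
have t0 : 0 < atan x by rewrite -[ltLHS](@atan0 R) lt_atan.
rewrite -[LHS]tanK; last first.
  rewrite in_itv /= ltrBrDr; apply/andP; split.
    by apply: (@lt_trans _ _ 0); have := @atan_ltpi2 R x; lra.
  by rewrite ltrBlDr ltrDl.
congr atan; rewrite /tan sinB cosB sin_pihalf cos_pihalf !mul0r !mul1r.
rewrite subr0 add0r -{3}[x]atanK /tan invf_div//.
Qed.

Lemma atanV_sg x y : atan (y / x) + atan (x / y) = pi / 2 * (Num.sg x * Num.sg y).
Proof.
have [->|x0] := eqVneq x 0.
  by rewrite invr0 mulr0 mul0r !atan0 sgr0 mul0r mulr0 addr0.
have [->|y0] := eqVneq y 0.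
  by rewrite invr0 mulr0 mul0r !atan0 sgr0 !mulr0 addr0.
have x2 : 0 < x ^+ 2 by rewrite exprn_even_gt0.
have E : y / x = (x * y) / x ^+ 2 by field.
rewrite -sgrM -[x / y]invf_div; have [h|h|h] := ltgtP 0 (x * y).
- by rewrite gtr0_sg// mulr1 atanV_gt0// E divr_gt0.
- have [t t0 ->] : exists2 t, 0 < t & y / x = - t.
    by exists (- (y / x)); rewrite ?opprK// E -mulNr divr_gt0// oppr_gt0.
  by rewrite ltr0_sg// mulrN1 invrN !atanN -opprD atanV_gt0.
- by have := mulf_neq0 x0 y0; rewrite -h eqxx.
Qed.

(** With the next lemma: both coordinates of the Cauchy kernel have a
    primitive in each of the two variables. *)
Lemma is_derive_atan_shift u c x : c != 0 ->
  is_derive x 1 (fun x => atan ((x - u) / c)) (c / ((x - u) ^+ 2 + c ^+ 2)).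
Proof.
move=> c0.
have H : is_derive x 1 (fun x => (x - u) / c) c^-1.
  have -> : (fun x => (x - u) / c) = c^-1 *: (fun x => x - u).
    by apply/funext => y /=; rewrite mulrC.
  by apply: is_derive_eq; rewrite subr0 scaler1.
have := @is_derive1_comp R _ _ x _ _ (is_derive1_atan ((x - u) / c)) H.
rewrite /comp => K; apply: (@is_derive_eq _ _ _ _ _ _ _ _ K).
have : (x - u) ^+ 2 + c ^+ 2 != 0.
  by rewrite gt_eqF// ltr_wpDl ?sqr_ge0// exprn_even_gt0.
have : 1 + ((x - u) / c) ^+ 2 != 0.
  by rewrite gt_eqF// ltr_pwDl// sqr_ge0.
move=> h1 h2; field.
by rewrite c0 h2 /=.
Qed.

Lemma is_derive_ln_shift u c x : c != 0 ->
  is_derive x 1 (fun x => ln ((x - u) ^+ 2 + c ^+ 2) / 2)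
    ((x - u) / ((x - u) ^+ 2 + c ^+ 2)).
Proof.
move=> c0.
have s0 : 0 < (x - u) ^+ 2 + c ^+ 2 by rewrite ltr_wpDl ?sqr_ge0// exprn_even_gt0.
have H : is_derive x 1 (fun x => (x - u) ^+ 2 + c ^+ 2) (2 * (x - u)).
  have -> : (fun x => (x - u) ^+ 2 + c ^+ 2) = (fun x => x - u) ^+ 2 + cst (c ^+ 2).
    by apply/funext => y /=.
  by apply: is_derive_eq; rewrite /= subr0 addr0 scaler1 expr1.
have K := @is_derive1_comp R _ _ x _ _ (is_derive1_ln s0) H.
have -> : (fun x => ln ((x - u) ^+ 2 + c ^+ 2) / 2) =
    2^-1 *: (@ln R \o (fun x => (x - u) ^+ 2 + c ^+ 2)).
  by apply/funext => y /=; rewrite mulrC.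
by apply: is_derive_eq; rewrite /= /GRing.scale /=; field; rewrite gt_eqF.
Qed.

Lemma continuous_kernel u c (h : R -> R) : c != 0 -> continuous h ->
  continuous (fun x => h x / ((x - u) ^+ 2 + c ^+ 2)).
Proof.
move=> c0 ch x; apply: cvgM; first exact: ch.
apply: cvgV.
  by rewrite gt_eqF// ltr_wpDl ?sqr_ge0// exprn_even_gt0.
apply: cvgD; last exact: cvg_cst.
apply: cvgM; apply: cvgB => //; exact: cvg_cst.
Qed.

(** At [c = 0] both sides are 0 because division by 0 returns 0, so no
    exceptional line has to be removed. *)
Lemma cutoff_atan p q M a a' u c : cutoff p q M a a' ->
  \int[mu]_x (a x * (c / ((x - u) ^+ 2 + c ^+ 2))) =
  - \int[mu]_x (a' x * atan ((x - u) / c)).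
Proof.
move=> B; have [->|c0] := eqVneq c 0.
  rewrite /Rintegral.
  under eq_integral do rewrite mul0r mulr0.
  under [X in _ = - fine X]eq_integral do rewrite invr0 mulr0 atan0 mulr0.
  by rewrite integral0 oppr0.
apply: cutoff_ibp B _ _; first by move=> x; exact: is_derive_atan_shift.
by apply: continuous_kernel => // x; exact: cvg_cst.
Qed.

Lemma cutoff_ln p q M a a' u c : cutoff p q M a a' -> c != 0 ->
  \int[mu]_x (a x * ((x - u) / ((x - u) ^+ 2 + c ^+ 2))) =
  - \int[mu]_x (a' x * (ln ((x - u) ^+ 2 + c ^+ 2) / 2)).
Proof.
move=> B c0.
apply: (cutoff_ibp B); first by move=> x; exact: is_derive_ln_shift.
by apply: continuous_kernel => // x; apply: cvgB => //; exact: cvg_cst.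
Qed.

End calculus.

(** * The Cauchy-Pompeiu formula for product functions *)

Section pompeiu.
Variable R : realType.
Notation mu := (@lebesgue_measure R).
Implicit Types (a b : R -> R) (p q x u M A B : R) (z w l : R * R).

Lemma area_Rfubini1 (u : R * R -> R) : L1 area u ->
  \int[area]_z u z = \int[mu]_x \int[mu]_y u (x, y).
Proof.
by move=> iu; exact: (esym (@Rfubini1 _ _ _ _ R (@lebesgue_measure R) (@lebesgue_measure R) u iu)).
Qed.

Lemma area_Rfubini2 (u : R * R -> R) : L1 area u ->
  \int[area]_z u z = \int[mu]_y \int[mu]_x u (x, y).
Proof.
by move=> iu; exact: (esym (@Rfubini2 _ _ _ _ R (@lebesgue_measure R) (@lebesgue_measure R) u iu)).
Qed.

(** What [cutoff] says about a function, and also about its derivative, when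
    smoothness is forgotten. *)
Record supported_bdd p q A a : Prop := SupportedBdd {
  supported_bdd_meas : measurable_fun [set: measurableTypeR R] a;
  supported_bdd_supp : forall x, ~~ (p <= x <= q) -> a x = 0;
  supported_bdd_le : forall x, `|a x| <= A }.

Lemma cutoff_bdd p q M a a' : cutoff p q M a a' -> supported_bdd p q 1 a.
Proof.
move=> C; split; last exact: cutoff_le C.
  by apply: continuous_measurable_fun; exact: is_derive_continuous (cutoff_der C).
move=> x; rewrite negb_and => h; apply: (cutoff_supp C); rewrite negb_and.
by case/orP: h => [h|h]; [apply/orP; left|apply/orP; right];
  apply: contra h => /ltW.
Qed.

Lemma cutoff_dbdd p q M a a' : cutoff p q M a a' -> supported_bdd p q M a'.
Proof.
move=> C; split; last exact: cutoff_dle C.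
  by apply: continuous_measurable_fun; exact: cutoff_cont C.
by move=> x; exact: cutoff_dsupp C.
Qed.

Lemma measurable_tens p1 q1 A a p2 q2 B b : supported_bdd p1 q1 A a -> supported_bdd p2 q2 B b ->
  measurable_fun [set: mplane R] (fun z => a z.1 * b z.2).
Proof.
move=> ca cb; apply: measurable_funM.
  exact: (measurableT_comp (supported_bdd_meas ca) measurable_fst).
exact: (measurableT_comp (supported_bdd_meas cb) measurable_snd).
Qed.

Lemma supported_bdd_prod p1 q1 A a p2 q2 B b : supported_bdd p1 q1 A a -> supported_bdd p2 q2 B b ->
  exists2 r, 0 < r & forall z, `|a z.1 * b z.2| <= A * B * \1_(box (0, 0) r) z.
Proof.
move=> ca cb; exists (`|p1| + `|q1| + `|p2| + `|q2| + 1).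
  by rewrite ltr_wpDl// !addr_ge0.
move=> z; rewrite indicE.
have AB : `|a z.1 * b z.2| <= A * B.
  by rewrite normrM ler_pM// ?(supported_bdd_le ca)// (supported_bdd_le cb).
have [h|/negP h] := boolP (z \in _); first by rewrite mulr1.
rewrite mulr0 normr_le0; apply/negP => /negP.
rewrite mulf_eq0 negb_or => /andP[az bz]; apply: h; rewrite inE.
have h1 : p1 <= z.1 <= q1.
  by rewrite -[_ && _]negbK; apply: contra az => /(supported_bdd_supp ca) ->.
have h2 : p2 <= z.2 <= q2.
  by rewrite -[_ && _]negbK; apply: contra bz => /(supported_bdd_supp cb) ->.
move: h1 h2 => /andP[? ?] /andP[? ?].
have := ler_norm p1; have := ler_norm p2; have := ler_norm q1.
have := ler_norm q2; have := ler_norm (- p1); have := ler_norm (- p2).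
rewrite !normrN => ? ? ? ? ? ?.
have := normr_ge0 p1; have := normr_ge0 p2; have := normr_ge0 q1.
have := normr_ge0 q2 => ? ? ? ?.
by rewrite /box /dist /= !subr0 ge_max !ler_norml; apply/andP; split; apply/andP; split; lra.
Qed.

Lemma L1_box l r (c : R) : 0 <= r -> L1 area (fun z => c * \1_(box l r) z).
Proof.
move=> r0; apply: L1Z.
suff [] : L1 area (\1_(box l r)) /\ \int[area]_z \1_(box l r) z <= (2 * r) ^+ 2 by [].
apply: L1_ge0_bound => //; first exact: measurable_indic_box.
have := @int_indic_box R l r 1 r0 ler01; rewrite mul1r => <-.
by under [leRHS]eq_integral do rewrite mul1r.
Qed.

Lemma Rintegral_indic_box c r (D : R) : 0 <= r ->
  \int[area]_z (D * \1_(box c r) z) = D * (2 * r) ^+ 2.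
Proof.
move=> r0; have i1 : L1 area (\1_(box c r)).
  by have := L1_box c 1 r0; apply: eq_integrable => // z _ /=; rewrite mul1r.
rewrite RintegralZl//; congr (_ * _); rewrite /Rintegral.
under eq_integral do rewrite -[\1_ _ _]mul1r.
by rewrite int_indic_box// mul1r.
Qed.

Lemma L1_box_ker l r w (c : R) : 0 < r ->
  L1 area (fun z => c * (\1_(box l r) z * normc (ker z w))).
Proof. by move=> r0; apply: L1Z; exact: (box_kernel _ _ r0).1. Qed.

Definition rsq w z := (z.1 - w.1) ^+ 2 + (z.2 - w.2) ^+ 2.

Lemma kerE z w : ker z w = Complex ((z.1 - w.1) / rsq w z) (- ((z.2 - w.2) / rsq w z)).
Proof. by []. Qed.

Lemma rsq_ge0 w z : 0 <= rsq w z.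
Proof. by rewrite addr_ge0 ?sqr_ge0. Qed.

Lemma normc_kerE z w : normc (ker z w) = (Num.sqrt (rsq w z))^-1.
Proof. by rewrite normc_ker toCB. Qed.

Lemma measurable_coord1 w : measurable_fun [set: mplane R] (fun z => z.1 - w.1).
Proof. by apply: measurable_funB => //; exact: measurable_cst. Qed.

Lemma measurable_coord2 w : measurable_fun [set: mplane R] (fun z => z.2 - w.2).
Proof. by apply: measurable_funB => //; exact: measurable_cst. Qed.

Lemma measurable_rsq w : measurable_fun [set: mplane R] (rsq w).
Proof.
by apply: measurable_funD; apply: measurable_funX;
  [exact: measurable_coord1|exact: measurable_coord2].
Qed.

Lemma measurable_div d (T : measurableType d) (f g : T -> R) :
  measurable_fun setT f -> measurable_fun setT g -> measurable_fun setT (fun t => f t / g t).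
Proof.
move=> mf mg; apply: measurable_funM => //.
exact: (measurableT_comp (@invr_measurable R) mg).
Qed.

(** Bounds the logarithm, which is unbounded at the pole and at infinity, by
    functions already known to be integrable on squares. *)
Lemma ln_rsq_le w z : `|ln (rsq w z) / 2| <= rsq w z + normc (ker z w).
Proof.
rewrite normrM (ger0_norm (_ : 0 <= 2^-1))// normc_kerE.
have [->|s0] := eqVneq (rsq w z) 0.
  by rewrite ln0// normr0 mul0r sqrtr0 invr0 addr0.
have {}s0 : 0 < rsq w z by rewrite lt_neqAle eq_sym s0 rsq_ge0.
have q0 : 0 < Num.sqrt (rsq w z) by rewrite sqrtr_gt0.
have h1 := ln_sublinear s0.
have h2 : - ln (rsq w z) < 2 * (Num.sqrt (rsq w z))^-1.
  have -> : ln (rsq w z) = ln (Num.sqrt (rsq w z)) *+ 2.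
    by rewrite -lnXn// sqr_sqrtr// ltW.
  have : ln (Num.sqrt (rsq w z))^-1 < (Num.sqrt (rsq w z))^-1.
    by apply: ln_sublinear; rewrite invr_gt0.
  rewrite lnV ?posrE// => h; rewrite -mulNrn mulr_natl.
  by rewrite ltrMn2r.
have i0 : 0 < (Num.sqrt (rsq w z))^-1 by rewrite invr_gt0.
rewrite ler_pdivrMr// ler_norml; apply/andP; split; lra.
Qed.

Lemma supported_bdd_L1 p q A a k : supported_bdd p q A a -> continuous a -> continuous k ->
  L1 mu (fun x => a x * k x).
Proof.
move=> ca cta ck; have : continuous (fun x => a x * k x).
  by move=> x; apply: cvgM; [exact: cta|exact: ck].
move=> /(continuous_itv_L1 p q); apply: eq_integrable => // x _ /=.
rewrite indicE mem_setE in_itv /=; have [h|h] := boolP (p <= x <= q).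
  by rewrite mulr1.
by rewrite mulr0 (supported_bdd_supp ca h) mul0r.
Qed.

Lemma Rintegral_eq0 (f : R -> R) : (forall x, f x = 0) -> \int[mu]_x f x = 0.
Proof. by move=> f0; rewrite /Rintegral; under eq_integral do rewrite f0; rewrite integral0. Qed.

Lemma cutoff_atanZ p q M a a' u c (C : R) : cutoff p q M a a' ->
  \int[mu]_x (C * a x * (c / ((x - u) ^+ 2 + c ^+ 2))) =
  \int[mu]_x (- (C * a' x * atan ((x - u) / c))).
Proof.
move=> Ca; have [->|c0] := eqVneq c 0.
  transitivity (0 : R).
    by apply: Rintegral_eq0 => x; rewrite mul0r mulr0.
  by symmetry; apply: Rintegral_eq0 => x; rewrite invr0 mulr0 atan0 mulr0 oppr0.
have cta := is_derive_continuous (cutoff_der Ca).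
under [LHS]eq_Rintegral do rewrite -mulrA.
under [RHS]eq_Rintegral do rewrite -mulrA -mulNr.
rewrite !RintegralZl//.
- by rewrite (cutoff_atan u c Ca) mulrN mulNr.
- apply: (supported_bdd_L1 (cutoff_dbdd Ca) (cutoff_cont Ca)).
  by move=> x; apply: (@is_derive_continuous R _ _ (fun x => is_derive_atan_shift u x c0)).
- apply: (supported_bdd_L1 (cutoff_bdd Ca) cta).
  by apply: continuous_kernel => // x; exact: cvg_cst.
Qed.

Lemma cutoff_lnZ p q M a a' u c (C : R) : cutoff p q M a a' -> c != 0 ->
  \int[mu]_x (C * a x * ((x - u) / ((x - u) ^+ 2 + c ^+ 2))) =
  \int[mu]_x (- (C * a' x * (ln ((x - u) ^+ 2 + c ^+ 2) / 2))).
Proof.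
move=> Ca c0.
have cta := is_derive_continuous (cutoff_der Ca).
under [LHS]eq_Rintegral do rewrite -mulrA.
under [RHS]eq_Rintegral do rewrite -mulrA -mulNr.
rewrite !RintegralZl//.
- by rewrite (cutoff_ln u Ca c0) mulrN mulNr.
- apply: (supported_bdd_L1 (cutoff_dbdd Ca) (cutoff_cont Ca)).
  by move=> x; apply: (@is_derive_continuous R _ _ (fun x => is_derive_ln_shift u x c0)).
- apply: (supported_bdd_L1 (cutoff_bdd Ca) cta).
  by apply: continuous_kernel => // x; apply: cvgB => //; exact: cvg_cst.
Qed.

Lemma measurable_sg : measurable_fun [set: R] (@Num.sg R).
Proof.
apply: nondecreasing_measurable => // x y xy.
have [x0|x0|x0] := ltgtP x 0.
- rewrite (ltr0_sg x0); have [y0|y0|->] := ltgtP y 0.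
  + by rewrite (ltr0_sg y0).
  + by rewrite (gtr0_sg y0); lra.
  + by rewrite sgr0; lra.
- by rewrite !gtr0_sg// (lt_le_trans x0).
- by move: xy; rewrite x0 sgr0 sgr_ge0.
Qed.

Section tensor.
Variables (p1 q1 M1 : R) (a a' : R -> R) (p2 q2 M2 : R) (b b' : R -> R) (w : R * R).
Hypotheses (Ca : cutoff p1 q1 M1 a a') (Cb : cutoff p2 q2 M2 b b').

Let L1_tens (p p' q q' A B : R) (e f : R -> R) : supported_bdd p q A e -> supported_bdd p' q' B f ->
  forall k : R * R -> R, measurable_fun [set: mplane R] k ->
  (forall z, `|k z| <= normc (ker z w)) -> L1 area (fun z => e z.1 * f z.2 * k z).
Proof.
move=> ce cf k mk kw; have [r r0 efr] := supported_bdd_prod ce cf.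
apply: L1_le (@L1_box_ker (0, 0) r w (A * B) r0).
  by apply: measurable_funM => //; exact: measurable_tens ce cf.
by move=> z; rewrite normrM mulrA ler_pM.
Qed.

Let L1_tens_bdd (p p' q q' A B : R) (e f : R -> R) : supported_bdd p q A e -> supported_bdd p' q' B f ->
  forall (k : R * R -> R) (D : R), measurable_fun [set: mplane R] k ->
  (forall z, `|k z| <= D) -> L1 area (fun z => e z.1 * f z.2 * k z).
Proof.
move=> ce cf k D mk kD; have [r r0 efr] := supported_bdd_prod ce cf.
apply: L1_le (@L1_box (0, 0) r (A * B * D) (ltW r0)).
  by apply: measurable_funM => //; exact: measurable_tens ce cf.
by move=> z; rewrite normrM mulrAC ler_pM.
Qed.

Let mk1 : measurable_fun [set: mplane R] (fun z => (z.1 - w.1) / rsq w z).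
Proof. by apply: measurable_div; [exact: measurable_coord1|exact: measurable_rsq]. Qed.

Let mk2 : measurable_fun [set: mplane R] (fun z => (z.2 - w.2) / rsq w z).
Proof. by apply: measurable_div; [exact: measurable_coord2|exact: measurable_rsq]. Qed.

Let k1_le z : `|(z.1 - w.1) / rsq w z| <= normc (ker z w).
Proof. by have := Re_le_normc (ker z w); rewrite kerE. Qed.

Let k2_le z : `|(z.2 - w.2) / rsq w z| <= normc (ker z w).
Proof. by have := Im_le_normc (ker z w); rewrite kerE /= normrN. Qed.

Let measurable_atan : measurable_fun [set: R] (@atan R).
Proof. by apply: continuous_measurable_fun => x; exact: continuous_atan. Qed.

Let matan12 : measurable_fun [set: mplane R] (fun z => atan ((z.1 - w.1) / (z.2 - w.2))).
Proof.
apply: (measurableT_comp measurable_atan); apply: measurable_div.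
  exact: measurable_coord1.
exact: measurable_coord2.
Qed.

Let matan21 : measurable_fun [set: mplane R] (fun z => atan ((z.2 - w.2) / (z.1 - w.1))).
Proof.
apply: (measurableT_comp measurable_atan); apply: measurable_div.
  exact: measurable_coord2.
exact: measurable_coord1.
Qed.

Let atan_le (x : R) : `|atan x| <= pi / 2.
Proof.
by rewrite ler_norml; apply/andP; split; apply/ltW;
  [exact: atan_gtNpi2|exact: atan_ltpi2].
Qed.

Let L1N (u : R * R -> R) : L1 area u -> L1 area (fun z => - u z).
Proof. by move=> iu; have := L1Z (-1) iu; under eq_fun do rewrite mulN1r. Qed.

Let ca := cutoff_bdd Ca.
Let cb := cutoff_bdd Cb.
Let ca' := cutoff_dbdd Ca.
Let cb' := cutoff_dbdd Cb.

(** The two terms are integrated by parts in different variables, which turns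
    both kernels into arctangents of reciprocal arguments; their sum is a
    multiple of [sign (x y)], and the double integral splits into a product. *)
Lemma pompeiu_radial :
  \int[area]_z (a' z.1 * b z.2 * ((z.1 - w.1) / rsq w z) +
     a z.1 * b' z.2 * ((z.2 - w.2) / rsq w z)) = - (2 * pi * a w.1 * b w.2).
Proof.
have i1 := L1_tens ca' cb mk1 k1_le.
have i2 := L1_tens ca cb' mk2 k2_le.
have i3 := L1N (L1_tens_bdd ca' cb' matan21 (fun=> atan_le _)).
have i4 := L1N (L1_tens_bdd ca' cb' matan12 (fun=> atan_le _)).
rewrite RintegralD//.
have -> : \int[area]_z (a' z.1 * b z.2 * ((z.1 - w.1) / rsq w z)) =
    \int[area]_z (- (a' z.1 * b' z.2 * atan ((z.2 - w.2) / (z.1 - w.1)))).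
  rewrite (area_Rfubini1 i1) (area_Rfubini1 i3); apply: eq_Rintegral => x _.
  rewrite -(cutoff_atanZ w.2 (x - w.1) (a' x) Cb).
  by apply: eq_Rintegral => y _; rewrite /rsq /= (addrC ((y - _) ^+ 2)).
have -> : \int[area]_z (a z.1 * b' z.2 * ((z.2 - w.2) / rsq w z)) =
    \int[area]_z (- (a' z.1 * b' z.2 * atan ((z.1 - w.1) / (z.2 - w.2)))).
  rewrite (area_Rfubini2 i2) (area_Rfubini2 i4); apply: eq_Rintegral => y _ /=.
  transitivity (\int[mu]_x (- (b' y * a' x * atan ((x - w.1) / (y - w.2))))).
    rewrite -(cutoff_atanZ w.1 (y - w.2) (b' y) Ca).
    by apply: eq_Rintegral => x _; rewrite /rsq /= (mulrC (a x)).
  by apply: eq_Rintegral => x _; rewrite (mulrC (b' y)).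
rewrite -RintegralD//.
have sg_le (x : R) : `|Num.sg x| <= 1 by rewrite normr_sg; case: eqP.
transitivity (\int[area]_z (a' z.1 * b' z.2 *
    (- (pi / 2) * (Num.sg (z.1 - w.1) * Num.sg (z.2 - w.2))))).
  by apply: eq_Rintegral => z _; rewrite -opprD -mulrDr atanV_sg -mulrN mulNr.
have msg (f : R * R -> R) : measurable_fun [set: mplane R] f ->
    measurable_fun [set: mplane R] (fun z => Num.sg (f z)).
  by move=> mf; exact: (measurableT_comp measurable_sg mf).
have i5 : L1 area (fun z => a' z.1 * b' z.2 *
    (- (pi / 2) * (Num.sg (z.1 - w.1) * Num.sg (z.2 - w.2)))).
  apply: (@L1_tens_bdd _ _ _ _ _ _ _ _ ca' cb' _ (pi / 2)).
    apply: measurable_funM; first exact: measurable_cst.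
    by apply: measurable_funM; apply: msg; [exact: measurable_coord1|exact: measurable_coord2].
  have P : 0 <= pi / 2 :> R by rewrite divr_ge0 ?pi_ge0.
  by move=> z; rewrite normrM normrN (ger0_norm P) ler_piMr// normrM mulr_ile1.
rewrite (area_Rfubini1 i5).
have sgL1 p q M (e e' : R -> R) (t : R) : cutoff p q M e e' ->
    L1 mu (fun x => e' x * Num.sg (x - t)).
  move=> Ce; have := supported_bdd_L1 (cutoff_dbdd Ce) (cutoff_cont Ce) (@cst_continuous R R 1).
  move=> /L1_norm; apply: L1_le.
    apply: measurable_funM; first exact: supported_bdd_meas (cutoff_dbdd Ce).
    apply: (measurableT_comp measurable_sg).
    by apply: measurable_funB => //; exact: measurable_cst.
  by move=> x; rewrite !normrM normr1 mulr1 ler_piMr.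
transitivity (\int[mu]_x ((pi * b w.2) * (a' x * Num.sg (x - w.1)))).
  apply: eq_Rintegral => x _.
  transitivity (\int[mu]_y (- (pi / 2) * (a' x * Num.sg (x - w.1)) *
      (b' y * Num.sg (y - w.2)))).
    by apply: eq_Rintegral => y _ /=; ring.
  by rewrite RintegralZl ?(cutoff_sg _ Cb)//; [field|exact: sgL1 Cb].
by rewrite RintegralZl ?(cutoff_sg _ Ca)//; [ring|exact: sgL1 Ca].
Qed.

(** Both terms are minus the integral of [a'(x) b'(y)] times the same
    logarithm, integrated by parts in [x] for one and in [y] for the other. *)
Lemma pompeiu_angular :
  \int[area]_z (a z.1 * b' z.2 * ((z.1 - w.1) / rsq w z) -
     a' z.1 * b z.2 * ((z.2 - w.2) / rsq w z)) = 0.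
Proof.
have i1 := L1_tens ca cb' mk1 k1_le.
have i2 := L1_tens ca' cb mk2 k2_le.
have i3 : L1 area (fun z => - (a' z.1 * b' z.2 * (ln (rsq w z) / 2))).
  apply: L1N; have [r r0 efr] := supported_bdd_prod ca' cb'.
  have mln : measurable_fun [set: mplane R] (fun z => ln (rsq w z) / 2).
    apply: measurable_funM; last exact: measurable_cst.
    exact: (measurableT_comp (@measurable_ln R) (measurable_rsq w)).
  pose D := 2 * (r + `|w.1| + `|w.2|) ^+ 2.
  apply: L1_le (L1D (@L1_box (0, 0) r (M1 * M2 * D) (ltW r0))
      (@L1_box_ker (0, 0) r w (M1 * M2) r0)).
    by apply: measurable_funM => //; exact: measurable_tens ca' cb'.
  move=> z; rewrite normrM; have := efr z; rewrite indicE.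
  have [/set_mem zb|_] := boolP (z \in _); last first.
    by rewrite !(mulr0, mul0r) addr0 normr_le0 => /eqP ->; rewrite normr0 mul0r.
  rewrite !(mulr1, mul1r) => h.
  rewrite -mulrDr ler_pM// (le_trans (ln_rsq_le _ _))// lerD2r.
  have /= := zb; rewrite /box /dist /= !subr0 ge_max => /andP[z1 z2].
  have H (x y : R) (s : R) : `|x| <= r -> `|y| <= s -> 0 <= s -> (x - y) ^+ 2 <= (r + s) ^+ 2.
    move=> xr ys s0; rewrite -(@real_normK _ (x - y)) ?num_real// lerXn2r ?nnegrE ?addr_ge0 ?(ltW r0)//.
    by apply: (le_trans (ler_normB _ _)); exact: lerD.
  rewrite /rsq /D mulr_natl mulr2n -addrA; apply: lerD; apply: H => //;
    rewrite ?addr_ge0//; [by rewrite lerDl|by rewrite lerDr].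
rewrite RintegralB//; apply/eqP; rewrite subr_eq0; apply/eqP.
transitivity (\int[area]_z (- (a' z.1 * b' z.2 * (ln (rsq w z) / 2)))).
  rewrite (area_Rfubini2 i1) (area_Rfubini2 i3).
  apply: ae_eq_Rintegral.
  - exact: (@Rfubini_meas2 _ _ _ _ R mu mu _ i1).
  - exact: (@Rfubini_meas2 _ _ _ _ R mu mu _ i3).
  (* the logarithm is differentiable along the lines that miss the pole *)
  exists [set w.2]; split => //; first exact: lebesgue_measure_set1.
  move=> y /= h; apply: contrapT => yw; apply: h.
  have {}yw : y - w.2 != 0 by rewrite subr_eq0; apply/eqP.
  transitivity (\int[mu]_x (b' y * a x * ((x - w.1) / ((x - w.1) ^+ 2 + (y - w.2) ^+ 2)))).
    by apply: eq_Rintegral => x _; rewrite /rsq /= (mulrC (b' y)).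
  rewrite (cutoff_lnZ _ _ Ca yw).
  by apply: eq_Rintegral => x _; rewrite /rsq /= (mulrC (b' y)).
rewrite (area_Rfubini1 i2) (area_Rfubini1 i3).
apply: ae_eq_Rintegral.
- exact: (@Rfubini_meas1 _ _ _ _ R mu mu _ i3).
- exact: (@Rfubini_meas1 _ _ _ _ R mu mu _ i2).
exists [set w.1]; split => //; first exact: lebesgue_measure_set1.
move=> x /= h; apply: contrapT => xw; apply: h.
have {}xw : x - w.1 != 0 by rewrite subr_eq0; apply/eqP.
symmetry.
transitivity (\int[mu]_y (a' x * b y * ((y - w.2) / ((y - w.2) ^+ 2 + (x - w.1) ^+ 2)))).
  by apply: eq_Rintegral => y _; rewrite /rsq /= (addrC ((x - _) ^+ 2)).
rewrite (cutoff_lnZ _ _ Cb xw).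
by apply: eq_Rintegral => y _; rewrite /rsq /= (addrC ((x - _) ^+ 2)).
Qed.

(** The d-bar derivative of [a(x) b(y)]. *)
Definition dbart z : R[i] := Complex (a' z.1 * b z.2 / 2) (a z.1 * b' z.2 / 2).

Lemma cmeas_dbart : cmeas (dbart : mplane R -> R[i]).
Proof.
split; apply: measurable_funM; try exact: measurable_cst.
  exact: measurable_tens ca' cb.
exact: measurable_tens ca cb'.
Qed.

Lemma dbart_ker_L1 : cL1 area (fun z => ker w z * dbart z).
Proof.
have [r1 r10 h1] := supported_bdd_prod ca' cb; have [r2 r20 h2] := supported_bdd_prod ca cb'.
apply: cL1_le (L1D (@L1_box_ker (0, 0) r1 w (M1 * 1) r10)
  (@L1_box_ker (0, 0) r2 w (1 * M2) r20)).
  by apply: cmeasM; [exact: cmeas_kerr|exact: cmeas_dbart].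
move=> z; rewrite normcM normc_kerC mulrC !mulrA -mulrDl ler_wpM2r ?normc_ge0//.
apply: (le_trans (normc_le_ReIm _)); rewrite /dbart /= !normrM (ger0_norm (_ : 0 <= 2^-1))//.
have half (x y : R) : 0 <= x -> x <= y -> x / 2 <= y by move=> ? ?; lra.
by apply: lerD; apply: half => //; rewrite -?normrM.
Qed.

(** The Cauchy-Pompeiu formula at [w]: the real part of the product of the kernel
    with [dbart] is the radial combination, the imaginary part the angular one. *)
Lemma pompeiu : cint area (fun z => ker w z * dbart z) = (pi * (a w.1 * b w.2))%:C%C.
Proof.
rewrite /cint; congr Complex.
  transitivity (\int[area]_z (- 2^-1 * (a' z.1 * b z.2 * ((z.1 - w.1) / rsq w z) +
     a z.1 * b' z.2 * ((z.2 - w.2) / rsq w z)))).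
    apply: eq_Rintegral => z _; rewrite ReM kerN ReN ImN kerE /dbart /=.
    by ring.
  rewrite RintegralZl//; last first.
    by apply: L1D; [exact: (L1_tens ca' cb)|exact: (L1_tens ca cb')].
  by rewrite pompeiu_radial; field.
transitivity (\int[area]_z (- 2^-1 * (a z.1 * b' z.2 * ((z.1 - w.1) / rsq w z) -
     a' z.1 * b z.2 * ((z.2 - w.2) / rsq w z)))).
  apply: eq_Rintegral => z _; rewrite ImM kerN ReN ImN kerE /dbart /=.
  by ring.
rewrite RintegralZl//; last first.
  by apply: L1B; [exact: (L1_tens ca cb')|exact: (L1_tens ca' cb)].
by rewrite pompeiu_angular mulr0.
Qed.

End tensor.
End pompeiu.

(** * Pairing a Cauchy transform with a d-bar derivative *)

Section cauchy.
Variable R : realType.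
Implicit Types (z w l c : R * R).
Variable eta : {finite_measure set (mplane R) -> \bar R}.

(** Integrability for Fubini's theorem: integrating in [z] first leaves a
    bounded multiple of [normc (F w)], by [box_kernel]. *)
Lemma cL1_prod (F G : mplane R -> R[i]) c r D : 0 < r -> cL1 eta F -> cmeas G ->
  (forall z, normc (G z) <= D * \1_(box c r) z) ->
  cL1 (eta \x area)%E (fun p => F p.1 * (ker p.1 p.2 * G p.2)).
Proof.
move=> r0 iF mG GD.
have mH : cmeas (fun p : mplane R * mplane R => F p.1 * (ker p.1 p.2 * G p.2)).
  apply: cmeasM; first exact: (cmeas_comp measurable_fst (cL1_meas iF)).
  by apply: cmeasM; [exact: cmeas_ker2|exact: (cmeas_comp measurable_snd mG)].
refine (@cL1_le _ _ _ _ _ _ mH (fun=> lexx _) _).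
have iN := cL1_normc iF.
have D0 : 0 <= D.
  have := le_trans (normc_ge0 _) (GD c).
  by rewrite indicE mem_set ?mulr1// /box /= distxx ltW.
apply: L1_prod; first exact: measurable_normc.
apply: (@le_lt_trans _ _ (\int[eta]_w ((D * (20 * r)) * normc (F w))%:E)%E).
  apply: ge0_le_integral => //.
  - by move=> w _; exact: integral_ge0.
  - apply: (@measurable_fun_fubini_tonelli_F _ _ _ _ R (@area R)
      (fun p : mplane R * mplane R => (`|normc (F p.1 * (ker p.1 p.2 * G p.2))|%:E)%E)) => //.
    apply/measurable_EFinP; apply: measurableT_comp => //.
    exact: measurable_normc.
  - apply/measurable_EFinP; apply: measurable_funM; first exact: measurable_cst.
    exact: L1_meas iN.
  move=> w _ /=.
  have [iK bK] := box_kernel w c r0.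
  apply: (@le_trans _ _ (\int[area]_z ((normc (F w) * D) * (\1_(box c r) z * normc (ker z w)))%:E)%E).
    apply: ge0_le_integral => //.
    - apply/measurable_EFinP; apply: measurableT_comp => //.
      apply: measurable_normc; apply: cmeasM; first exact: cmeas_cst.
      by apply: cmeasM => //; exact: cmeas_kerr.
    - by apply/measurable_EFinP; apply: measurable_funM;
        [exact: measurable_cst|exact: L1_meas iK].
    move=> z _; rewrite lee_fin ger0_norm ?normc_ge0// !normcM -mulrA.
    rewrite ler_wpM2l ?normc_ge0// mulrC mulrA normc_kerC.
    by rewrite ler_wpM2r ?normc_ge0.
  rewrite (L1_finite (L1Z _ iK)) RintegralZl// lee_fin.
  have -> : D * (20 * r) * normc (F w) = normc (F w) * D * (20 * r) by ring.
  by rewrite ler_wpM2l// mulr_ge0// normc_ge0.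
by rewrite (L1_finite (L1Z _ iN)) ltry.
Qed.

(** By Fubini's theorem on each square, the potential of the finite measure
    [eta] is locally integrable, hence finite almost everywhere. *)
Lemma potential_ae : {ae area, forall z, cL1 eta (fun w => ker w z)}.
Proof.
have H n : {ae area, forall z, box (0, 0) n.+1%:R z -> cL1 eta (fun w => ker w z)}.
  pose G z : R[i] := (\1_(box (0, 0) n.+1%:R) z : R)%:C%C.
  have i1 : cL1 eta (fun=> 1).
    split => /=; apply: finite_measure_integrable_cst => //.
  have := @cL1_prod (fun=> 1) G (0, 0) n.+1%:R 1 (ltr0Sn _ _) i1.
  have mG : cmeas (G : mplane R -> _).
    by apply: cmeas_real; exact: measurable_indic_box.
  move=> /(_ mG) [] .
    by move=> z; rewrite /G normcE /= expr0n addr0 sqrtr_sqr mul1r ger0_norm.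
  move=> h1 h2; have := cfubini_ae2 (conj h1 h2); apply: filterS => z /=.
  move=> ih zb; move: ih; rewrite /G indicE mem_set//=.
  by under eq_fun do rewrite mul1r mulr1.
have := ae_foralln H; apply: filterS => z /(_ (Num.truncn (dist z (0, 0)))) h.
by apply: h; rewrite /box /= ltW// truncnS_gt.
Qed.

Section local.
Variables (c : R * R) (r M : R) (a a' b b' : R -> R).
Hypothesis (Ca : cutoff (c.1 - r) (c.1 + r) M a a').
Hypothesis (Cb : cutoff (c.2 - r) (c.2 + r) M b b').

Lemma cutoff_r_gt0 : 0 < r.
Proof. by have := cutoff_lt Ca; lra. Qed.

Lemma normc_dbart z : normc (dbart a a' b b' z) <= M * \1_(box c r) z.
Proof.
have ca := cutoff_bdd Ca; have cb := cutoff_bdd Cb.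
have ca' := cutoff_dbdd Ca; have cb' := cutoff_dbdd Cb.
apply: (le_trans (normc_le_ReIm _)); rewrite /dbart /= !normrM (ger0_norm (_ : 0 <= 2^-1))//.
rewrite indicE; have [_|/negP h] := boolP (z \in _).
  rewrite mulr1.
  have h1 : `|a' z.1| * `|b z.2| <= M * 1 by rewrite ler_pM ?(supported_bdd_le ca') ?(supported_bdd_le cb).
  have h2 : `|a z.1| * `|b' z.2| <= 1 * M by rewrite ler_pM ?(supported_bdd_le ca) ?(supported_bdd_le cb').
  by lra.
rewrite mulr0.
have [z1|z1] := boolP (c.1 - r <= z.1 <= c.1 + r); last first.
  by rewrite (supported_bdd_supp ca z1) (supported_bdd_supp ca' z1) normr0 !mul0r addr0.
have [z2|z2] := boolP (c.2 - r <= z.2 <= c.2 + r); last first.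
  by rewrite (supported_bdd_supp cb z2) (supported_bdd_supp cb' z2) normr0 !(mulr0, mul0r) addr0.
by exfalso; apply: h; rewrite inE box_prod /=; split; rewrite /= in_itv.
Qed.

(** The distributional equation satisfied by a Cauchy transform: exchange the
    integrals and apply [pompeiu] to the inner one.  It is used both for the
    density [F = f] and for [F w = f w / (w - l)]. *)
Lemma cauchy_fubini (F h : mplane R -> R[i]) : cL1 eta F -> cmeas h ->
  {ae area, forall z, cL1 eta (fun w => F w * ker w z) /\
    h z = cint eta (fun w => F w * ker w z)} ->
  cint area (fun z => h z * dbart a a' b b' z) =
  cint eta (fun w => F w * (pi * (a w.1 * b w.2))%:C%C).
Proof.
move=> iF mh hF.
have mG := cmeas_dbart Ca Cb.
have iH := cL1_prod cutoff_r_gt0 iF mG normc_dbart.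
transitivity (cint area (fun z => cint eta (fun w => F w * (ker w z * dbart a a' b b' z)))).
  apply: cint_ae.
  - exact: cmeasM.
  - by split; [exact: (Rfubini_meas2 iH.1)|exact: (Rfubini_meas2 iH.2)].
  apply: aeS hF => z [i1 ->]; rewrite -cintZr//.
  by apply: eq_cint => w; rewrite mulrA.
rewrite -(cfubini iH); apply: eq_cint => w /=.
rewrite cintZ; last exact: (dbart_ker_L1 w Ca Cb).
by rewrite (pompeiu w Ca Cb).
Qed.

End local.
End cauchy.

(** * Continuous functions on the plane *)

Section plane_topology.
Variable R : realType.
Implicit Types (z w l c : R * R) (K : set (R * R)).

Lemma nbhs_box z (U : set (R * R)) :
  nbhs z U <-> exists2 r : R, 0 < r & forall w, dist w z <= r -> U w.
Proof.
split.
  move=> /nbhs_ballP[e /= e0 eU]; exists (e / 2); first by rewrite divr_gt0.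
  move=> w wz; apply: eU.
  have we : dist w z < e by apply: (le_lt_trans wz); rewrite ltr_pdivrMr// ltr_pMr// ltr1n.
  by move: we; rewrite /dist gt_max => /andP[h1 h2]; split; rewrite /ball /= distrC.
move=> [r r0 rU]; apply/nbhs_ballP; exists r => //= w [h1 h2]; apply: rU.
by rewrite /dist ge_max; move: h1 h2; rewrite /ball /= distrC (distrC z.2) => /ltW -> /ltW ->.
Qed.

Lemma compact_box l (r : R) : compact (box l r).
Proof.
rewrite box_prod.
by apply: compact_setX; exact: segment_compact.
Qed.

Lemma compact_in_box K : compact K ->
  exists2 r : R, 0 < r & forall z, K z -> dist z (0, 0) <= r.
Proof.
move=> /compact_bounded[M [Mr KM]]; exists (`|M| + 1); first by rewrite ltr_wpDl.
move=> z /(KM (`|M| + 1)); rewrite /dist !subr0; apply.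
by rewrite (le_lt_trans (ler_norm M))// ltrDl.
Qed.

(** Compactness, in the form that makes a local bound on a scale [d] uniform. *)
Lemma unif_near_compact K (P : R -> R * R -> Prop) : compact K ->
  (forall x, K x -> exists2 d : R, 0 < d &
     forall z e, dist z x <= d -> 0 < e -> e <= d -> P e z) ->
  exists2 d : R, 0 < d & forall z, K z -> P d z.
Proof.
move=> /compact_near_coveringP cK h.
have [] : \forall e \near (0 : R)^'+, K `<=` P e.
  apply: cK => x /h[d d0 dP].
  exists ([set z | dist z x <= d], [set e | 0 < e <= d]).
    split => /=; first by apply/nbhs_box; exists d.
    near=> e; apply/andP; split => //.
    by near: e; exact: nbhs_right_le.
  by move=> [z e] /= [zx /andP[e0 ed]]; exact: dP.
move=> d /= d0 dP; exists (d / 2); first by rewrite divr_gt0.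
apply: dP; last by rewrite divr_gt0.
by rewrite /ball /= sub0r normrN ger0_norm ?divr_ge0 ?(ltW d0)// ltr_pdivrMr// ltr_pMr// ltr1n.
Unshelve. all: by end_near. Qed.

Lemma normc_norm (x : R[i]) : `|x| = ((normc x)%:C)%C.
Proof. by case: x. Qed.

Lemma cvg_normc T (F : set_system T) {FF : Filter F} (f : T -> R[i]^o) (y : R[i]^o) :
  f @ F --> y <-> forall e : R, 0 < e -> \forall t \near F, normc (y - f t) <= e.
Proof.
split.
  move=> /cvgrPdist_le h e e0.
  have /h : 0 < (e%:C)%C by rewrite ltcR.
  by apply: filterS => t; rewrite normc_norm lecR.
move=> h; apply/cvgrPdist_le => -[er ei]; rewrite ltcE /= => /andP[/eqP -> /h].
by apply: filterS => t; rewrite normc_norm lecE /= eqxx.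
Qed.

Lemma ccontinuousP (g : R * R -> R[i]^o) z : {for z, continuous g} <->
  forall e : R, 0 < e -> exists2 d : R, 0 < d &
    forall w, dist w z <= d -> normc (g w - g z) <= e.
Proof.
split.
  move=> /cvg_normc h e /h /nbhs_box[d d0 dh]; exists d => // w /dh.
  by rewrite normcB.
move=> h; apply/cvg_normc => e /h[d d0 dh]; apply/nbhs_box; exists d => // w /dh.
by rewrite normcB.
Qed.

Lemma ccontinuous_unif (g : R * R -> R[i]^o) (r e : R) : continuous g -> 0 < e ->
  exists2 d : R, 0 < d & forall z w, dist z (0, 0) <= r -> dist w z <= d ->
    normc (g w - g z) <= e.
Proof.
move=> cg e0.
have [] := @unif_near_compact (box (0, 0) r)
   (fun d z => forall w, dist w z <= d -> normc (g w - g z) <= e).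
- exact: compact_box.
- move=> x _; have e2 : 0 < e / 2 by rewrite divr_gt0.
  have [d d0 dh] := (ccontinuousP g x).1 (cg x) _ e2.
  exists (d / 2); first by rewrite divr_gt0.
  move=> z s zx s0 sd w wz.
  have -> : g w - g z = (g w - g x) - (g z - g x) by rewrite opprB addrA subrK.
  apply: (le_trans (ler_normcD _ _)); rewrite normc_opp [leRHS](splitr e).
  apply: lerD; apply: dh.
    apply: (le_trans (dist_tri z w x)); rewrite [leRHS](splitr d).
    by apply: lerD => //; exact: le_trans wz sd.
  by apply: (le_trans zx); lra.
by move=> d d0 dh; exists d => // z w zr; exact: dh.
Qed.

Lemma ccontinuous_bounded (g : R * R -> R[i]^o) (r : R) : continuous g ->
  exists2 B : R, 0 < B & forall z, dist z (0, 0) <= r -> normc (g z) <= B.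
Proof.
move=> cg; have [|x _|d d0 dh] := @unif_near_compact (box (0, 0) r)
  (fun d z => normc (g z) <= d^-1).
- exact: compact_box.
- have [d d0 dh] := (ccontinuousP g x).1 (cg x) _ ltr01.
  have G0 : 0 < normc (g x) + 1 by rewrite ltr_wpDl ?normc_ge0.
  exists (Num.min d (normc (g x) + 1)^-1); first by rewrite lt_min d0 invr_gt0.
  move=> z e; rewrite le_min => /andP[zd _] e0; rewrite le_min => /andP[_ ee].
  apply: (@le_trans _ _ (normc (g x) + 1)).
    have -> : g z = g x + (g z - g x) by rewrite addrC subrK.
    by apply: (le_trans (ler_normcD _ _)); rewrite lerD2l; exact: dh.
  by rewrite -[leLHS]invrK lef_pV2 ?posrE ?invr_gt0.
by exists d^-1; rewrite ?invr_gt0.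
Qed.

(** The rational squares form a countable basis.  Stated for a property [P] of
    sets that passes to subsets, it gives both the measurability of open sets
    and the nullity of the complement of the support. *)
Lemma open_box_cover (P : set (R * R) -> Prop) (U : set (R * R)) :
  (forall z, U z -> exists2 r : R, 0 < r & P (box z r)) ->
  (forall A B, A `<=` B -> P B -> P A) ->
  U `<=` \bigcup_(q1 : rat) \bigcup_(q2 : rat) \bigcup_(n : nat)
    [set z | P (box (ratr q1, ratr q2) n.+1%:R^-1) /\ box (ratr q1, ratr q2) n.+1%:R^-1 z].
Proof.
move=> h PS z /h[r r0 rP].
have [n nr] : exists n : nat, n.+1%:R^-1 < r / 2.
  exists (Num.truncn (r / 2)^-1); rewrite invf_plt ?posrE ?divr_gt0//.
  exact: truncnS_gt.
have n0 : 0 < n.+1%:R^-1 :> R by rewrite invr_gt0.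
have H (x : R) : exists q : rat, `|x - ratr q| <= n.+1%:R^-1.
  have xx : x - n.+1%:R^-1 < x + n.+1%:R^-1.
    by rewrite ltrBlDr -addrA ltrDl addr_gt0.
  have [q] := rat_in_itvoo xx.
  rewrite in_itv /= => /andP[q1 q2]; exists q.
  by rewrite distrC ler_distl !ltW.
have [q1 h1] := H z.1; have [q2 h2] := H z.2.
exists q1 => //; exists q2 => //; exists n => //.
have zq : dist z (ratr q1, ratr q2) <= n.+1%:R^-1 by rewrite ge_max /= h1.
split=> //; apply: PS rP => w; rewrite /box /= => wq.
apply: (le_trans (dist_tri (ratr q1, ratr q2) w z)); rewrite (distC _ z).
rewrite [leRHS](splitr r); apply: lerD; exact: le_trans (ltW nr).
Qed.

Lemma open_measurable_plane (U : set (mplane R)) : open (U : set (R * R)) -> measurable U.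
Proof.
move=> oU.
pose F (q1 q2 : rat) (n : nat) : set (mplane R) :=
  if `[< box (ratr q1, ratr q2) n.+1%:R^-1 `<=` U >] then
    box (ratr q1, ratr q2) n.+1%:R^-1 else set0.
have -> : U = \bigcup_q1 \bigcup_q2 \bigcup_n F q1 q2 n.
  apply/seteqP; split => z.
    move=> zU; have [||q1 _ [q2 _ [n _ [h1 h2]]]] :=
      @open_box_cover (fun A => A `<=` U) U _ _ z zU.
    - by move=> w Uw; have /nbhs_box[r r0 rU] := open_nbhs_nbhs (conj oU Uw); exists r.
    - by move=> A B AB BU; exact: subset_trans BU.
    - exists q1 => //; exists q2 => //; exists n => //.
      by rewrite /F asboolT.
  move=> [q1 _ [q2 _ [n _]]]; rewrite /F; case: ifPn => // /asboolP; exact.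
apply: bigcupT_measurable_rat => q1; apply: bigcupT_measurable_rat => q2.
apply: bigcupT_measurable => n; rewrite /F; case: ifPn => // _.
exact: measurable_box.
Qed.

Lemma continuous_measurable_plane (u : R * R -> R) : continuous u ->
  measurable_fun [set: mplane R] u.
Proof.
move=> /continuousP cu; apply: (measurability _ (RGenOInfty.measurableE R)) => //.
move=> /= _ [_ [x ->] <-]; apply: measurableI => //.
by apply: open_measurable_plane; apply: cu; exact: interval_open.
Qed.

Lemma ccontinuous_cmeas (g : R * R -> R[i]^o) : continuous g -> cmeas (g : mplane R -> R[i]).
Proof.
move=> cg; split; apply: continuous_measurable_plane => z;
  apply/cvgrPdist_le => e e0; apply/nbhs_box;
  have [d d0 dh] := (ccontinuousP g z).1 (cg z) _ e0;
  exists d => // w /dh wz; apply: le_trans wz; rewrite normcB.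
  by have := Re_le_normc (g z - g w); rewrite ReD ReN.
by have := Im_le_normc (g z - g w); rewrite ImD ImN.
Qed.

End plane_topology.

(** * A smooth step *)

Section smooth_step.
Variable R : realType.
Implicit Types (u v : R -> R) (x y s t r : R) (n k : nat).

(** Existence of [n] continuous successive derivatives, phrased with derivatives
    given by [is_derive]. *)
Fixpoint C1n n u : Prop :=
  if n is m.+1 then exists2 u', (forall x, is_derive x 1 u (u' x)) & C1n m u'
  else continuous u.

Lemma C1n_pred n u : C1n n.+1 u -> C1n n u.
Proof.
elim: n u => [u [u' du _]|n IH u [u' du Cu']]; first exact: is_derive_continuous du.
by exists u' => //; exact: IH.
Qed.

Lemma C1nD n u v : C1n n u -> C1n n v -> C1n n (fun x => u x + v x).
Proof.
elim: n u v => [u v cu cv x|n IH u v [u' du Cu] [v' dv Cv]].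
  by apply: cvgD; [exact: cu|exact: cv].
exists (fun x => u' x + v' x); last exact: IH.
by move=> x; exact: is_deriveD.
Qed.

Lemma C1nZ n (c : R) u : C1n n u -> C1n n (fun x => c * u x).
Proof.
elim: n u => [u cu x|n IH u [u' du Cu]].
  by apply: cvgM; [exact: cvg_cst|exact: cu].
exists (fun x => c * u' x); last exact: IH.
by move=> x; exact: is_deriveZ.
Qed.

Lemma C1nM n u v : C1n n u -> C1n n v -> C1n n (fun x => u x * v x).
Proof.
elim: n u v => [u v cu cv x|n IH u v hu hv].
  by apply: cvgM; [exact: cu|exact: cv].
have [u' du Cu] := hu; have [v' dv Cv] := hv.
exists (fun x => u x * v' x + v x * u' x).
  by move=> x; exact: is_deriveM.
by apply: C1nD; apply: IH => //; exact: C1n_pred.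
Qed.

Lemma C1nV n u : (forall x, u x != 0) -> C1n n u -> C1n n (fun x => (u x)^-1).
Proof.
move=> u0; elim: n => [cu x|n IH hu].
  by apply: cvgV => //; exact: cu.
have [u' du Cu] := hu.
exists (fun x => (-1) * ((u x)^-1 * ((u x)^-1 * u' x))).
  move=> x; apply: (is_derive_eq (is_deriveV (u0 x) (du x))).
  by rewrite /GRing.scale /= expr2 invfM; ring.
have h := IH (C1n_pred hu).
by apply: C1nZ; apply: C1nM => //; exact: C1nM.
Qed.

Lemma is_derive_affine u u' s t x : is_derive (s * x + t) 1 u (u' (s * x + t)) ->
  is_derive x 1 (fun x => u (s * x + t)) (s * u' (s * x + t)).
Proof.
move=> du.
have H : is_derive x 1 (fun x => s * x + t) s.
  have -> : (fun x => s * x + t) = s *: (fun x => x) + cst t by apply/funext.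
  by apply: is_derive_eq; rewrite addr0 scaler1.
have := @is_derive1_comp R u _ x _ _ du H.
by rewrite mulrC.
Qed.

Lemma C1n_affine n u s t : C1n n u -> C1n n (fun x => u (s * x + t)).
Proof.
elim: n u => [u cu x|n IH u [u' du Cu]].
  apply: (@continuous_comp _ _ _ (fun x => s * x + t) u); last exact: cu.
  apply: cvgD; last exact: cvg_cst.
  by apply: cvgM; [exact: cvg_cst|exact: cvg_id].
exists (fun x => s * u' (s * x + t)); last exact/C1nZ/IH.
by move=> x; exact: is_derive_affine.
Qed.

(** The functions [x^-k exp (- 1 / x)], extended by 0; the family is closed under
    derivation, so all its members are smooth. *)
Definition flat k x : R := if 0 < x then x^-1 ^+ k * expR (- x^-1) else 0.

Lemma expR_ge_pow n t : 0 <= t -> t ^+ n.+1 <= n.+1`!%:R * expR t.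
Proof.
move=> t0; rewrite -ler_pdivrMl ?ltr0n ?fact_gt0// mulrC.
by apply: le_trans (expR_ge1Dxn n t0); rewrite lerDr.
Qed.

Lemma flat_le k x : 0 < x -> `|flat k x| <= k.+2`!%:R * x ^+ 2.
Proof.
move=> x0; rewrite /flat x0.
have i0 : 0 < x^-1 by rewrite invr_gt0.
rewrite ger0_norm ?mulr_ge0 ?exprn_ge0 ?expR_ge0 ?(ltW i0)//.
have := expR_ge_pow k.+1 (ltW i0).
rewrite expRN ler_pdivrMr ?expR_gt0// => h.
rewrite mulrAC -ler_pdivrMr ?exprn_gt0//; apply: le_trans h.
by rewrite -exprVn -exprD addn2.
Qed.

(** At 0 the derivative is 0 because [flat k] is at most a multiple of
    [x ^+ 2], by [flat_le]. *)
Lemma is_derive_flat k x :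
  is_derive x 1 (flat k) (flat k.+2 x + (- k%:R) * flat k.+1 x).
Proof.
have [x0|x0|->] := ltgtP x 0.
- have -> : flat k.+2 x + (- k%:R) * flat k.+1 x = 0.
    by rewrite /flat ltNge (ltW x0)/= mulr0 addr0.
  apply: (near_eq_is_derive _ (is_derive_cst (0 : R) x 1)).
  near=> y; rewrite /flat ltNge ifN// negbK.
  by apply: ltW; near: y; exact: lt_nbhsl.
- have x1 : x != 0 by rewrite gt_eqF.
  have dV : is_derive x 1 (fun y : R => y^-1) (- x ^- 2).
    apply: (is_derive_eq (@is_deriveV R (fun y => y) x 1 1 x1 _)).
    by rewrite /GRing.scale /= mulr1.
  have dE : is_derive x 1 (fun y : R => expR (- y^-1)) (expR (- x^-1) * x ^- 2).
    have dN : is_derive x 1 (fun y : R => - y^-1) (x ^- 2).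
      by apply: (is_derive_eq (is_deriveN dV)); rewrite opprK.
    exact: (@is_derive1_comp R expR _ x _ _ (is_derive_expR _) dN).
  have dX : is_derive x 1 (fun y : R => y^-1 ^+ k) ((k%:R * x^-1 ^+ k.-1) * (- x ^- 2)).
    have -> : (fun y : R => y^-1 ^+ k) = (fun y : R => y^-1) ^+ k.
      by apply/funext => y; rewrite exprfctE.
    exact: (is_derive_eq (is_deriveX k dV)).
  apply: (@near_eq_is_derive _ _ _ (fun y => y^-1 ^+ k * expR (- y^-1))).
    near=> y; rewrite /flat ifT//.
    by near: y; exact: lt_nbhsr.
  apply: (is_derive_eq (is_deriveM dX dE)).
  rewrite /flat x0 /GRing.scale /= -exprVn.
  case: k {dX} => [|k] /=; first by rewrite !expr0; ring.
  by rewrite !exprS; ring.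
have -> : flat k.+2 0 + (- k%:R) * flat k.+1 0 = 0.
  by rewrite /flat ltxx mulr0 addr0.
have H : h^-1 *: (flat k (h + 0) - flat k 0) @[h --> 0^'] --> (0 : R).
  apply/cvgrPdist_le => e e0.
  pose C : R := k.+2`!%:R.
  have C0 : 0 < C by rewrite ltr0n fact_gt0.
  have eC : 0 < e / C by rewrite divr_gt0.
  near=> h; rewrite sub0r normrN addr0 /flat ltxx subr0 /GRing.scale /=.
  have [h0|h0] := ltP 0 h; last by rewrite mulr0 normr0 ltW.
  have := flat_le k h0; rewrite /flat h0 => hk.
  rewrite normrM normfV (gtr0_norm h0) ler_pdivrMl//.
  have hh : h <= e / C.
    by rewrite -(gtr0_norm h0); near: h; apply: dnbhs0_le; exact: eC.
  rewrite ler_pdivlMr// in hh.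
  apply: (le_trans hk); have -> : k.+2`!%:R * h ^+ 2 = h * (h * C) by rewrite /C; ring.
  by rewrite ler_wpM2l// ltW.
have H' : h^-1 *: ((flat k \o shift 0) (h *: 1) - flat k 0) @[h --> 0^'] --> (0 : R).
  move: H; apply: cvg_trans; apply: near_eq_cvg; near=> h.
  by rewrite /= /GRing.scale /= mulr1.
apply: DeriveDef; first by apply/cvg_ex; exists 0.
exact: (cvg_lim (@Rhausdorff R) H').
Unshelve. all: by end_near. Qed.

Lemma C1n_flat n k : C1n n (flat k).
Proof.
elim: n k => [k|n IH k].
  by apply: is_derive_continuous => x; exact: is_derive_flat.
exists (fun x => flat k.+2 x + (- k%:R) * flat k.+1 x).
  by move=> x; exact: is_derive_flat.
by apply: C1nD => //; exact: C1nZ.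
Qed.

Lemma flat_ge0 x : 0 <= flat 0 x.
Proof. by rewrite /flat; case: ifP => // _; rewrite mulr_ge0 ?expR_ge0. Qed.

Lemma flat_gt0 x : 0 < x -> 0 < flat 0 x.
Proof. by move=> x0; rewrite /flat x0 expr0 mul1r expR_gt0. Qed.

Lemma flat_le0 x : x <= 0 -> flat 0 x = 0.
Proof. by rewrite /flat ltNge => ->. Qed.

Lemma flat_ndecr x y : x <= y -> flat 0 x <= flat 0 y.
Proof.
move=> xy; have [x0|x0] := leP x 0; first by rewrite flat_le0// flat_ge0.
have y0 := lt_le_trans x0 xy.
by rewrite /flat x0 y0 !expr0 !mul1r ler_expR lerN2 lef_pV2.
Qed.

Definition step x : R := flat 0 x / (flat 0 x + flat 0 (1 - x)).

Lemma step_den x : 0 < flat 0 x + flat 0 (1 - x).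
Proof.
have [x0|x0] := ltP 0 x; first by rewrite ltr_pwDl ?flat_gt0// flat_ge0.
by rewrite ltr_wpDl ?flat_ge0// flat_gt0//; lra.
Qed.

Lemma step_ge0 x : 0 <= step x.
Proof. by rewrite divr_ge0 ?flat_ge0// ltW ?step_den. Qed.

Lemma step_le1 x : step x <= 1.
Proof. by rewrite ler_pdivrMr ?step_den// mul1r lerDl flat_ge0. Qed.

Lemma step0 x : x <= 0 -> step x = 0.
Proof. by move=> x0; rewrite /step flat_le0// mul0r. Qed.

Lemma step1 x : 1 <= x -> step x = 1.
Proof.
move=> x1; have := step_den x; rewrite /step (@flat_le0 (1 - x)) ?subr_le0// addr0.
by move=> h; rewrite divff// gt_eqF.
Qed.

Lemma step_ndecr x y : x <= y -> step x <= step y.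
Proof.
move=> xy; rewrite /step ler_pdivrMr ?step_den// mulrAC ler_pdivlMr ?step_den//.
rewrite !mulrDr (mulrC (flat 0 y) (flat 0 x)) lerD2l.
by apply: ler_pM; rewrite ?flat_ge0// flat_ndecr// lerD2l lerN2.
Qed.

Lemma C1n_step n : C1n n step.
Proof.
apply: C1nM; first exact: C1n_flat.
apply: C1nV; first by move=> x; rewrite gt_eqF// step_den.
apply: C1nD; first exact: C1n_flat.
rewrite (_ : (fun x => flat 0 (1 - x)) = fun x => flat 0 ((-1) * x + 1)).
  by apply: C1n_affine; exact: C1n_flat.
by apply/funext => x; congr flat; ring.
Qed.

Lemma dstep_ex : exists (S' : R -> R) (M : R),
  [/\ forall x, is_derive x 1 step (S' x), continuous S', 0 < M & forall x, `|S' x| <= M].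
Proof.
have [S' dS cS] := C1n_step 1.
have : compact [set S' x | x in `[0, 1]].
  apply: continuous_compact; last exact: segment_compact.
  exact: continuous_subspaceT.
move=> /compact_bounded[M [Mr h]].
exists S', (`|M| + 1); split; [exact: dS|exact: cS|by rewrite ltr_wpDl|].
move=> x; have [x01|x01] := boolP (x \in `[0, 1]).
  have MM : M < `|M| + 1 by rewrite (le_lt_trans (ler_norm _))// ltrDl.
  by apply: (h _ MM); exists x.
suff -> : S' x = 0 by rewrite normr0 addr_ge0.
have [_ <-] := dS x.
move: x01; rewrite in_itv /= negb_and -!ltNge => /orP[xp|qx].
  rewrite (@near_eq_derive _ _ _ step (cst 0)) ?derive_cst//.
  near=> y; rewrite step0//.
  by apply: ltW; near: y; exact: lt_nbhsl.
rewrite (@near_eq_derive _ _ _ step (cst 1)) ?derive_cst//.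
near=> y; rewrite step1//.
by apply: ltW; near: y; exact: lt_nbhsr.
Unshelve. all: by end_near. Qed.

(** In the coordinate [(x - o) / r], rises from 0 to 1 on [[s, s + 1]] and falls
    back on [[t, t + 1]].  Consecutive windows telescope, so they make a
    partition of unity. *)
Definition window (o : R) r s t x : R := step ((x - o) / r - s) - step ((x - o) / r - t).

Lemma window_aff (o r s x : R) : (x - o) / r - s = r^-1 * x + (- (o / r) - s).
Proof. by rewrite mulrBl; ring. Qed.

Lemma C1n_window n (o r s t : R) : C1n n (window o r s t).
Proof.
have -> : window o r s t = fun x => step (r^-1 * x + (- (o / r) - s)) +
    (-1) * step (r^-1 * x + (- (o / r) - t)).
  by apply/funext => x; rewrite /window !window_aff mulN1r.
by apply: C1nD; [|apply: C1nZ]; apply: C1n_affine; exact: C1n_step.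
Qed.

Section window_props.
Variables (o r s t : R).
Hypotheses (r0 : 0 < r) (st : s <= t).

Lemma window_ge0 x : 0 <= window o r s t x.
Proof. by rewrite subr_ge0 step_ndecr// lerD2l lerN2. Qed.

Lemma window_le1 x : window o r s t x <= 1.
Proof. by rewrite lerBlDr (le_trans (step_le1 _))// lerDl step_ge0. Qed.

Lemma window_eq1 x : o + r * (s + 1) <= x -> x <= o + r * t -> window o r s t x = 1.
Proof.
move=> h1 h2; rewrite /window step1 ?step0 ?subr0//.
  by rewrite subr_le0 ler_pdivrMr// lerBlDl mulrC.
by rewrite lerBrDl ler_pdivlMr// lerBrDl mulrC.
Qed.

Lemma window_eq0 x : ~~ (o + r * s < x < o + r * (t + 1)) -> window o r s t x = 0.
Proof.
rewrite negb_and -!leNgt => /orP[h|h]; rewrite /window.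
  have h1 : (x - o) / r - s <= 0 by rewrite subr_le0 ler_pdivrMr// lerBlDl mulrC.
  by rewrite !step0 ?subrr//; apply: le_trans h1; rewrite lerD2l lerN2.
have h1 : 1 <= (x - o) / r - t.
  by rewrite lerBrDl ler_pdivlMr// lerBrDl mulrC.
by rewrite !step1 ?subrr//; apply: (le_trans h1); rewrite lerD2l lerN2.
Qed.

End window_props.

(** The constant [M] is the same at all scales and positions: rescaling by [r]
    only divides the derivative by [r]. *)
Lemma window_cutoff : exists2 M : R, 0 < M & forall o r s t, 0 < r -> s <= t ->
  exists a', cutoff (o + r * s) (o + r * (t + 1)) (M / r) (window o r s t) a'.
Proof.
have [S [M [dS cS M0 SM]]] := dstep_ex.
exists (2 * M); first by rewrite mulr_gt0.
move=> o r s t r0 st.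
pose D s x := r^-1 * S (r^-1 * x + (- (o / r) - s)).
exists (fun x => D s x - D t x); split.
- by rewrite ltrD2l ltr_pM2l//; lra.
- move=> x; have -> : window o r s t = fun x => step (r^-1 * x + (- (o / r) - s)) -
      step (r^-1 * x + (- (o / r) - t)).
    by apply/funext => y; rewrite /window !window_aff.
  have H q : is_derive x 1 (fun x => step (r^-1 * x + (- (o / r) - q))) (D q x).
    exact: (@is_derive_affine step S).
  exact: is_deriveB.
- have cD q : continuous (D q).
    move=> x; apply: cvgM; first exact: cvg_cst.
    apply: (@continuous_comp _ _ _ (fun x => r^-1 * x + (- (o / r) - q)) S).
      apply: cvgD; last exact: cvg_cst.
      by apply: cvgM; [exact: cvg_cst|exact: cvg_id].
    exact: cS.
  by move=> x; apply: cvgB; exact: cD.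
- by move=> x; exact: window_eq0.
- by move=> x; rewrite ger0_norm ?window_ge0// window_le1.
- move=> x; apply: (le_trans (ler_normB _ _)); rewrite /D !normrM.
  have i0 : 0 < r^-1 by rewrite invr_gt0.
  rewrite (gtr0_norm i0) -mulrDr mulrC ler_wpM2r ?(ltW i0)// mulr_natl mulr2n.
  by apply: lerD.
Qed.

End smooth_step.

(** * Absolutely convergent representation of Cauchy transforms *)

Section representation.
Variable R : realType.
Implicit Types (z w l c : R * R).
Variable eta : {finite_measure set (mplane R) -> \bar R}.

Lemma cvg_Re T (F : set_system T) {FF : Filter F} (f : T -> R[i]^o) (y : R[i]^o) :
  f @ F --> y -> (fun t => complex.Re (f t)) @ F --> complex.Re y.
Proof.
move=> /cvg_normc h; apply/cvgrPdist_le => e /h; apply: filterS => t; apply: le_trans.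
by rewrite -ReN -ReD Re_le_normc.
Qed.

Lemma cvg_Im T (F : set_system T) {FF : Filter F} (f : T -> R[i]^o) (y : R[i]^o) :
  f @ F --> y -> (fun t => complex.Im (f t)) @ F --> complex.Im y.
Proof.
move=> /cvg_normc h; apply/cvgrPdist_le => e /h; apply: filterS => t; apply: le_trans.
by rewrite -ImN -ImD Im_le_normc.
Qed.

Lemma cvg_inv_right : (n.+1%:R^-1 : R) @[n --> \oo] --> (0 : R)^'+.
Proof.
move=> A hA; have H : \forall n \near \oo, 0 < (n.+1%:R^-1 : R) -> A n.+1%:R^-1 := @cvg_harmonic R _ hA.
by apply: filterS H => n; apply; rewrite invr_gt0.
Qed.

(** Dominated convergence: the truncated domains exhaust the complement of [z],
    where the integrand vanishes anyway. *)
Lemma trunc_cvg z (u : mplane R -> R) (N : mplane R -> R) :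
  measurable_fun setT u -> {ae eta, forall w, `|u w| <= N w} -> u z = 0 -> L1 eta N ->
  \int[eta]_(w in [set w | n.+1%:R^-1 < normc (toC w - toC z)]) u w @[n --> \oo] -->
  \int[eta]_w u w.
Proof.
move=> m_u uN uz iN.
pose S n : set (mplane R) := [set w | n.+1%:R^-1 < normc (toC w - toC z)].
have mS n : measurable (S n).
  have mn : measurable_fun setT (fun w : mplane R => normc (toC w - toC z)).
    by apply: measurable_normc; apply: cmeasB; [exact: cmeas_toC|exact: cmeas_cst].
  have := mn measurableT `]n.+1%:R^-1, +oo[%classic (measurable_itv _).
  by rewrite setTI; congr (measurable _); apply/seteqP; split => w /=; rewrite in_itv /= andbT.
have muS n : measurable_fun setT (u \_ (S n)).
  by apply/(measurable_restrictT _ (mS n)); exact: measurable_funTS.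
have key : forall w n, `|(u \_ (S n)) w| <= `|u w|.
  by move=> w n; rewrite patchE; case: ifP => // _; rewrite normr0.
have uu : measurable_fun setT (EFin \o u) by exact/measurable_EFinP.
have Scvg w : \forall n \near \oo, (u \_ (S n)) w = u w.
  have [->|wz] := eqVneq w z.
    by near=> n; rewrite patchE uz; case: ifP.
  have r0 : 0 < normc (toC w - toC z) by rewrite normc_gt0 toC_eq0.
  have H : \forall n \near \oo, `|n.+1%:R^-1 : R| < normc (toC w - toC z).
    have := (@cvgr0Pnorm_lt _ _ _ _ _ (fun n => n.+1%:R^-1 : R)).1 (@cvg_harmonic R) _ r0.
    exact.
  apply: filterS H => n /(le_lt_trans (ler_norm _)) h.
  by rewrite patchE mem_set.
have [||i1 _ h] := @dominated_convergence _ _ R eta setT measurableT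
  (fun n w => ((u \_ (S n)) w)%:E) (EFin \o u) (EFin \o N)
  (fun n => iffRL (measurable_EFinP _ _) (muS n)) uu _ iN _.
- apply: (@aeS _ _ _ _ (fun=> True)); last by exists set0; split => // w /= [].
  by move=> w _ _; apply: cvg_near_cst; apply: filterS (Scvg w) => n /= ->.
- apply: aeS uN => w h n _; rewrite /= lee_fin.
  exact: le_trans (key w n) h.
move: h; rewrite (L1_finite i1) => /fine_cvgP[_].
apply: cvg_trans; apply: near_eq_cvg; near=> n.
by rewrite /= Rintegral_mkcond.
Unshelve. all: by end_near. Qed.

(** Where the potential of [eta] converges, the principal value is an absolutely
    convergent integral. *)
Lemma cauchy_rep f h : complex_measurable f ->
  {ae eta, forall w, normc (f w) <= 1} -> continuous_cauchy_transform eta f h ->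
  {ae area, forall z, cL1 eta (fun w => ker w z) -> h z = cint eta (fun w => f w * ker w z)}.
Proof.
move=> mf f1 [ch hz]; apply: aeS hz => z hz iK.
have mk : cmeas (fun w : mplane R => f w * ker w z) by apply: cmeasM => //; exact: cmeas_kerl.
have fk : {ae eta, forall w, normc (f w * ker w z) <= normc (ker w z)}.
  by apply: aeS f1 => w; rewrite normcM => ?; rewrite ler_piMl// normc_ge0.
have fR : {ae eta, forall w, `|complex.Re (f w * ker w z)| <= normc (ker w z)}.
  by apply: aeS fk => w; apply: le_trans; exact: Re_le_normc.
have fI : {ae eta, forall w, `|complex.Im (f w * ker w z)| <= normc (ker w z)}.
  by apply: aeS fk => w; apply: le_trans; exact: Im_le_normc.
have iN := cL1_normc iK.
have kz : f z * ker z z = 0 by rewrite kerxx mulr0.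
have hn : (cauchy_trunc eta f z n.+1%:R^-1 : R[i]^o) @[n --> \oo] --> h z.
  exact: (cvg_comp _ _ cvg_inv_right hz).
have -> : h z = Complex (complex.Re (h z)) (complex.Im (h z)) by case: (h z).
congr Complex.
  have c1 := @trunc_cvg z (fun w => complex.Re (f w * ker w z)) (fun w => normc (ker w z))
    mk.1 fR (f_equal (@complex.Re R) kz) iN.
  have c2 : complex.Re (cauchy_trunc eta f z n.+1%:R^-1) @[n --> \oo] --> complex.Re (h z).
    exact: cvg_Re hn.
  apply: (@cvg_unique R (@Rhausdorff R) _ _ _ _ c2).
  apply: cvg_trans c1; apply: near_eq_cvg; apply: nearW => n.
  by rewrite /cauchy_trunc /cintegral /=; apply: eq_Rintegral => w _; rewrite mulrC.
have c1 := @trunc_cvg z (fun w => complex.Im (f w * ker w z)) (fun w => normc (ker w z))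
  mk.2 fI (f_equal (@complex.Im R) kz) iN.
have c2 : complex.Im (cauchy_trunc eta f z n.+1%:R^-1) @[n --> \oo] --> complex.Im (h z).
  exact: cvg_Im hn.
apply: (@cvg_unique R (@Rhausdorff R) _ _ _ _ c2).
apply: cvg_trans c1; apply: near_eq_cvg; apply: nearW => n.
by rewrite /cauchy_trunc /cintegral /=; apply: eq_Rintegral => w _; rewrite mulrC.
Qed.

Lemma Linfty_ae f : (Linfty_norm eta f <= 1)%E -> {ae eta, forall w, normc (f w) <= 1}.
Proof.
rewrite /Linfty_norm unlock /Lnorm.
case: ifPn => [_ /ess_supP|]; last first.
  rewrite -leNgt => h _; exists setT; split => //.
  by apply/eqP; rewrite eq_le h measure_ge0.
by apply: aeS => w /=; rewrite lee_fin ger0_norm// normc_ge0.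
Qed.

Lemma negligible_bigcup_rat (F : rat -> set (mplane R)) :
  (forall q, eta.-negligible (F q)) -> eta.-negligible (\bigcup_q F q).
Proof.
move=> hF.
have : eta.-negligible (\bigcup_n (if unpickle n is Some q then F q else set0)).
  apply: negligible_bigcup => n; case: unpickle => [q|]; [exact: hF|exact: negligible_set0].
apply: negligibleS => z [q _ Fz].
move: (pickle q) (pickleK q) => n E; exists n; first exact: I.
by rewrite E.
Qed.

(** The complement of the support is covered by countably many null squares. *)
Lemma support_box : compact (measure_support eta) ->
  exists2 r : R, 0 < r & {ae eta, forall w, box (0, 0) r w}.
Proof.
move=> /compact_in_box[r r0 hr]; exists r => //.
suff : eta.-negligible (~` (measure_support eta : set (mplane R))).
  by apply: negligibleS => w /= wr /hr.
apply: negligibleS.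
  apply: (@open_box_cover R (fun A => eta.-negligible A)).
    move=> z /= /existsNP[U /not_implyP[oU /not_implyP[Uz /negP]]].
    rewrite -leNgt => U0.
    have /nbhs_box[s s0 sU] := open_nbhs_nbhs (conj oU Uz); exists s => //.
    exists U; split => //; first exact: open_measurable_plane.
    by apply/eqP; rewrite eq_le U0 measure_ge0.
  by move=> A B AB; exact: negligibleS.
apply: negligible_bigcup_rat => q1; apply: negligible_bigcup_rat => q2.
apply: negligible_bigcup => n.
have [h|h] := pselect (eta.-negligible (box (ratr q1, ratr q2) n.+1%:R^-1)).
  by apply: negligibleS h => z [].
by apply: negligibleS (negligible_set0 eta) => z [].
Qed.

End representation.

(** * Mass estimate and localization *)

(** The resolvent identity of the Cauchy kernel. *)
Lemma ker_resolvent (R : realType) (w z l : R * R) : w != z -> w != l -> z != l ->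
  ker w l * ker w z = (ker w z - ker w l) * ker z l.
Proof.
move=> wz wl zl; rewrite /ker.
have := toC_eq0 w z; have := toC_eq0 w l; have := toC_eq0 z l.
have -> : toC z - toC l = (toC w - toC l) - (toC w - toC z) by ring.
move: (toC w - toC z) (toC w - toC l) => A B.
rewrite (negbTE wz) (negbTE wl) (negbTE zl) => /negbT BA /negbT B0 /negbT A0.
by field; rewrite A0 B0 BA.
Qed.

Lemma set1_plane (R : realType) (z : R * R) :
  [set z] = ([set z.1] : set (measurableTypeR R)) `*` [set z.2].
Proof. by apply/seteqP; split => [w /= ->//|[w1 w2] /= [-> ->]]; case: z. Qed.

Lemma measurable_set1_plane (R : realType) (z : R * R) : measurable ([set z] : set (mplane R)).
Proof. by rewrite set1_plane; apply: measurableX; exact: measurable_set1. Qed.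

Lemma area_set1 (R : realType) (z : R * R) : area [set z] = 0%E.
Proof.
rewrite set1_plane.
transitivity ((@lebesgue_measure R [set z.1]) * (@lebesgue_measure R [set z.2]))%E.
  by apply: product_measure1E; exact: measurable_set1.
by rewrite !lebesgue_measure_set1 mul0e.
Qed.

Section estimates.
Variable R : realType.
Implicit Types (z w l c : R * R).
Variable eta : {finite_measure set (mplane R) -> \bar R}.

(** The form in which the hypothesis that [h] is the Cauchy transform of [f eta]
    is used. *)
Definition represents (f : R * R -> R[i]) (h : R * R -> R[i]) :=
  {ae area, forall z, cL1 eta (fun w => ker w z) -> h z = cint eta (fun w => f w * ker w z)}.

Lemma eta_cL1_bdd (f : mplane R -> R[i]) (k : mplane R -> R) : cmeas f ->
  (forall w, normc (f w) <= k w) -> L1 eta k -> cL1 eta f.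
Proof. by move=> mf fk ik; exact: cL1_le mf fk ik. Qed.

Lemma eta_L1_cst (D : R) : L1 eta (fun=> D).
Proof. by apply: finite_measure_integrable_cst. Qed.

Lemma L1_indic_box c s : L1 eta (\1_(box c s)).
Proof.
apply: L1_le (eta_L1_cst 1); first exact: measurable_indic_box.
by move=> w; rewrite indicE ger0_norm//; case: (_ \in _).
Qed.

Section local.
Variables (c : R * R) (r M : R) (a a' b b' : R -> R).
Hypothesis (Ca : cutoff (c.1 - r) (c.1 + r) M a a').
Hypothesis (Cb : cutoff (c.2 - r) (c.2 + r) M b b').

Let r0 : 0 < r := cutoff_r_gt0 Ca.

Lemma dbart_L1 : cL1 area (dbart a a' b b').
Proof. exact: cL1_le (cmeas_dbart Ca Cb) (normc_dbart Ca Cb) (L1_box _ _ (ltW r0)). Qed.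

Lemma cutoff_int0 p q m (e e' : R -> R) : cutoff p q m e e' ->
  \int[@lebesgue_measure R]_x e' x = 0.
Proof.
move=> Ce; have := @cutoff_ibp R p q m e e' (cst 1) (cst 0) Ce
  (fun x => is_derive_cst (1 : R) x 1) (@cst_continuous R R 0).
under eq_Rintegral do rewrite /= mulr0.
under [X in _ = - X -> _]eq_Rintegral do rewrite /= mulr1.
rewrite Rintegral_eq0// => /eqP; rewrite eq_sym oppr_eq0 => /eqP //.
Qed.

(** Allows a constant to be subtracted from the function that is paired with
    [dbart]. *)
Lemma cint_dbart0 : cint area (dbart a a' b b') = 0.
Proof.
have [i1 i2] := dbart_L1.
rewrite /cint; congr Complex.
  rewrite (area_Rfubini2 i1); apply: Rintegral_eq0 => y /=.
  under eq_Rintegral do rewrite -mulrA mulrC.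
  rewrite RintegralZl ?(cutoff_int0 Ca) ?mulr0//.
  have := supported_bdd_L1 (cutoff_dbdd Ca) (cutoff_cont Ca) (@cst_continuous R R 1).
  by apply: eq_integrable => // x _ /=; rewrite mulr1.
rewrite (area_Rfubini1 i2); apply: Rintegral_eq0 => x /=.
under eq_Rintegral do rewrite mulrAC.
rewrite RintegralZl ?(cutoff_int0 Cb) ?mulr0//.
have := supported_bdd_L1 (cutoff_dbdd Cb) (cutoff_cont Cb) (@cst_continuous R R 1).
by apply: eq_integrable => // y _ /=; rewrite mulr1.
Qed.

(** Pairing [g] with the d-bar derivative of a bump gives [pi] times the integral
    of the bump; subtracting the value of [g] at the centre makes the
    oscillation of [g] appear. *)
Lemma mass_estimate (g : R * R -> R[i]^o) (om : R) :
  continuous g -> represents (cst 1) g -> 0 <= om ->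
  (forall z, dist z c <= r -> normc (g z - g c) <= om) ->
  pi * \int[eta]_w (a w.1 * b w.2) <= 2 * (om * M * (2 * r) ^+ 2).
Proof.
move=> cg rg om0 gom.
have mg := ccontinuous_cmeas cg.
have mdb := cmeas_dbart Ca Cb.
have M0 : 0 <= M by apply: le_trans (cutoff_dle Ca 0).
have i1 : cL1 eta (fun=> 1).
  apply: (eta_cL1_bdd (k := fun=> 1)); [exact: cmeas_cst|by move=> w; rewrite normc1|exact: eta_L1_cst].
have E := @cauchy_fubini R eta c r M a a' b b' Ca Cb (fun=> 1) g i1 mg.
have {}E : cint area (fun z => g z * dbart a a' b b' z) =
    cint eta (fun w => (pi * (a w.1 * b w.2))%:C%C).
  rewrite E; first by apply: eq_cint => w; rewrite mul1r.
  apply: aeS (aeI rg (potential_ae eta)) => z [rz iz]; split.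
    by under eq_fun do rewrite mul1r.
  exact: rz.
have dom z : normc ((g z - g c) * dbart a a' b b' z) <= om * M * \1_(box c r) z.
  rewrite normcM -mulrA; have := normc_dbart Ca Cb z; rewrite indicE.
  have [/set_mem zb|_] := boolP (z \in _).
    by rewrite mulr1 => ?; rewrite ler_pM ?normc_ge0// gom.
  by rewrite !mulr0 => h; have -> : normc (dbart a a' b b' z) = 0;
    [apply/eqP; rewrite eq_le h normc_ge0|rewrite mulr0].
have mG : cmeas (fun z : mplane R => (g z - g c) * dbart a a' b b' z).
  by apply: cmeasM => //; apply: cmeasB => //; exact: cmeas_cst.
have iG := cL1_le mG dom (L1_box c _ (ltW r0)).
have E2 : cint area (fun z => (g z - g c) * dbart a a' b b' z) =
    cint eta (fun w => (pi * (a w.1 * b w.2))%:C%C).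
  have := cintD iG (cL1Z (g c) dbart_L1).
  rewrite cintZ ?cint_dbart0 ?mulr0 ?addr0; last exact: dbart_L1.
  by move=> <-; rewrite -E; apply: eq_cint => z; ring.
have := le_cint mG dom (L1_box c _ (ltW r0)).
rewrite E2 (Rintegral_indic_box _ _ (ltW r0)); apply: le_trans.
apply: le_trans (Re_le_normc _); rewrite /cint /=.
rewrite RintegralZl//; last first.
  apply: L1_le (eta_L1_cst 1); first exact: (measurable_tens (cutoff_bdd Ca) (cutoff_bdd Cb)).
  by move=> w; rewrite normrM mulr_ile1 ?(cutoff_le Ca) ?(cutoff_le Cb).
exact: ler_norm.
Qed.

Hypothesis noatom : forall z, eta [set z] = 0%E.
Variables (f : R * R -> R[i]) (h : R * R -> R[i]^o) (l : R * R).
Hypotheses (mf : complex_measurable f) (f1 : forall w, normc (f w) <= 1).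
Hypotheses (ch : continuous h) (rh : represents f h).
Hypotheses (il : cL1 eta (fun w => ker w l)).
Hypotheses (hl : h l = cint eta (fun w => f w * ker w l)).

Let mk z : cmeas (fun w : mplane R => f w * ker w z).
Proof. by apply: cmeasM => //; exact: cmeas_kerl. Qed.

Let ik z : cL1 eta (fun w => ker w z) -> cL1 eta (fun w => f w * ker w z).
Proof.
move=> iz; apply: (eta_cL1_bdd (mk z) _ (cL1_normc iz)) => w.
by rewrite normcM ler_piMl ?normc_ge0.
Qed.

(** By the resolvent identity [(h z - h l) / (z - l)] is, for almost every [z],
    the Cauchy transform at [z] of the density [f w / (w - l)]; pairing it with
    [dbart] is then an instance of [cauchy_fubini].  Atoms are excluded since
    the identity fails for [w = l]. *)
Lemma localization :
  cint area (fun z => (h z - h l) * ker z l * dbart a a' b b' z) =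
  cint eta (fun w => f w * ker w l * (pi * (a w.1 * b w.2))%:C%C).
Proof.
have mh := ccontinuous_cmeas ch.
apply: (@cauchy_fubini R eta c r M a a' b b' Ca Cb _ (fun z => (h z - h l) * ker z l)).
- exact: ik.
- by apply: cmeasM; [apply: cmeasB => //; exact: cmeas_cst|exact: cmeas_kerl].
have zl : {ae area, forall z, z <> l}.
  by exists [set l]; split; [exact: measurable_set1_plane|exact: area_set1|move=> z /= /contrapT].
apply: aeS (aeI (aeI rh (potential_ae eta)) zl) => z [[rz iz] /eqP {}zl].
have mkk : cmeas (fun w : mplane R => f w * ker w l * ker w z).
  by apply: cmeasM => //; exact: cmeas_kerl.
split.
  apply: (eta_cL1_bdd (k := fun w => normc (ker z l) * (normc (ker w z) + normc (ker w l)))) => //.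
    move=> w; rewrite -mulrA normcM; apply: (@le_trans _ _ (normc (ker w l * ker w z))).
      by rewrite ler_piMl ?normc_ge0.
    have [->|wz] := eqVneq w z.
      by rewrite kerxx mulr0 normc0 mulr_ge0 ?addr_ge0 ?normc_ge0.
    have [->|wl] := eqVneq w l.
      by rewrite kerxx mul0r normc0 mulr_ge0 ?addr_ge0 ?normc_ge0.
    rewrite ker_resolvent// normcM mulrC ler_wpM2l ?normc_ge0//.
    by apply: (le_trans (ler_normcD _ _)); rewrite normc_opp.
  by apply: L1Z; apply: L1D; exact: cL1_normc.
rewrite hl (rz iz) -cintB; [|exact: ik|exact: ik].
rewrite -cintZr; last by apply: cL1B; exact: ik.
apply: cint_ae => //.
  apply: cmeasM; last exact: cmeas_cst.
  by apply: cmeasB; exact: mk.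
(* the two densities agree except at [w = z] and [w = l] *)
exists ([set z] `|` [set l]); split.
- by apply: measurableU; exact: measurable_set1_plane.
- transitivity (eta [set z]); last exact: noatom.
  apply: measureU0; last exact: noatom; exact: measurable_set1_plane.
move=> w /= hw; apply: contrapT => /not_orP[wz wl]; apply: hw.
by rewrite -mulrA ker_resolvent//; [ring|exact/eqP|exact/eqP].
Qed.

Let dom (om : R) : 0 <= om ->
  (forall z, dist z c <= r -> normc (h z - h l) <= om) ->
  forall z, normc ((h z - h l) * ker z l * dbart a a' b b' z) <=
    om * M * (\1_(box c r) z * normc (ker z l)).
Proof.
move=> om0 hom z; have M0 : 0 <= M by apply: le_trans (cutoff_dle Ca 0).
rewrite !normcM; have := normc_dbart Ca Cb z; rewrite indicE.
have [/set_mem zb|_] := boolP (z \in _).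
  rewrite mulr1 mul1r => ?; rewrite [leRHS]mulrAC ler_pM ?mulr_ge0 ?normc_ge0//.
  by rewrite ler_wpM2r ?normc_ge0// hom.
by rewrite !(mulr0, mul0r) => hh; have -> : normc (dbart a a' b b' z) = 0;
  [apply/eqP; rewrite eq_le hh normc_ge0|rewrite mulr0].
Qed.

Let mG : cmeas (fun z : mplane R => (h z - h l) * ker z l * dbart a a' b b' z).
Proof.
have mh := ccontinuous_cmeas ch.
apply: cmeasM; last exact: cmeas_dbart Ca Cb.
by apply: cmeasM; [apply: cmeasB => //; exact: cmeas_cst|exact: cmeas_kerl].
Qed.

Lemma localization_L1 : cL1 area (fun z => (h z - h l) * ker z l * dbart a a' b b' z).
Proof.
have [B B0 hB] := ccontinuous_bounded (r + dist c (0, 0)) ch.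
have om0 : 0 <= B + normc (h l) by rewrite addr_ge0 ?normc_ge0// ltW.
have hom z : dist z c <= r -> normc (h z - h l) <= B + normc (h l).
  move=> zc; apply: (le_trans (ler_normcD _ _)); rewrite normc_opp lerD2r hB//.
  by apply: (le_trans (dist_tri c z _)); rewrite lerD2r.
have [ib _] := box_kernel l c r0.
exact: cL1_le mG (dom om0 hom) (L1Z _ ib).
Qed.

(** Vitushkin's bound: with [M] of order [1 / r] the right-hand side is of order
    [om], whatever the scale [r]. *)
Lemma near_estimate (om : R) : 0 <= om ->
  (forall z, dist z c <= r -> normc (h z - h l) <= om) ->
  normc (cint area (fun z => (h z - h l) * ker z l * dbart a a' b b' z)) <=
  2 * (om * M * (20 * r)).
Proof.
move=> om0 hom.
have M0 : 0 <= M by apply: le_trans (cutoff_dle Ca 0).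
have [ib bb] := box_kernel l c r0.
apply: (le_trans (le_cint mG (dom om0 hom) (L1Z _ ib))).
by rewrite ler_pM2l// RintegralZl// ler_wpM2l// mulr_ge0.
Qed.

End local.
End estimates.

(** * Linear growth of the measure *)

Section growth.
Variable R : realType.
Implicit Types (z w l c : R * R).
Variable eta : {finite_measure set (mplane R) -> \bar R}.
Variable g : R * R -> R[i]^o.
Hypotheses (cg : continuous g) (rg : represents eta (cst 1) g).

(** The bump equal to 1 on the square of radius [s] and supported in the one of
    radius [2 s] has derivatives of order [1 / s]. *)
Lemma growth : exists2 G : R, 0 < G & forall c (s om : R), 0 < s -> 0 <= om ->
  (forall z, dist z c <= 2 * s -> normc (g z - g c) <= om) ->
  \int[eta]_w \1_(box c s) w <= G * om * s.
Proof.
have [M M0 HM] := window_cutoff R.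
have pi0 := pi_gt0 R.
(* [2 * (om * (M / s) * (4 * s) ^+ 2) = 32 * M * om * s], divided by [pi] *)
exists (32 * M / pi); first by rewrite divr_gt0// mulr_gt0.
move=> c s om s0 om0 gom.
have H (o : R) : exists a', cutoff (o - 2 * s) (o + 2 * s) (M / s) (window o s (- 2) 1) a'.
  have h21 : -2 <= 1 :> R by lra.
  have [a' Ca] := HM o s (- 2) 1 s0 h21; exists a'.
  have -> : o - 2 * s = o + s * (- 2) by ring.
  by have -> : o + 2 * s = o + s * (1 + 1) by ring.
have [a' Ca] := H c.1; have [b' Cb] := H c.2.
have := mass_estimate Ca Cb cg rg om0 gom.
have -> : 2 * (om * (M / s) * (2 * (2 * s)) ^+ 2) = 32 * M * om * s.
  by field; rewrite gt_eqF.
rewrite -ler_pdivlMl// => h.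
have {}h : \int[eta]_w (window c.1 s (- 2) 1 w.1 * window c.2 s (- 2) 1 w.2) <=
    32 * M / pi * om * s.
  by have <- : pi^-1 * (32 * M * om * s) = 32 * M / pi * om * s by ring.
apply: le_trans h.
have w0 o x : 0 <= window o s (- 2) 1 x by apply: window_ge0; lra.
apply: le_Rintegral => //.
- exact: L1_indic_box.
- apply: L1_le (eta_L1_cst eta 1).
    exact: measurable_tens (cutoff_bdd Ca) (cutoff_bdd Cb).
  by move=> w; rewrite normrM mulr_ile1 ?(cutoff_le Ca) ?(cutoff_le Cb).
move=> w _; rewrite indicE; have [/set_mem|_] := boolP (w \in _); last exact: mulr_ge0.
rewrite box_prod /= !in_itv /= => -[/andP[h1 h2] /andP[h3 h4]].
by rewrite !window_eq1 ?mulr1//; lra.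
Qed.

(** The masses of the squares around [z] shrink linearly with their sides. *)
Lemma noatom z : eta [set z] = 0%E.
Proof.
have [G G0 HG] := growth.
have [d d0 dg] := (ccontinuousP g z).1 (@cg z) 1 ltr01.
have fin : eta [set z] \is a fin_num by apply: fin_num_measure; exact: measurable_set1_plane.
rewrite -(fineK fin); congr EFin; apply/eqP; rewrite eq_le fine_ge0// andbT.
have key s : 0 < s -> 2 * s <= d -> fine (eta [set z]) <= G * s.
  move=> s0 sd; have := HG z s 1 s0 ler01; rewrite mulr1 => h.
  apply: le_trans (h _); last by move=> w wz; apply: dg; exact: le_trans wz sd.
  rewrite -lee_fin fineK// -(L1_finite (L1_indic_box eta z s)).
  rewrite integral_indic ?setIT//; last exact: measurable_box.
  apply: le_measure; rewrite ?inE; [exact: measurable_set1_plane|exact: measurable_box|].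
  by move=> w ->; rewrite /box /= distxx ltW.
rewrite leNgt; apply/negP; set m := fine _ => m0.
have s0 : 0 < Num.min (d / 2) (m / (2 * G)).
  by rewrite lt_min !divr_gt0// mulr_gt0.
have s1 : 2 * Num.min (d / 2) (m / (2 * G)) <= d.
  by rewrite mulrC -ler_pdivlMr// ge_min lexx.
have := key _ s0 s1; rewrite -/m.
have : G * Num.min (d / 2) (m / (2 * G)) <= m / 2.
  apply: (@le_trans _ _ (G * (m / (2 * G)))).
    by rewrite ler_pM2l// ge_min lexx orbT.
  by rewrite le_eqVlt; apply/orP; left; apply/eqP; field; rewrite gt_eqF.
by move=> h1 h2; have := le_trans h2 h1; lra.
Qed.

(** The decay of the contribution of a cell of size [d] with vanishing mass, cut
    off near [l]. *)
Definition kappa l (d : R) w : R := if d < dist w l then d / dist w l ^+ 2 else 0.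

Lemma measurable_dist l : measurable_fun [set: mplane R] (fun w => dist w l).
Proof.
apply: measurable_maxr; apply: measurableT_comp => //.
  exact: measurable_coord1.
exact: measurable_coord2.
Qed.

Lemma kappa_ge0 l d w : 0 < d -> 0 <= kappa l d w.
Proof. by move=> d0; rewrite /kappa; case: ifP => // _; rewrite divr_ge0 ?(ltW d0)// exprn_ge0// dist_ge0. Qed.

Lemma kappa_le l d w : 0 < d -> kappa l d w <= d^-1.
Proof.
move=> d0; rewrite /kappa; case: ifP => [h|_]; last by rewrite invr_ge0 ltW.
have D0 := lt_trans d0 h.
rewrite ler_pdivrMr ?exprn_gt0// mulrC ler_pdivlMr// -expr2.
by rewrite lerXn2r ?nnegrE ?(ltW d0) ?(ltW D0)// ltW.
Qed.

Lemma L1_kappa l d : 0 < d -> L1 eta (kappa l d).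
Proof.
move=> d0; apply: L1_le (eta_L1_cst eta d^-1).
  apply: measurable_fun_ifT.
  - by apply: measurable_fun_ltr; [exact: measurable_cst|exact: measurable_dist].
  - by apply: measurable_div; [exact: measurable_cst|apply: measurable_funX; exact: measurable_dist].
  - exact: measurable_cst.
by move=> w; rewrite ger0_norm ?kappa_ge0// kappa_le.
Qed.

(** The shell [2^k d < dist w l <= 2^(k+1) d] has mass at most
    [2^(k+1) G om d] and carries the value [(4^k d)^-1], so the shells up to
    [rho] sum to a geometric series; beyond [rho] the integrand is at most
    [d / rho ^+ 2]. *)
Lemma far_estimate (G om : R) l (d rho : R) : 0 <= G -> 0 <= om -> 0 < d -> d <= rho ->
  (forall s, 0 < s -> s <= 2 * rho -> \int[eta]_w \1_(box l s) w <= G * om * s) ->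
  \int[eta]_w kappa l d w <= 4 * (G * om) + d / rho ^+ 2 * \int[eta]_w 1.
Proof.
move=> G0 om0 d0 drho gr.
have rho0 := lt_le_trans d0 drho.
have [N [N1 N2]] := dyadic d0 drho.
pose F k w : R := (4 ^+ k * d)^-1 * \1_(box l (2 ^+ k.+1 * d)) w.
have E4 k : 4 ^+ k = 2 ^+ k * 2 ^+ k :> R by rewrite -exprMn; congr (_ ^+ _); ring.
have p2 k : 0 < 2 ^+ k :> R by rewrite exprn_gt0.
have p4 k : 0 < 4 ^+ k :> R by rewrite exprn_gt0.
have F0 k w : 0 <= F k w by rewrite mulr_ge0// invr_ge0 mulr_ge0// ltW.
have iF k : L1 eta (F k) by apply: L1Z; exact: L1_indic_box.
have iS n : L1 eta (fun w => \sum_(0 <= k < n) F k w).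
  elim: n => [|n ih].
    by under eq_fun do rewrite big_geq//; exact: eta_L1_cst.
  by under eq_fun do rewrite big_nat_recr//=; exact: L1D.
have dom w : kappa l d w <= \sum_(0 <= k < N.+1) F k w + d / rho ^+ 2.
  have S0 n : 0 <= \sum_(0 <= k < n) F k w by rewrite sumr_ge0.
  have dr0 : 0 <= d / rho ^+ 2 by rewrite divr_ge0 ?(ltW d0)// exprn_ge0// ltW.
  rewrite /kappa; case: ifP => [h|_]; last by rewrite addr_ge0.
  have D0 := lt_trans d0 h.
  have [hr|hr] := leP (dist w l) rho; last first.
    apply: (@le_trans _ _ (d / rho ^+ 2)); last by rewrite lerDr.
    rewrite ler_pM2l// lef_pV2 ?posrE ?exprn_gt0//.
    by rewrite lerXn2r ?nnegrE ?(ltW rho0) ?(ltW D0)// ltW.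
  apply: ler_wpDr => //.
  have [k [k1 k2]] := dyadic d0 (ltW h).
  have kN : (k < N.+1)%N.
    rewrite ltnNge; apply/negP => Nk.
    have : 2 ^+ N.+1 <= 2 ^+ k :> R by rewrite ler_eXn2l// ltr1n.
    rewrite ltr_pdivrMr// in N2; rewrite ler_pdivlMr// in k1.
    move=> h1; have := lt_le_trans N2 (le_trans _ k1); rewrite ltNge hr => H.
    by have := H (ler_wpM2l (ltW d0) h1).
  rewrite (@big_cat_nat _ _ _ k.+1)//= big_nat_recr//= addrAC; apply: ler_wpDl.
    by rewrite addr_ge0// sumr_ge0.
  rewrite /F indicE mem_set; last first.
    by rewrite /box /=; rewrite ltr_pdivrMr// mulrC in k2; exact: ltW.
  rewrite mulr1 ler_pdivrMr ?exprn_gt0// mulrC ler_pdivlMr ?mulr_gt0//.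
  rewrite ler_pdivlMr// in k1.
  have -> : d * (4 ^+ k * d) = (d * 2 ^+ k) ^+ 2 by rewrite E4; ring.
  by rewrite lerXn2r ?nnegrE ?mulr_ge0 ?(ltW d0) ?(ltW D0)// ltW.
apply: (@le_trans _ _ (\int[eta]_w (\sum_(0 <= k < N.+1) F k w + d / rho ^+ 2))).
  apply: le_Rintegral => //; first exact: L1_kappa.
  by apply: L1D; [exact: iS|exact: eta_L1_cst].
rewrite RintegralD//; [|exact: iS|exact: eta_L1_cst].
apply: lerD; last first.
  rewrite -RintegralZl//; last exact: eta_L1_cst.
  by under [leRHS]eq_Rintegral do rewrite mulr1.
(* partial sums of [2 * (G * om) * (1 / 2) ^ k] *)
have bd n : (n <= N.+1)%N -> \int[eta]_w (\sum_(0 <= k < n) F k w) <=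
    4 * (G * om) * (1 - (2 ^+ n)^-1).
  elim: n => [_|n ih nN].
    rewrite expr0 invr1 subrr mulr0.
    by under eq_Rintegral do rewrite big_geq//; rewrite Rintegral_cst// mul0r.
  under eq_Rintegral do rewrite big_nat_recr//=.
  rewrite RintegralD//; [|exact: iS|exact: iF].
  have sn : 0 < 2 ^+ n.+1 * d by rewrite mulr_gt0.
  have sr : 2 ^+ n.+1 * d <= 2 * rho.
    rewrite exprS -mulrA ler_pM2l//; rewrite ler_pdivlMr// mulrC in N1.
    by apply: le_trans N1; rewrite ler_pM2r// ler_eXn2l// ltr1n.
  apply: (le_trans (lerD (ih (ltnW nN)) (_ : _ <= (4 ^+ n * d)^-1 * (G * om * (2 ^+ n.+1 * d))))).
    rewrite /F RintegralZl//; last exact: L1_indic_box.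
    by rewrite ler_wpM2l// ?gr// invr_ge0 mulr_ge0// ltW.
  have -> : (4 ^+ n * d)^-1 * (G * om * (2 ^+ n.+1 * d)) = 2 * (G * om) * (2 ^+ n)^-1.
    by rewrite E4 exprS; field; rewrite !gt_eqF.
  have -> : (2 ^+ n.+1)^-1 = (2 ^+ n)^-1 / 2 :> R.
    by rewrite exprS; field; rewrite gt_eqF.
  have := mulr_ge0 G0 om0; have : 0 < (2 ^+ n)^-1 :> R by rewrite invr_gt0.
  by move=> ? ?; rewrite le_eqVlt; apply/orP; left; apply/eqP; field.
apply: (le_trans (bd _ (leqnn _))); by rewrite ler_piMr ?mulr_ge0// gerBl invr_ge0 ltW.
Qed.

End growth.

(** * Smooth combinations of product functions *)

Section tensors.
Variable R : realType.
Implicit Types (a b : R -> R) (z w l c : R * R) (u v : R * R -> R).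

Definition tens a b z : R := a z.1 * b z.2.

Lemma is_derive_cvg a (x d : R) : is_derive x 1 a d ->
  h^-1 * (a (h + x) - a x) @[h --> (0 : R)^'] --> d.
Proof.
move=> [da <-]; have : h^-1 *: ((a \o shift x) (h *: 1) - a x) @[h --> (0 : R)^'] --> 'D_1 a x by exact: da.
apply: cvg_trans; apply: near_eq_cvg; apply: nearW => h.
by rewrite /= /GRing.scale /= mulr1.
Qed.

Lemma is_derive_plane u z e (d : R) :
  h^-1 * (u (h * e.1 + z.1, h * e.2 + z.2) - u z) @[h --> (0 : R)^'] --> d ->
  is_derive z e u d.
Proof.
move=> H; have H' : h^-1 *: ((u \o shift z) (h *: e) - u z) @[h --> (0 : R)^'] --> d.
  apply: cvg_trans H; apply: near_eq_cvg; apply: nearW => h.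
  by rewrite /= /GRing.scale /=; case: z e => [? ?] [? ?].
apply: DeriveDef; first by apply/cvg_ex; exists d.
exact: (cvg_lim (@Rhausdorff R) H').
Qed.

Lemma is_derive_tens1 a b (d : R) z : is_derive z.1 1 a d ->
  is_derive z (1, 0) (tens a b) (d * b z.2).
Proof.
move=> da; apply: is_derive_plane.
have H : (h^-1 * (a (h + z.1) - a z.1)) * b z.2 @[h --> (0 : R)^'] --> d * b z.2.
  by apply: cvgM; [exact: is_derive_cvg|exact: cvg_cst].
apply: cvg_trans H; apply: near_eq_cvg; apply: nearW => h.
by rewrite /tens /= mulr1 mulr0 add0r; ring.
Qed.

Lemma is_derive_tens2 a b (d : R) z : is_derive z.2 1 b d ->
  is_derive z (0, 1) (tens a b) (a z.1 * d).
Proof.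
move=> db; apply: is_derive_plane.
have H : a z.1 * (h^-1 * (b (h + z.2) - b z.2)) @[h --> (0 : R)^'] --> a z.1 * d.
  by apply: cvgM; [exact: cvg_cst|exact: is_derive_cvg].
apply: cvg_trans H; apply: near_eq_cvg; apply: nearW => h.
by rewrite /tens /= mulr1 mulr0 add0r; ring.
Qed.

Lemma continuous_tens a b : continuous a -> continuous b -> continuous (tens a b).
Proof.
move=> ca cb z; apply: cvgM.
  by apply: (@continuous_comp _ _ _ fst a); [exact: cvg_fst|exact: ca].
by apply: (@continuous_comp _ _ _ snd b); [exact: cvg_snd|exact: cb].
Qed.

Lemma Cn_tens n a b : C1n n a -> C1n n b -> Cn n (tens a b).
Proof.
elim: n a b => [a b|n IH a b Ca Cb]; first exact: continuous_tens.
have [a' da Ca'] := Ca; have [b' db Cb'] := Cb.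
have ex : dx (tens a b) = tens a' b.
  apply/funext => z; rewrite /dx; have := is_derive_tens1 b (da z.1).
  by move=> H; rewrite derive_val.
have ey : dy (tens a b) = tens a b'.
  apply/funext => z; rewrite /dy; have := is_derive_tens2 a (db z.2).
  by move=> H; rewrite derive_val.
split.
- by apply: continuous_tens; exact: is_derive_continuous.
- move=> z; split; first by case: (is_derive_tens1 b (da z.1)).
  by case: (is_derive_tens2 a (db z.2)).
- by rewrite ex; apply: IH => //; exact: C1n_pred.
- by rewrite ey; apply: IH => //; exact: C1n_pred.
Qed.

Lemma Cn_lin n (k : R) u v : Cn n u -> Cn n v -> Cn n (fun z => k * u z + v z).
Proof.
elim: n u v => [u v cu cv z|n IH u v [cu du Cux Cuy] [cv dv Cvx Cvy]].
  by apply: cvgD; [apply: cvgM; [exact: cvg_cst|exact: cu]|exact: cv].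
have H z e : derivable u z e -> derivable v z e ->
    is_derive z e (fun z => k * u z + v z) (k * 'D_e u z + 'D_e v z).
  move=> /derivableP h1 /derivableP h2.
  exact: (is_deriveD (is_deriveZ k h1) h2).
have ex : dx (fun z => k * u z + v z) = fun z => k * dx u z + dx v z.
  apply/funext => z; have := H z (1, 0) (du z).1 (dv z).1.
  by move=> h; rewrite /dx derive_val.
have ey : dy (fun z => k * u z + v z) = fun z => k * dy u z + dy v z.
  apply/funext => z; have := H z (0, 1) (du z).2 (dv z).2.
  by move=> h; rewrite /dy derive_val.
split.
- by move=> z; apply: cvgD; [apply: cvgM; [exact: cvg_cst|exact: cu]|exact: cv].
- move=> z; split; first by case: (H z (1, 0) (du z).1 (dv z).1).
  by case: (H z (0, 1) (du z).2 (dv z).2).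
- by rewrite ex; exact: IH.
- by rewrite ey; exact: IH.
Qed.

Lemma C1n0 n : C1n n (cst (0 : R)).
Proof.
elim: n => [|n IH]; first exact: cst_continuous.
by exists (cst 0) => // x; exact: is_derive_cst.
Qed.

Lemma Cn_0 n : Cn n (fun _ : R * R => 0 : R).
Proof.
have -> : (fun _ : R * R => 0 : R) = tens (cst 0) (cst 0).
  by apply/funext => z; rewrite /tens mul0r.
by apply: Cn_tens; exact: C1n0.
Qed.

Lemma Cn_sum n (I : Type) (s : seq I) (k : I -> R) (u : I -> R * R -> R) :
  (forall p, Cn n (u p)) -> Cn n (fun z => \sum_(p <- s) k p * u p z).
Proof.
move=> Cu; elim: s => [|p s IH].
  by under eq_fun do rewrite big_nil; exact: Cn_0.
under eq_fun do rewrite big_cons.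
exact: Cn_lin.
Qed.

Lemma is_derive_sum_plane z e (I : Type) (s : seq I) (k d : I -> R) (u : I -> R * R -> R) :
  (forall p, is_derive z e (u p) (d p)) ->
  is_derive z e (fun z => \sum_(p <- s) k p * u p z) (\sum_(p <- s) k p * d p).
Proof.
move=> du; elim: s => [|p s IH].
  rewrite big_nil; under eq_fun do rewrite big_nil.
  exact: (is_derive_cst (0 : R) z e).
rewrite big_cons; under eq_fun do rewrite big_cons.
exact: (is_deriveD (is_deriveZ (k p) (du p)) IH).
Qed.

Section combination.
Variables (I : eqType) (s : seq I) (k : I -> R[i]) (a a' b b' : I -> R -> R).
Hypothesis da : forall p (x : R), is_derive x 1 (a p) (a' p x).
Hypothesis db : forall p (x : R), is_derive x 1 (b p) (b' p x).

(** The approximants: complex combinations of finitely many products. *)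
Definition comb z : R[i] := \sum_(p <- s) k p * (a p z.1 * b p z.2)%:C%C.

Lemma Re_comb z : complex.Re (comb z) = \sum_(p <- s) complex.Re (k p) * tens (a p) (b p) z.
Proof.
rewrite /comb; elim: s => [|p t IH]; first by rewrite !big_nil.
by rewrite !big_cons ReD IH; congr (_ + _); case: (k p) => x y /=; rewrite mulr0 subr0.
Qed.

Lemma Im_comb z : complex.Im (comb z) = \sum_(p <- s) complex.Im (k p) * tens (a p) (b p) z.
Proof.
rewrite /comb; elim: s => [|p t IH]; first by rewrite !big_nil.
by rewrite !big_cons ImD IH; congr (_ + _); case: (k p) => x y /=; rewrite mulr0 add0r.
Qed.

Lemma dbar_comb z :
  dbar comb z = \sum_(p <- s) k p * dbart (a p) (a' p) (b p) (b' p) z.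
Proof.
rewrite /dbar /=.
have -> : (fun w => complex.Re (comb w)) =
    fun w => \sum_(p <- s) complex.Re (k p) * tens (a p) (b p) w.
  by apply/funext => w; rewrite Re_comb.
have -> : (fun w => complex.Im (comb w)) =
    fun w => \sum_(p <- s) complex.Im (k p) * tens (a p) (b p) w.
  by apply/funext => w; rewrite Im_comb.
have X (q : I -> R) : dx (fun w => \sum_(p <- s) q p * tens (a p) (b p) w) z =
    \sum_(p <- s) q p * (a' p z.1 * b p z.2).
  have := is_derive_sum_plane s q (fun p => is_derive_tens1 (b p) (da p z.1)).
  by move=> h; rewrite /dx derive_val.
have Y (q : I -> R) : dy (fun w => \sum_(p <- s) q p * tens (a p) (b p) w) z =
    \sum_(p <- s) q p * (a p z.1 * b' p z.2).
  have := is_derive_sum_plane s q (fun p => is_derive_tens2 (a p) (db p z.2)).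
  by move=> h; rewrite /dy derive_val.
rewrite !X !Y; elim: s => [|p t IH].
  by rewrite !big_nil; apply/eqP; rewrite eq_complex /= !(mulr0, mul0r, addr0, subr0, oppr0) !eqxx.
rewrite !big_cons -IH /dbart.
have -> : 2^-1 = (2^-1 : R)%:C%C :> R[i] by rewrite fmorphV rmorph_nat.
move: (\sum_(j <- t) _) (\sum_(j <- t) _) (\sum_(j <- t) _) (\sum_(j <- t) _) => A B C D.
case: (k p) => x y; apply/eqP; rewrite eq_complex /=.
by apply/andP; split; apply/eqP; ring.
Qed.

Lemma smooth_comb r : 
  (forall p n, C1n n (a p)) -> (forall p n, C1n n (b p)) ->
  (forall p z, p \in s -> tens (a p) (b p) z != 0 -> dist z (0, 0) <= r) ->
  smooth_compact_support comb.
Proof.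
move=> Ca Cb supp; split.
- move=> n; have -> : (fun w => complex.Re (comb w)) =
      fun w => \sum_(p <- s) complex.Re (k p) * tens (a p) (b p) w.
    by apply/funext => w; rewrite Re_comb.
  by apply: Cn_sum => p; exact: Cn_tens.
- move=> n; have -> : (fun w => complex.Im (comb w)) =
      fun w => \sum_(p <- s) complex.Im (k p) * tens (a p) (b p) w.
    by apply/funext => w; rewrite Im_comb.
  by apply: Cn_sum => p; exact: Cn_tens.
apply: (@subclosed_compact _ _ (box (0, 0) r)).
- exact: closed_closure.
- exact: compact_box.
have cb : closed (box (0, 0) r : set (R * R)).
  apply: compact_closed; last exact: compact_box.
  exact: norm_hausdorff.
rewrite [X in _ `<=` X]((closure_id _).1 cb); apply: closure_subset => z /=.
have [//|zr] := boolP (dist z (0, 0) <= r).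
rewrite /comb big1_seq ?eqxx// => p /andP[_ ps].
have [/eqP t0|/(supp _ _ ps) h] := boolP (tens (a p) (b p) z == 0).
  by rewrite -/(tens (a p) (b p) z) t0 mulr0.
by move: zr; rewrite h.
Qed.

End combination.

Lemma vitushkin_cint phi (g : R * R -> R[i]) l :
  vitushkin phi g l = (pi^-1)%:C%C * cint area (fun z => (g z - g l) * ker z l * dbar phi z).
Proof. by []. Qed.

End tensors.

(** * Continuity of localized functions *)

Section potentials.
Variable R : realType.
Implicit Types (z w l c : R * R).

Lemma dominated_box (psi : R * R -> R[i]) (r D : R) z : 0 <= D ->
  normc (psi z) <= D * \1_(box (0, 0) r) z -> ~ box (0, 0) r z -> psi z = 0.
Proof.
move=> D0 + zr; rewrite indicE memNset// mulr0 => h.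
by apply: eq0_normc; apply/eqP; rewrite eq_le h normc_ge0.
Qed.

Section potential.
Variables (psi : mplane R -> R[i]) (r D : R).
Hypotheses (r0 : 0 < r) (D0 : 0 <= D) (mpsi : cmeas psi).
Hypothesis psiD : forall z, normc (psi z) <= D * \1_(box (0, 0) r) z.

Definition potential l : R[i]^o := cint area (fun z => psi z * ker z l).

Lemma potential_L1 l : cL1 area (fun z => psi z * ker z l).
Proof.
apply: cL1_le (L1_box_ker (0, 0) l D r0).
  by apply: cmeasM => //; exact: cmeas_kerl.
by move=> z; rewrite normcM mulrA ler_wpM2r ?normc_ge0.
Qed.

(** The resolvent identity, for a point [z] away from both poles. *)
Lemma ker_diff z l l' (s : R) : 0 < s -> dist l' l <= s / 2 -> s < dist z l ->
  normc (ker z l' - ker z l) <= 4 * dist l' l / s ^+ 2.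
Proof.
move=> s0 ds zs.
have zs' : s / 2 <= dist z l'.
  by have := dist_tri l' z l; have := zs; lra.
have [->|ll] := eqVneq l' l.
  by rewrite subrr normc0 distxx mulr0 mul0r.
have zl : z != l by apply: contraTneq zs => ->; rewrite distxx -leNgt ltW.
have zl' : z != l' by apply: contraTneq zs' => ->; rewrite distxx -ltNge divr_gt0.
have -> : ker z l' - ker z l = ker z l * ker z l' * (toC l' - toC l).
  rewrite (ker_resolvent zl' zl ll) /ker -mulrA mulVf ?mulr1//.
  by rewrite toC_eq0.
rewrite !normcM.
have k1 : normc (ker z l) <= s^-1 by apply: ker_le => //; exact: ltW.
have k2 : normc (ker z l') <= (s / 2)^-1 by apply: ker_le => //; rewrite divr_gt0.
apply: (@le_trans _ _ (s^-1 * (s / 2)^-1 * (2 * dist l' l))).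
  by rewrite ler_pM ?mulr_ge0 ?normc_ge0 ?normc_le_dist// ler_pM ?normc_ge0.
by rewrite le_eqVlt; apply/orP; left; apply/eqP; field; rewrite gt_eqF.
Qed.

(** Inside the square of radius [s] around [l] the two kernels are integrated
    separately, outside their difference is small; [s] is left free to balance
    the two parts. *)
Lemma potential_diff l l' (s : R) : 0 < s -> dist l' l <= s / 2 ->
  normc (potential l' - potential l) <=
  2 * (D * (40 * s + 4 * dist l' l / s ^+ 2 * (2 * r) ^+ 2)).
Proof.
move=> s0 ds; rewrite /potential -cintB; try exact: potential_L1.
have [i1 b1] := box_kernel l l s0.
have [i2 b2] := box_kernel l' l s0.
have i3 := L1_box (0, 0) (4 * dist l' l / s ^+ 2) (ltW r0).
have i12 := L1D i1 i2.
pose B z := D * ((\1_(box l s) z * normc (ker z l) + \1_(box l s) z * normc (ker z l')) +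
   4 * dist l' l / s ^+ 2 * \1_(box (0, 0) r) z).
have iB : L1 area B by apply: L1Z; exact: L1D.
have c0 : 0 <= 4 * dist l' l / s ^+ 2.
  by rewrite divr_ge0 ?mulr_ge0 ?dist_ge0 ?(ltW s0).
apply: (@le_trans _ _ (2 * \int[area]_z B z)).
  apply: le_cint => //.
    by apply: cmeasB; apply: cmeasM => //; exact: cmeas_kerl.
  move=> z; rewrite -mulrBr normcM /B.
  have [zr|zr] := pselect (box (0, 0) r z); last first.
    rewrite (dominated_box D0 (psiD z) zr) normc0 mul0r mulr_ge0//.
    have h3 : 0 <= 4 * dist l' l / s ^+ 2 * \1_(box (0, 0) r) z by apply: mulr_ge0.
    by rewrite addr_ge0// addr_ge0// mulr_ge0// normc_ge0.
  have := psiD z; rewrite [\1_(box (0, 0) r) z]indicE mem_set// !mulr1 => pD.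
  apply: ler_pM; rewrite ?normc_ge0//.
  have [zs|zs] := leP (dist z l) s.
    rewrite indicE mem_set// !mul1r; apply: ler_wpDr => //.
    by apply: (le_trans (ler_normcD _ _)); rewrite normc_opp addrC.
  apply: ler_wpDl; first by rewrite addr_ge0// mulr_ge0 ?normc_ge0.
  exact: ker_diff.
rewrite ler_pM2l// RintegralZl//; last exact: L1D.
rewrite ler_wpM2l// RintegralD// RintegralD// (Rintegral_indic_box _ _ (ltW r0)) lerD2r.
have -> : 40 * s = 20 * s + 20 * s by ring.
by apply: lerD.
Qed.

Lemma potential_continuous : continuous potential.
Proof.
move=> l; apply/ccontinuousP => e e0.
(* [D + 1] rather than [D], which may be 0 *)
pose E := D + 1.
have E0 : 0 < E by rewrite ltr_wpDl.
pose s := e / (160 * E).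
have s0 : 0 < s by rewrite divr_gt0// mulr_gt0.
pose d := e * s ^+ 2 / (64 * E * r ^+ 2).
have d0 : 0 < d.
  have s2 : 0 < s ^+ 2 by rewrite exprn_gt0.
  have r2 : 0 < r ^+ 2 by rewrite exprn_gt0.
  by apply: divr_gt0; [exact: mulr_gt0|apply: mulr_gt0 => //; exact: mulr_gt0].
exists (Num.min d (s / 2)); first by rewrite lt_min d0 divr_gt0.
move=> l'; rewrite le_min => /andP[ld ls].
apply: (le_trans (potential_diff s0 ls)).
have h1 : 40 * s + 4 * dist l' l / s ^+ 2 * (2 * r) ^+ 2 <= e / (2 * E).
  have -> : e / (2 * E) = 40 * s + 4 * d / s ^+ 2 * (2 * r) ^+ 2.
    by rewrite /d {1}/s; field; rewrite !gt_eqF.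
  rewrite lerD2l ler_pM2r ?exprn_gt0 ?mulr_gt0// ler_pM2r ?invr_gt0 ?exprn_gt0//.
  by rewrite ler_pM2l.
apply: (@le_trans _ _ (2 * (E * (e / (2 * E))))).
  rewrite ler_pM2l//; apply: ler_pM => //; last by rewrite lerDl.
  apply: addr_ge0; first by rewrite mulr_ge0// ltW.
  apply: mulr_ge0; last exact: sqr_ge0.
  by apply: divr_ge0; [rewrite mulr_ge0 ?dist_ge0|exact: sqr_ge0].
by rewrite le_eqVlt; apply/orP; left; apply/eqP; field; rewrite gt_eqF.
Qed.

End potential.

(** Splitting the difference quotient expresses the localized function by
    two potentials of bounded densities. *)
Lemma vitushkin_continuous (phi : R * R -> R[i]) (g : R * R -> R[i]^o) (r D : R) :
  0 < r -> 0 <= D -> cmeas (dbar phi : mplane R -> R[i]) ->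
  (forall z, normc (dbar phi z) <= D * \1_(box (0, 0) r) z) -> continuous g ->
  continuous (vitushkin phi g : R * R -> R[i]^o).
Proof.
move=> r0 D0 mphi phiD cg.
have [B B0 gB] := ccontinuous_bounded r cg.
have mg := ccontinuous_cmeas cg.
pose psi z := g z * dbar phi z.
have mpsi : cmeas (psi : mplane R -> R[i]) by exact: cmeasM.
have psiD z : normc (psi z) <= B * D * \1_(box (0, 0) r) z.
  rewrite normcM -mulrA; have [zr|zr] := pselect (box (0, 0) r z).
    by apply: ler_pM; rewrite ?normc_ge0// gB.
  by rewrite (dominated_box D0 (phiD z) zr) normc0 mulr0 indicE memNset// !mulr0.
have BD0 : 0 <= B * D by rewrite mulr_ge0// ltW.
have E l : vitushkin phi g l = (pi^-1)%:C%C *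
    (potential psi l - g l * potential (dbar phi) l).
  rewrite vitushkin_cint; congr (_ * _).
  rewrite /potential -cintZ; last exact: potential_L1 r0 mphi phiD l.
  rewrite -cintB; first by apply: eq_cint => z; rewrite /psi; ring.
    exact: potential_L1 r0 mpsi psiD l.
  by apply: cL1Z; exact: potential_L1 r0 mphi phiD l.
have c1 := potential_continuous r0 BD0 mpsi psiD.
have c2 := potential_continuous r0 D0 mphi phiD.
have -> : vitushkin phi g = fun l => (pi^-1)%:C%C *
    (potential psi l - g l * potential (dbar phi) l) by apply/funext.
move=> l; apply: (@cvgM R[i]); first exact: cvg_cst.
apply: (@cvgB R[i] R[i]^o); first exact: c1.
by apply: (@cvgM R[i]); [exact: cg|exact: c2].
Qed.

End potentials.

(** * One cell of the grid *)

Section cell.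
Variable R : realType.
Implicit Types (z w l c : R * R).
Variable eta : {finite_measure set (mplane R) -> \bar R}.
Variable f : R * R -> R[i].
Hypotheses (mf : complex_measurable f) (f1 : forall w, normc (f w) <= 1).

Definition cell_mass (a b : R -> R) : R := \int[eta]_w (a w.1 * b w.2).

(** The mean of [f] over the cell.  When the cell has no mass the inverse is 0,
    and so is the coefficient. *)
Definition cell_coef (a b : R -> R) : R[i] :=
  cint eta (fun w => f w * (a w.1 * b w.2)%:C%C) * ((cell_mass a b)^-1)%:C%C.

Section one_cell.
Variables (c : R * R) (r M : R) (a a' b b' : R -> R).
Hypothesis (Ca : cutoff (c.1 - r) (c.1 + r) M a a').
Hypothesis (Cb : cutoff (c.2 - r) (c.2 + r) M b b').
Hypotheses (a0 : forall x, 0 <= a x) (b0 : forall x, 0 <= b x).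

Let r0 : 0 < r := cutoff_r_gt0 Ca.
Let phi w : R := a w.1 * b w.2.
Let gam := cell_coef a b.

Lemma normc_real (x : R) : normc (x%:C%C) = `|x|.
Proof. by rewrite normcE /= expr0n addr0 sqrtr_sqr. Qed.

Lemma phi_ge0 w : 0 <= phi w.
Proof. exact: mulr_ge0. Qed.

Lemma phi_le1 w : phi w <= 1.
Proof.
rewrite -(ger0_norm (phi_ge0 w)) normrM.
by rewrite mulr_ile1 ?(cutoff_le Ca) ?(cutoff_le Cb).
Qed.

Lemma measurable_phi : measurable_fun [set: mplane R] phi.
Proof. exact: (measurable_tens (cutoff_bdd Ca) (cutoff_bdd Cb)). Qed.

Lemma L1_phi : L1 eta phi.
Proof.
apply: L1_le (eta_L1_cst eta 1); first exact: measurable_phi.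
by move=> w; rewrite ger0_norm ?phi_ge0// phi_le1.
Qed.

Lemma phi_supp w : phi w != 0 -> dist w c <= r.
Proof.
move=> h; have [//|hd] := leP (dist w c) r.
have := normc_dbart Ca Cb w.
have z1 : c.1 - r < w.1 < c.1 + r.
  rewrite -[_ && _]negbK; apply: contra h => /(cutoff_supp Ca).
  by rewrite /phi => ->; rewrite mul0r.
have z2 : c.2 - r < w.2 < c.2 + r.
  rewrite -[_ && _]negbK; apply: contra h => /(cutoff_supp Cb).
  by rewrite /phi => ->; rewrite mulr0.
move=> _; move: hd; rewrite ltNge => /negP[].
move/andP: z1 => [? ?]; move/andP: z2 => [? ?].
by rewrite /dist ge_max !ler_distl !ltW.
Qed.

Lemma cmeas_phi : cmeas (fun w : mplane R => (phi w)%:C%C).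
Proof. by apply: cmeas_real; exact: measurable_phi. Qed.

Lemma normc_fphi w : normc (f w * (phi w)%:C%C) <= phi w.
Proof.
rewrite normcM normc_real (ger0_norm (phi_ge0 w)).
by rewrite ler_piMl ?phi_ge0.
Qed.

Lemma normc_cint_fphi : normc (cint eta (fun w => f w * (phi w)%:C%C)) <= 2 * cell_mass a b.
Proof.
apply: le_cint; [|exact: normc_fphi|exact: L1_phi].
by apply: cmeasM => //; exact: cmeas_phi.
Qed.

Lemma cell_mass_ge0 : 0 <= cell_mass a b.
Proof. by apply: Rintegral_ge0 => w _; exact: phi_ge0. Qed.

(** The bound is 2 and not 1 because of the constant in [le_cint]. *)
Lemma normc_cell_coef : normc gam <= 2.
Proof.
rewrite normcM normc_real; have [m0|m0] := eqVneq (cell_mass a b) 0.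
  by rewrite m0 invr0 normr0 mulr0.
have mp : 0 < cell_mass a b by rewrite lt_neqAle eq_sym m0 cell_mass_ge0.
by rewrite gtr0_norm ?invr_gt0// ler_pdivrMr// normc_cint_fphi.
Qed.

Lemma cint_phi : cint eta (fun w => (phi w)%:C%C) = (cell_mass a b)%:C%C.
Proof. by rewrite /cint /cell_mass /=; congr Complex; rewrite /Rintegral integral0. Qed.

Lemma cL1_phi : cL1 eta (fun w => (phi w)%:C%C).
Proof.
apply: (cL1_le cmeas_phi _ L1_phi) => w.
by rewrite normc_real ger0_norm ?phi_ge0.
Qed.

Lemma cL1_fphi : cL1 eta (fun w => f w * (phi w)%:C%C).
Proof.
apply: (eta_cL1_bdd (k := phi)); [|exact: normc_fphi|exact: L1_phi].
by apply: cmeasM => //; exact: cmeas_phi.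
Qed.

(** The choice of the coefficient; for a cell without mass, [f phi] integrates to
    0 as well. *)
Lemma zero_moment : cint eta (fun w => (f w - gam) * (phi w)%:C%C) = 0.
Proof.
under eq_cint do rewrite mulrBl.
rewrite cintB; [|exact: cL1_fphi|apply: cL1Z; exact: cL1_phi].
rewrite cintZ; last exact: cL1_phi.
rewrite cint_phi /gam /cell_coef -mulrA -rmorphM /=.
have [m0|m0] := eqVneq (cell_mass a b) 0.
  have := normc_cint_fphi; rewrite m0 !mulr0 subr0 => h.
  by apply: eq0_normc; apply/eqP; rewrite eq_le h normc_ge0.
by rewrite mulVf// mulr1 subrr.
Qed.

Variable l : R * R.
Hypothesis il : cL1 eta (fun w => ker w l).

Definition cell_term : R[i] := cint eta (fun w => (f w - gam) * (phi w)%:C%C * ker w l).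

Lemma cL1_kphi (u : R * R -> R[i]) (D : R) : cmeas (u : mplane R -> R[i]) ->
  (forall w, normc (u w) <= D) -> cL1 eta (fun w => u w * ker w l * (phi w)%:C%C).
Proof.
move=> m_u uD; apply: (eta_cL1_bdd (k := fun w => D * normc (ker w l))).
- by apply: cmeasM; [apply: cmeasM => //; exact: cmeas_kerl|exact: cmeas_phi].
- move=> w; rewrite !normcM normc_real (ger0_norm (phi_ge0 w)).
  rewrite -[leRHS]mulr1; apply: ler_pM; rewrite ?phi_ge0 ?phi_le1 ?mulr_ge0 ?normc_ge0//.
  by rewrite ler_wpM2r ?normc_ge0.
- by apply: L1Z; exact: cL1_normc.
Qed.

Lemma cint_pi_phi (u : R * R -> R[i]) :
  cL1 eta (fun w => u w * ker w l * (phi w)%:C%C) ->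
  cint eta (fun w => u w * ker w l * (pi * (a w.1 * b w.2))%:C%C) =
  pi%:C%C * cint eta (fun w => u w * ker w l * (phi w)%:C%C).
Proof.
by move=> iu; rewrite -cintZ//; apply: eq_cint => w; rewrite rmorphM /= -/(phi w); ring.
Qed.

(** The term is the difference of two localizations, of [h] and of a multiple of
    [g], and [near_estimate] applies to each. *)
Lemma cell_near (h g : R * R -> R[i]^o) (om : R) :
  (forall z, eta [set z] = 0%E) ->
  continuous h -> continuous g -> represents eta f h -> represents eta (cst 1) g ->
  h l = cint eta (fun w => f w * ker w l) ->
  g l = cint eta (fun w => cst 1 w * ker w l) ->
  0 <= om ->
  (forall z, dist z c <= r -> normc (h z - h l) <= om) ->
  (forall z, dist z c <= r -> normc (g z - g l) <= om) ->
  normc cell_term <= 120 * om * (M * r).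
Proof.
move=> noat ch cg rh rg hl gl om0 hom gom.
have m1 : complex_measurable (cst (1 : R[i])) by exact: cmeas_cst.
have n1 w : normc (cst (1 : R[i]) w) <= 1 by rewrite normc1.
have L1 := localization Ca Cb noat mf f1 ch rh il hl.
have L2 := localization Ca Cb noat m1 n1 cg rg il gl.
have E1 := near_estimate Ca Cb ch om0 hom.
have E2 := near_estimate Ca Cb cg om0 gom.
rewrite {}L1 in E1; rewrite {}L2 in E2.
have i1 := cL1_kphi mf f1.
have i2 := cL1_kphi m1 n1.
rewrite (cint_pi_phi i1) in E1; rewrite (cint_pi_phi i2) in E2.
have T : cell_term = cint eta (fun w => f w * ker w l * (phi w)%:C%C) -
    gam * cint eta (fun w => cst 1 w * ker w l * (phi w)%:C%C).
  rewrite -cintZ// -cintB//; last exact: cL1Z.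
  by apply: eq_cint => w /=; ring.
rewrite T; move: E1 E2; rewrite !normcM normc_real (gtr0_norm (pi_gt0 R)).
move: (cint _ _) (cint _ _) => B A E1 E2.
apply: (le_trans (ler_normcD _ _)); rewrite normc_opp normcM.
have p1 : 1 <= pi :> R by apply: le_trans (pi_ge2 R); rewrite ler1n.
have A1 : normc A <= 2 * (om * M * (20 * r)).
  by apply: le_trans E1; rewrite ler_peMl ?normc_ge0.
have B1 : normc B <= 2 * (om * M * (20 * r)).
  by apply: le_trans E2; rewrite ler_peMl ?normc_ge0.
(* 40 for [h], and twice 40 for [g], whose coefficient is at most 2 *)
have -> : 120 * om * (M * r) = 2 * (om * M * (20 * r)) + 2 * (2 * (om * M * (20 * r))) by ring.
apply: lerD => //; apply: ler_pM; rewrite ?normc_ge0//.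
exact: normc_cell_coef.
Qed.

(** Since the mass vanishes, [ker c l] can be subtracted from the kernel, and the
    difference is of order [r / dist w l ^+ 2] on the cell. *)
Lemma cell_far : 3 * r < dist l c ->
  normc cell_term <= 24 * \int[eta]_w (phi w * kappa l r w).
Proof.
move=> lc.
have c0 : 0 < dist l c by apply: lt_trans lc; rewrite mulr_gt0.
pose k w := (f w - gam) * (phi w)%:C%C.
have ikc : cL1 eta (fun w => k w * ker c l).
  rewrite /k; under eq_fun do rewrite mulrC.
  apply: cL1Z; under eq_fun do rewrite mulrBl.
  apply: cL1B; first exact: cL1_fphi.
  by apply: cL1Z; exact: cL1_phi.
have mk : cmeas (k : mplane R -> R[i]).
  apply: cmeasM; last exact: cmeas_phi.
  by apply: cmeasB => //; exact: cmeas_cst.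
have fg w : normc (f w - gam) <= 3.
  apply: (le_trans (ler_normcD _ _)); rewrite normc_opp.
  by have := normc_cell_coef; have := f1 w; lra.
have -> : cell_term = cint eta (fun w => k w * (ker w l - ker c l)).
  have ik : cL1 eta (fun w => k w * ker w l).
    apply: (eta_cL1_bdd (k := fun w => 3 * normc (ker w l))).
    - by apply: cmeasM => //; exact: cmeas_kerl.
    - move=> w; rewrite !normcM normc_real (ger0_norm (phi_ge0 w)).
      rewrite ler_wpM2r ?normc_ge0// -[leRHS]mulr1.
      by apply: ler_pM; rewrite ?normc_ge0 ?phi_ge0 ?phi_le1.
    - by apply: L1Z; exact: cL1_normc.
  under [RHS]eq_cint do rewrite mulrBr.
  rewrite cintB// (_ : cint eta (fun w => k w * ker c l) = 0) ?subr0//.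
  rewrite cintZr ?zero_moment ?mul0r//.
  rewrite /k; under eq_fun do rewrite mulrBl.
  apply: cL1B; first exact: cL1_fphi.
  by apply: cL1Z; exact: cL1_phi.
have i1 : L1 eta (fun w => 12 * (phi w * kappa l r w)).
  apply: L1Z; apply: L1_le (eta_L1_cst eta r^-1).
    by apply: measurable_funM; [exact: measurable_phi|exact: L1_meas (L1_kappa _ _ r0)].
  move=> w; rewrite ger0_norm ?mulr_ge0 ?phi_ge0 ?kappa_ge0//.
  rewrite -[leRHS]mul1r; apply: ler_pM; rewrite ?phi_ge0 ?phi_le1 ?kappa_ge0//.
  exact: kappa_le.
(* 12 = 3 * 4: the bound of [f - gam] and that of the kernel difference *)
apply: (@le_trans _ _ (2 * \int[eta]_w (12 * (phi w * kappa l r w)))).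
  apply: le_cint => //.
    apply: cmeasM => //; apply: cmeasB; first exact: cmeas_kerl.
    exact: cmeas_cst.
  move=> w; rewrite /k !normcM normc_real (ger0_norm (phi_ge0 w)).
  have [->|/phi_supp wc] := eqVneq (phi w) 0.
    by rewrite !(mulr0, mul0r).
  have wl : 2 * r < dist w l by have := dist_tri w l c; rewrite (distC l w); lra.
  have w0 : 0 < dist w l by apply: lt_trans wl; rewrite mulr_gt0.
  have cw : dist w l / 2 <= dist c l.
    by have := dist_tri c w l; have := dist_ge0 w c; lra.
  rewrite /kappa ifT; last by apply: lt_trans wl; rewrite ltr_pMl// ltr1n.
  have -> : 12 * (phi w * (r / dist w l ^+ 2)) = 3 * phi w * (4 * (r / dist w l ^+ 2)) by ring.
  apply: ler_pM; rewrite ?mulr_ge0 ?normc_ge0 ?phi_ge0//.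
    by rewrite ler_wpM2r ?phi_ge0.
  have wl' : w != l by apply: contraTneq w0 => ->; rewrite distxx ltxx.
  have cl' : c != l by apply: contraTneq c0 => ->; rewrite distxx ltxx.
  have -> : ker w l - ker c l = ker w l * ker c l * (toC c - toC w).
    have := toC_eq0 w l; have := toC_eq0 c l; rewrite /ker.
    have -> : toC c - toC w = (toC c - toC l) - (toC w - toC l) by ring.
    rewrite (negbTE wl') (negbTE cl').
    move: (toC c - toC l) (toC w - toC l) => X Y /negbT X0 /negbT Y0.
    by field; rewrite X0 Y0.
  rewrite !normcM.
  have k1 : normc (ker w l) <= (dist w l)^-1 by exact: ker_le.
  have k2 : normc (ker c l) <= (dist w l / 2)^-1 by apply: ker_le => //; rewrite divr_gt0.
  have k3 : normc (toC c - toC w) <= 2 * r.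
    by apply: (le_trans (normc_le_dist _ _)); rewrite ler_pM2l// distC.
  apply: (@le_trans _ _ ((dist w l)^-1 * (dist w l / 2)^-1 * (2 * r))).
    by rewrite ler_pM ?mulr_ge0 ?normc_ge0// ler_pM ?normc_ge0.
  by rewrite le_eqVlt; apply/orP; left; apply/eqP; field; rewrite gt_eqF.
have i2 : L1 eta (fun w => phi w * kappa l r w).
  have := L1Z (12^-1) i1; apply: eq_integrable => // w _ /=.
  by congr EFin; field.
rewrite RintegralZl// mulrA le_eqVlt; apply/orP; left; apply/eqP; congr (_ * _).
by ring.
Qed.

End one_cell.
End cell.

(** * Summation over the grid *)

Section grid.
Variable R : realType.
Implicit Types (z w l c : R * R).

Lemma sum_window (o d x : R) n :
  \sum_(i <- index_iota 0 n) window o d i%:R (i%:R + 1) x =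
  step ((x - o) / d) - step ((x - o) / d - n%:R).
Proof.
elim: n => [|n IH]; first by rewrite big_geq// subr0 subrr.
rewrite big_nat_recr//= IH /window -natr1.
by rewrite addrA subrK.
Qed.

(** The integers at distance at most 4 from [t] lie among 9 consecutive ones. *)
Lemma near_count (t : R) n :
  \sum_(i <- index_iota 0 n) (`|t - (i%:R : R)| <= 4)%R%:R <= (9 : R).
Proof.
pose P (i : nat) : bool := `|t - (i%:R : R)| <= (4 : R).
rewrite (eq_bigr (fun i => if P i then 1 else 0)); last first.
  by move=> i _; rewrite /P; case: ifP.
rewrite -big_mkcond /= -big_filter.
have -> : \sum_(i <- [seq i <- index_iota 0 n | P i]) (1 : R) =
    (size [seq i <- index_iota 0 n | P i])%:R.
  elim: [seq _ <- _ | _] => [|x s IH]; first by rewrite big_nil.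
  by rewrite big_cons IH /= -natr1 addrC.
rewrite ler_nat.
pose k := Num.truncn (Num.max 0 (t - 4)).
have x0 : 0 <= Num.max 0 (t - 4) by rewrite le_max lexx.
rewrite -(size_iota k 9); apply: uniq_leq_size; first exact/filter_uniq/iota_uniq.
move=> i; rewrite mem_filter => /andP[].
rewrite /P ler_distl => /andP[h1 h2] _.
rewrite mem_iota; apply/andP; split.
  have : k%:R <= i%:R :> R.
    apply: (@le_trans _ _ (Num.max 0 (t - 4))); first by rewrite truncn_le.
    by rewrite ge_max ler0n /=; lra.
  by rewrite ler_nat.
have h3 : Num.max 0 (t - 4) < k.+1%:R by exact: truncnS_gt.
have h4 : t - 4 < k.+1%:R by apply: le_lt_trans h3; rewrite le_max lexx orbT.
rewrite -(ltr_nat R) natrD; rewrite -natr1 in h4.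
by lra.
Qed.

Lemma Rintegral_sum d (T : measurableType d) (mu : {measure set T -> \bar R})
    (I : Type) (s : seq I) (u : I -> T -> R) : (forall p, L1 mu (u p)) ->
  L1 mu (fun t => \sum_(p <- s) u p t) /\
  \int[mu]_t (\sum_(p <- s) u p t) = \sum_(p <- s) \int[mu]_t u p t.
Proof.
move=> iu; elim: s => [|p s [ih1 ih2]]; split.
- by under eq_fun do rewrite big_nil; exact: integrable0.
- rewrite big_nil /Rintegral; under eq_integral do rewrite big_nil.
  by rewrite integral0.
- by under eq_fun do rewrite big_cons; exact: L1D.
- under eq_Rintegral do rewrite big_cons.
  rewrite big_cons -ih2; apply: RintegralD => //; exact: iu.
Qed.

Lemma normc_sum (I : Type) (s : seq I) (F : I -> R[i]) :
  normc (\sum_(p <- s) F p) <= \sum_(p <- s) normc (F p).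
Proof.
elim: s => [|p s IH]; first by rewrite !big_nil normc0.
by rewrite !big_cons; apply: (le_trans (ler_normcD _ _)); rewrite lerD2l.
Qed.

Variable eta : {finite_measure set (mplane R) -> \bar R}.
Variables (f : R * R -> R[i]) (h g : R * R -> R[i]^o).
Hypotheses (mf : complex_measurable f) (f1 : forall w, normc (f w) <= 1).
Hypotheses (ch : continuous h) (cg : continuous g).
Hypotheses (rh : represents eta f h) (rg : represents eta (cst 1) g).
Variable M : R.
Hypothesis HM : forall o r s t : R, 0 < r -> s <= t ->
  exists a', cutoff (o + r * s) (o + r * (t + 1)) (M / r) (window o r s t) a'.

Variables (r0 d : R) (n : nat).
Hypotheses (d0 : 0 < d) (nd : 2 * r0 + d <= d * n%:R).
Hypothesis eta0 : {ae eta, forall w, box (0, 0) r0 w}.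

Let o : R := - r0 - d.
Let W (i : nat) : R -> R := window o d i%:R (i%:R + 1).
Let cen (p : nat * nat) : R * R := (o + d * (p.1%:R + 1), o + d * (p.2%:R + 1)).
Let cells := [seq (i, j) | i <- index_iota 0 n, j <- index_iota 0 n].
Let phi (p : nat * nat) w : R := W p.1 w.1 * W p.2 w.2.
Let gam (p : nat * nat) : R[i] := cell_coef eta f (W p.1) (W p.2).

(** The grid starts one mesh to the left of the square carrying [eta], so that the
    windows add up to 1 on that whole square. *)
Definition grid_approx : R * R -> R[i] :=
  comb cells gam (fun p => W p.1) (fun p => W p.2).

Let W0 i x : 0 <= W i x.
Proof. by apply: window_ge0; rewrite lerDl. Qed.

Lemma sumW_le1 x : \sum_(i <- index_iota 0 n) W i x <= 1.
Proof. by rewrite sum_window lerBlDr (le_trans (step_le1 _))// lerDl step_ge0. Qed.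

Lemma sumW_eq1 x : `|x| <= r0 -> \sum_(i <- index_iota 0 n) W i x = 1.
Proof.
rewrite ler_norml => /andP[x1 x2]; rewrite sum_window step1 ?step0 ?subr0//.
  by rewrite subr_le0 ler_pdivrMr// mulrC; apply: le_trans nd; rewrite /o; lra.
by rewrite ler_pdivlMr// mul1r /o; lra.
Qed.

Lemma sum_phi w : \sum_(p <- cells) phi p w =
  (\sum_(i <- index_iota 0 n) W i w.1) * (\sum_(j <- index_iota 0 n) W j w.2).
Proof.
rewrite big_allpairs big_distrl /=; apply: eq_bigr => i _.
by rewrite big_distrr.
Qed.

Lemma cutoff_cells : exists W' : nat -> R -> R, forall i,
  cutoff (o + d * (i%:R + 1) - d) (o + d * (i%:R + 1) + d) (M / d) (W i) (W' i).
Proof.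
suff : forall i, exists a', cutoff (o + d * (i%:R + 1) - d) (o + d * (i%:R + 1) + d)
  (M / d) (W i) a' by move/choice => [W' HW]; exists W'.
move=> i; have [|a' Ca] := @HM o d i%:R (i%:R + 1) d0; first by rewrite lerDl.
exists a'; have -> : o + d * (i%:R + 1) - d = o + d * i%:R by ring.
by have -> : o + d * (i%:R + 1) + d = o + d * (i%:R + 1 + 1) by ring.
Qed.

Lemma cen_le p : p \in cells -> dist (cen p) (0, 0) <= `|o| + d * n%:R.
Proof.
move=> /allpairsP[[i j] /= [ii jj ->]].
have H (k : nat) : k \in index_iota 0 n -> `|o + d * (k%:R + 1)| <= `|o| + d * n%:R.
  rewrite mem_index_iota => /andP[_ kn]; apply: (le_trans (ler_normD _ _)).
  rewrite lerD2l ger0_norm; last by rewrite mulr_ge0 ?(ltW d0)// addr_ge0.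
  by rewrite ler_pM2l// natr1 ler_nat.
by rewrite /dist /cen /= !subr0 ge_max !H.
Qed.

Lemma smooth_grid_approx : smooth_compact_support grid_approx.
Proof.
have [W' HW] := cutoff_cells.
apply: (@smooth_comb _ _ _ _ _ _ (`|o| + d * (n%:R + 1))).
- by move=> p m; exact: C1n_window.
- by move=> p m; exact: C1n_window.
move=> p z ps t0.
have zc := @phi_supp R (cen p) d (M / d) _ _ _ _ (HW p.1) (HW p.2) z t0.
apply: (le_trans (dist_tri (cen p) z _)).
have -> : `|o| + d * (n%:R + 1) = d + (`|o| + d * n%:R) by ring.
by apply: lerD => //; exact: cen_le.
Qed.

Lemma continuous_vitushkin_grid : continuous (vitushkin grid_approx g : R * R -> R[i]^o).
Proof.
have [W' HW] := cutoff_cells.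
have dW i (x : R) : is_derive x 1 (W i) (W' i x) by exact: cutoff_der (HW i) x.
pose D p z := dbart (W p.1) (W' p.1) (W p.2) (W' p.2) z.
have dE : dbar grid_approx = fun z => \sum_(p <- cells) gam p * D p z.
  by apply/funext => z; rewrite (dbar_comb cells gam (fun p => dW p.1) (fun p => dW p.2)).
have M0 : 0 <= M / d := le_trans (normr_ge0 _) (cutoff_dle (HW 0%N) 0).
have mD p : cmeas (D p : mplane R -> R[i]).
  exact: (@cmeas_dbart R _ _ _ _ _ _ _ _ _ _ (HW p.1) (HW p.2)).
pose B := \sum_(p <- cells) normc (gam p) * (M / d).
pose r1 := `|o| + d * n%:R + d.
apply: (@vitushkin_continuous R grid_approx g r1 B).
- by rewrite ltr_wpDl// addr_ge0// mulr_ge0// ltW.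
- by rewrite sumr_ge0// => p _; rewrite mulr_ge0 ?normc_ge0.
- rewrite dE; elim: cells => [|p s IH].
    by under eq_fun do rewrite big_nil; exact: cmeas_cst.
  under eq_fun do rewrite big_cons; apply: cmeasD => //.
  by apply: cmeasM; [exact: cmeas_cst|exact: mD].
- move=> z; rewrite dE; apply: (le_trans (normc_sum _ _)).
  rewrite /B big_distrl big_seq [leRHS]big_seq; apply: ler_sum => p ps.
  rewrite normcM.
  apply: (@le_trans _ _ (normc (gam p) * (M / d * \1_(box (0, 0) r1) z))); last by rewrite mulrA.
  rewrite ler_wpM2l ?normc_ge0//.
  apply: (le_trans (@normc_dbart R (cen p) d (M / d) _ _ _ _ (HW p.1) (HW p.2) z)).
  rewrite ler_wpM2l// !indicE.
  have [/set_mem zp|_] := boolP (z \in box (cen p) d); last exact: ler0n.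
  rewrite [z \in box (0, 0) r1]mem_set// /box /= /r1 addrC.
  by apply: (le_trans (dist_tri (cen p) z _)); apply: lerD => //; exact: cen_le.
- exact: cg.
Qed.

Section estimate_at.
Variable l : R * R.
Hypotheses (il : cL1 eta (fun w => ker w l)).
Hypotheses (hl : h l = cint eta (fun w => f w * ker w l)).
Hypotheses (gl : g l = cint eta (fun w => cst 1 w * ker w l)).
Variable om : R.
Hypotheses (om0 : 0 <= om).
Hypothesis hom : forall z, dist z l <= 5 * d -> normc (h z - h l) <= om.
Hypothesis gom : forall z, dist z l <= 5 * d -> normc (g z - g l) <= om.

Let noat := noatom cg rg.

(** Localization is linear in the test function, and on each product it gives the
    Cauchy transform of the product times [eta]. *)
Lemma vitushkin_grid : vitushkin grid_approx g l =
  \sum_(p <- cells) gam p * cint eta (fun w => cst 1 w * ker w l * (phi p w)%:C%C).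
Proof.
have [W' HW] := cutoff_cells.
have dW i (x : R) : is_derive x 1 (W i) (W' i x) by exact: cutoff_der (HW i) x.
have m1 : complex_measurable (cst (1 : R[i])) by exact: cmeas_cst.
have n1 w : normc (cst (1 : R[i]) w) <= 1 by rewrite normc1.
rewrite vitushkin_cint.
pose D p z := dbart (W p.1) (W' p.1) (W p.2) (W' p.2) z.
have -> : cint area (fun z => (g z - g l) * ker z l * dbar grid_approx z) =
    cint area (fun z => \sum_(p <- cells) gam p * ((g z - g l) * ker z l * D p z)).
  apply: eq_cint => z.
  rewrite (dbar_comb cells gam (fun p => dW p.1) (fun p => dW p.2)).
  rewrite big_distrr /=; apply: eq_bigr => p _; rewrite /D; ring.
have iD p : cL1 area (fun z => (g z - g l) * ker z l * D p z).
  exact: (@localization_L1 R (cen p) d (M / d) _ _ _ _ (HW p.1) (HW p.2) g l cg).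
rewrite cint_sum; last by move=> p; exact: cL1Z.
rewrite big_distrr /=; apply: eq_bigr => p _.
rewrite cintZ// mulrCA; congr (_ * _).
rewrite /D (localization (HW p.1 : cutoff ((cen p).1 - d) _ _ _ _) (HW p.2) noat m1 n1 cg rg il gl).
have ip := @cL1_kphi R eta (cen p) d (M / d) _ _ _ _ (HW p.1) (HW p.2) (W0 p.1) (W0 p.2) l il _ _ m1 n1.
rewrite (cint_pi_phi ip) mulrA -rmorphM /= mulVf ?mul1r//.
by rewrite gt_eqF// pi_gt0.
Qed.

(** The windows form a partition of unity on a square that carries [eta]. *)
Lemma represent_grid : h l =
  \sum_(p <- cells) cint eta (fun w => f w * ker w l * (phi p w)%:C%C).
Proof.
have [W' HW] := cutoff_cells.
have ip p := @cL1_kphi R eta (cen p) d (M / d) _ _ _ _ (HW p.1) (HW p.2) (W0 p.1) (W0 p.2) l il _ _ mf f1.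
rewrite hl -cint_sum//; apply: cint_ae.
- by apply: cmeasM => //; exact: cmeas_kerl.
- exact: cL1_meas (cL1_sum cells ip).
apply: aeS eta0 => w; rewrite /box /= /dist !subr0 ge_max => /andP[w1 w2].
rewrite -big_distrr /= -rmorph_sum /= sum_phi !sumW_eq1// mulr1.
by rewrite mulr1.
Qed.

(** A cell is near when its centre is within [4 d] of [l]; there are at most 9
    such positions in each coordinate, hence 81 near cells.  For the far cells
    the integrals add up because the windows sum to at most 1. *)
Lemma grid_estimate : normc (h l - vitushkin grid_approx g l) <=
  81 * (120 * om * M) + 24 * \int[eta]_w kappa l d w.
Proof.
have [W' HW] := cutoff_cells.
have m1 : complex_measurable (cst (1 : R[i])) by exact: cmeas_cst.
have n1 w : normc (cst (1 : R[i]) w) <= 1 by rewrite normc1.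
have M0 : 0 <= M.
  by have := cutoff_dle (HW 0%N) 0 => /(le_trans (normr_ge0 _)); rewrite pmulr_lge0// invr_gt0.
have i1 p := @cL1_kphi R eta (cen p) d (M / d) _ _ _ _ (HW p.1) (HW p.2) (W0 p.1) (W0 p.2) l il _ _ mf f1.
have i2 p := @cL1_kphi R eta (cen p) d (M / d) _ _ _ _ (HW p.1) (HW p.2) (W0 p.1) (W0 p.2) l il _ _ m1 n1.
pose T p := cell_term eta f (W p.1) (W p.2) l.
have -> : h l - vitushkin grid_approx g l = \sum_(p <- cells) T p.
  rewrite vitushkin_grid represent_grid -sumrB; apply: eq_bigr => p _.
  rewrite -(cintZ (gam p) (i2 p)) -(cintB (i1 p) (cL1Z (gam p) (i2 p))).
  by apply: eq_cint => w /=; rewrite /phi /gam; ring.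
apply: (le_trans (normc_sum _ _)).
pose A (x : R) (i : nat) : R := (`|(x - o) / d - 1 - (i%:R : R)| <= 4)%R%:R.
have near_eq (x : R) (i : nat) : (`|x - (o + d * (i%:R + 1))| <= 4 * d) =
    (`|(x - o) / d - 1 - i%:R| <= 4).
  have -> : x - (o + d * (i%:R + 1)) = ((x - o) / d - 1 - i%:R) * d.
    by field; rewrite gt_eqF.
  by rewrite normrM (gtr0_norm d0) ler_pM2r.
have iphk p : L1 eta (fun w => phi p w * kappa l d w).
  apply: L1_le (L1_kappa eta l d0).
    apply: measurable_funM; last exact: L1_meas (L1_kappa eta l d0).
    exact: (@measurable_phi R (cen p) d (M / d) _ _ _ _ (HW p.1) (HW p.2)).
  have p0 := phi_ge0 (W0 p.1) (W0 p.2).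
  have p1 := @phi_le1 R (cen p) d (M / d) _ _ _ _ (HW p.1) (HW p.2) (W0 p.1) (W0 p.2).
  move=> w; rewrite ger0_norm ?mulr_ge0 ?kappa_ge0//.
  by rewrite ler_piMl ?kappa_ge0//; exact: p1.
have bound p : normc (T p) <= A l.1 p.1 * A l.2 p.2 * (120 * om * M) +
    24 * \int[eta]_w (phi p w * kappa l d w).
  have C0 : 0 <= 120 * om * M by rewrite !mulr_ge0.
  have I0 : 0 <= 24 * \int[eta]_w (phi p w * kappa l d w).
    by rewrite mulr_ge0// Rintegral_ge0// => w _; rewrite mulr_ge0 ?kappa_ge0// mulr_ge0.
  have [lc|lc] := leP (dist l (cen p)) (4 * d).
    have := lc; rewrite /dist ge_max /cen /= !near_eq => /andP[h1 h2].
    rewrite /A h1 h2 !mul1r; apply: ler_wpDr => //.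
    have -> : 120 * om * M = 120 * om * (M / d * d) by field; rewrite gt_eqF.
    have zl z : dist z (cen p) <= d -> dist z l <= 5 * d.
      by move=> zc; have := dist_tri (cen p) z l; rewrite (distC (cen p) l); lra.
    apply: (@cell_near R eta f mf f1 (cen p) d (M / d) _ _ _ _ (HW p.1) (HW p.2)
      (W0 p.1) (W0 p.2) l il h g om noat ch cg rh rg hl gl om0).
      by move=> z /zl; exact: hom.
    by move=> z /zl; exact: gom.
  apply: ler_wpDl; first by rewrite mulr_ge0// mulr_ge0.
  apply: (@cell_far R eta f mf f1 (cen p) d (M / d) _ _ _ _ (HW p.1) (HW p.2)
    (W0 p.1) (W0 p.2) l il).
  by apply: le_lt_trans lc; rewrite ler_pM2r//; lra.
apply: (le_trans (ler_sum _ (fun p _ => bound p))).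
rewrite big_split /=; apply: lerD.
  rewrite -big_distrl /= ler_wpM2r ?mulr_ge0//.
  have -> : \sum_(p <- cells) A l.1 p.1 * A l.2 p.2 =
      (\sum_(i <- index_iota 0 n) A l.1 i) * (\sum_(j <- index_iota 0 n) A l.2 j).
    rewrite big_allpairs big_distrl /=; apply: eq_bigr => i _.
    by rewrite big_distrr.
  have -> : 81 = 9 * 9 :> R by ring.
  by apply: ler_pM; rewrite ?sumr_ge0// near_count.
rewrite -big_distrr /= ler_pM2l//.
have [iS <-] := Rintegral_sum cells iphk.
apply: le_Rintegral => //; first exact: L1_kappa.
move=> w _; rewrite -big_distrl /= ler_piMl ?kappa_ge0// sum_phi.
by rewrite mulr_ile1 ?sumW_le1 ?sumr_ge0.
Qed.

End estimate_at.
End grid.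

(** * Uniform approximation *)

Section main.
Variable R : realType.
Implicit Types (z w l c : R * R).

(** A property true almost everywhere holds arbitrarily close to any point. *)
Lemma ae_box (P : R * R -> Prop) l (r : R) : 0 < r ->
  {ae (@area R), forall z, P z} -> exists2 z, dist z l <= r & P z.
Proof.
move=> r0 [N [mN N0 PN]]; apply: contrapT => h.
have : (area (box l r) <= area N)%E.
  apply: le_measure; rewrite ?inE//; first exact: measurable_box.
  by move=> z zl; apply: PN => /= Pz; apply: h; exists z.
by rewrite N0 area_box ?(ltW r0)// lee_fin leNgt exprn_gt0// mulr_gt0.
Qed.

(** Replaces [f] by a density bounded everywhere, without changing the measure
    [f eta]. *)
Lemma truncate_density (eta : {finite_measure set (mplane R) -> \bar R})
    (f : R * R -> R[i]) (h : R * R -> R[i]^o) : complex_measurable f ->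
  {ae eta, forall w, normc (f w) <= 1} -> continuous_cauchy_transform eta f h ->
  exists f' : R * R -> R[i], [/\ complex_measurable f', forall w, normc (f' w) <= 1 &
    represents eta f' h].
Proof.
move=> mf f1 hf.
pose S : set (mplane R) := [set w | normc (f w) <= 1].
have mS : measurable S.
  have mn : measurable_fun setT (fun w : mplane R => normc (f w)) by exact: measurable_normc.
  have := mn measurableT `]-oo, 1]%classic (measurable_itv _).
  by rewrite setTI; congr (measurable _); apply/seteqP; split => w /=; rewrite in_itv.
pose f' w := f w * (\1_S w : R)%:C%C.
have mf' : cmeas (f' : mplane R -> R[i]).
  by apply: cmeasM => //; apply: cmeas_real; exact: measurable_indic.
exists f'; split => //.
  move=> w; rewrite normcM normc_real indicE.
  have [/set_mem wS|_] := boolP (w \in S); last by rewrite normr0 mulr0.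
  by rewrite normr1 mulr1.
apply: aeS (cauchy_rep mf f1 hf) => z hz iz; rewrite (hz iz).
apply: cint_ae.
- by apply: cmeasM => //; exact: cmeas_kerl.
- by apply: cmeasM => //; exact: cmeas_kerl.
apply: aeS f1 => w wS; rewrite /f' indicE mem_set//=.
by rewrite mulr1.
Qed.

(** The oscillation [om] is chosen first; it fixes the radius [rho] up to which
    the growth estimate is used, and the mesh [d] is then taken so small that
    the contribution from beyond [rho] is negligible. *)
Lemma uniform_approx (K : set (R * R)) (eta : {finite_measure set (mplane R) -> \bar R})
    (f : R * R -> R[i]) (g h : R * R -> R[i]^o) (e : R) :
  compact K -> compact (measure_support eta) -> complex_measurable f ->
  (forall w, normc (f w) <= 1) -> continuous g -> continuous h ->
  represents eta f h -> represents eta (cst 1) g -> 0 < e ->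
  exists2 phi : R * R -> R[i], smooth_compact_support phi &
    forall l, K l -> normc (h l - vitushkin phi g l) <= e.
Proof.
move=> cK cS mf f1 cg ch rh rg e0.
have [rK rK0 KrK] := compact_in_box cK.
have [r0 r00 etar0] := support_box cS.
have [M M0 HM] := window_cutoff R.
have [G G0 HG] := growth cg rg.
pose m := \int[eta]_w (1 : R).
have m0 : 0 <= m by apply: Rintegral_ge0.
(* near and far contributions that are proportional to [om] *)
pose Q := 81 * (120 * M) + 96 * G.
have Q0 : 0 < Q by rewrite addr_gt0// !mulr_gt0.
pose om := e / (6 * Q).
have om0 : 0 < om by rewrite divr_gt0// mulr_gt0.
have [d1 d10 hd1] := ccontinuous_unif (rK + 1) cg om0.
have [d2 d20 hd2] := ccontinuous_unif (rK + 1) ch om0.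
(* cells near [l] reach distance [5 * d], and growth looks up to [4 * rho] *)
pose rho := Num.min d1 d2 / 5.
have rho0 : 0 < rho by rewrite divr_gt0// lt_min d10.
(* 144 = 24 * 6: the contribution from beyond [rho] is at most [e / 6] *)
pose d := Num.min rho (e * rho ^+ 2 / (144 * (m + 1))).
have m1 : 0 < m + 1 by rewrite ltr_wpDl.
have d0 : 0 < d.
  rewrite lt_min rho0 /=; apply: divr_gt0; last exact: mulr_gt0.
  by apply: mulr_gt0 => //; rewrite exprn_gt0.
have drho : d <= rho by rewrite ge_min lexx.
have r51 : 5 * rho <= d1 by rewrite /rho mulrC divfK// ge_min lexx.
have r52 : 5 * rho <= d2 by rewrite /rho mulrC divfK// ge_min lexx orbT.
pose n := (Num.truncn (d^-1 * (2 * r0 + d))).+1.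
have nd : 2 * r0 + d <= d * n%:R.
  by rewrite -ler_pdivrMl//; apply: ltW; exact: truncnS_gt.
pose phi := grid_approx eta f r0 d n.
have cV := @continuous_vitushkin_grid R eta f g cg M HM r0 d n d0.
exists phi; first exact: (@smooth_grid_approx R eta f M HM r0 d n d0).
have good l : dist l (0, 0) <= rK + 1 -> cL1 eta (fun w => ker w l) ->
    h l = cint eta (fun w => f w * ker w l) ->
    g l = cint eta (fun w => cst 1 w * ker w l) ->
    normc (h l - vitushkin phi g l) <= e / 3.
  move=> lr il hl gl.
  have d5 : 5 * d <= 5 * rho by rewrite ler_pM2l.
  have := @grid_estimate R eta f h g mf f1 ch cg rh rg M HM r0 d n d0 nd etar0
    l il hl gl om (ltW om0)
    (fun z zl => hd2 l z lr (le_trans zl (le_trans d5 r52)))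
    (fun z zl => hd1 l z lr (le_trans zl (le_trans d5 r51))).
  move=> h1; apply: (le_trans h1).
  have := @far_estimate R eta G om l d rho (ltW G0) (ltW om0) d0 drho.
  move=> h2; have {}h2 := h2 _.
  have h3 : \int[eta]_w kappa l d w <= 4 * (G * om) + d / rho ^+ 2 * m.
    apply: h2 => s s0 sr; apply: HG => //; first exact: ltW.
    by move=> z zl; apply: hd1 => //; apply: (le_trans zl); lra.
  have h4 : d / rho ^+ 2 * m <= e / 144.
    have rr : 0 < rho ^+ 2 by rewrite exprn_gt0.
    rewrite mulrAC ler_pdivrMr//.
    apply: (@le_trans _ _ (d * (m + 1))); first by rewrite ler_pM2l// lerDl.
    apply: (@le_trans _ _ (e * rho ^+ 2 / (144 * (m + 1)) * (m + 1))).
      by rewrite ler_pM2r// ge_min lexx orbT.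
    by rewrite le_eqVlt; apply/orP; left; apply/eqP; field; rewrite gt_eqF.
  have h5 : om * Q = e / 6 by rewrite /om; field; rewrite gt_eqF.
  have h6 : om * Q = 81 * (120 * om * M) + 96 * (G * om) by rewrite /Q; ring.
  by move: h3 h4 h5; rewrite h6; lra.
move=> l Kl.
have e3 : 0 < e / 3 by rewrite divr_gt0.
have [s1 s10 hs1] := (ccontinuousP h l).1 (ch l) _ e3.
have [s2 s20 hs2] := (ccontinuousP _ l).1 (cV l) _ e3.
have s0 : 0 < Num.min 1 (Num.min s1 s2) by rewrite !lt_min ltr01 s10.
(* a point close to [l] at which the almost everywhere identities hold *)
have [l' l'l [[iz hz] gz]] := ae_box l s0 (aeI (aeI (potential_ae eta) rh) rg).
move: l'l; rewrite !le_min => /andP[l1 /andP[l2 l3]].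
have lr : dist l' (0, 0) <= rK + 1.
  by apply: (le_trans (dist_tri l l' _)); rewrite addrC lerD// KrK.
have E := good l' lr iz (hz iz) (gz iz).
have -> : h l - vitushkin phi g l = (h l - h l') + (h l' - vitushkin phi g l') +
    (vitushkin phi g l' - vitushkin phi g l) by ring.
have -> : e = e / 3 + e / 3 + e / 3 by field.
apply: (le_trans (ler_normcD _ _)); apply: lerD; last exact: hs2.
apply: (le_trans (ler_normcD _ _)); apply: lerD => //.
by rewrite normcB; exact: hs1.
Qed.

End main.

Theorem corollary3p4 (R : realType) (K : set (R * R)) (hK : compact K)
    (eta : {finite_measure set (mplane R) -> \bar R})
    (heta : compact (measure_support eta))
    (Ceta : R * R -> R[i]^o)
    (hCeta : continuous_cauchy_transform eta (cst 1) Ceta)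
    (f : R * R -> R[i]) (mf : complex_measurable f)
    (hf : (Linfty_norm eta f <= 1)%E)
    (Cfeta : R * R -> R[i]^o)
    (hCfeta : continuous_cauchy_transform eta f Cfeta) :
  vitushkin_closure Ceta K Cfeta.
Proof.
have [f' [mf' f'1 rf']] := truncate_density mf (Linfty_ae hf) hCfeta.
have m1 : complex_measurable (cst (1 : R[i])) by exact: cmeas_cst.
have n1 (w : R * R) : normc (cst (1 : R[i]) w) <= 1 by rewrite normc1.
have r1 : represents eta (cst 1) Ceta.
  by apply: (cauchy_rep m1 _ hCeta); exists set0; split => // w /(_ (n1 w)).
split; first exact: continuous_subspaceT hCfeta.1.
move=> B /uniform_nbhs[E [entE EB]].
move: entE; rewrite -entourage_from_ballE => -[[er ei]].
rewrite /= ltcE /= => /andP[/eqP -> er0] ballE.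
have e2 : 0 < er / 2 by rewrite divr_gt0.
have [phi sphi happ] := uniform_approx hK heta mf' f'1 hCeta.1 hCfeta.1 rf' r1 e2.
exists (vitushkin phi Ceta); split; first by exists phi.
apply: EB => z Kz; apply: ballE => /=.
rewrite -ball_normE /ball_ /= normc_norm ltcR.
by apply: (le_lt_trans (happ z Kz)); lra.
Qed.
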